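(* Let $P(x,u)=\prod_{j\ge1}\frac{1}{1-xu^j}$. Fix $x$ with $|x|<1$ and integers $0\le h<k$ with $\gcd(h,k)=1$. Let \[Q_{h,k}(s)=\sum_{m\ge1}\sum_{l\ge1}\frac{x^l e^{2\pi i l m h/k}}{l}(lm)^{-s}\quad(\Re s>1),\] which extends analytically to $\mathbb{C}\setminus\{1\}$ (this extension is used below). Define \[\Psi_k(z)=\frac{\operatorname{Li}_2(x^k)}{2\pi k^2}\,\frac1z,\qquad j_{h,k}(z)=\frac{1}{2\pi i}\int_{-\frac34-i\infty}^{-\frac34+i\infty}Q_{h,k}(s)\,\Gamma(s)\,(2\pi z)^{-s}\,ds,\] \[w_{h,k}=\frac{1}{2k}\ln(1-x^k)+\sum_{l\ge1,\ k\nmid l}\frac{x^l}{l}\,\frac{1}{e^{-2\pi i l h/k}-1}.\] Then there is a neighborhood of $u=e^{2\pi i h/k}$ inside the unit disk on which \[P\!\left(x,e^{2\pi i(h/k+iz)}\right)=e^{w_{h,k}}\,e^{\Psi_k(z)}\,e^{j_{h,k}(z)},\qquad \Re z>0.\]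
   Context: $\operatorname{Li}_2$ is the dilogarithm, $\Gamma$ the Gamma function, $(2\pi z)^{-s}=\exp(-s\log(2\pi z))$ with the principal logarithm, and $\ln$ the principal logarithm. $P(x,u)=\sum_{n\ge0}F_n(x)u^n$ is the generating function of the partition polynomials $F_n(x)=\sum_k p_k(n)x^k$, $p_k(n)$ being the number of partitions of $n$ into exactly $k$ parts. *)

(* Defs.v *)
(* Stdlib real numbers with Coquelicot (complex numbers, series, integrals). *)
From Stdlib Require Export Reals Arith.
From Coquelicot Require Export Coquelicot.

Open Scope R_scope.

Definition Cexp (z : C) : C := (exp (Re z) * cos (Im z), exp (Re z) * sin (Im z)).

(* Principal argument, in (-PI, PI]; the value at 0 is irrelevant. *)
Definition Carg (z : C) : R :=
  if Rle_dec 0 (Im z) then acos (Re z / Cmod z) else - acos (Re z / Cmod z).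

Definition Clog (z : C) : C := (ln (Cmod z), Carg z).

(* Principal complex power; Coquelicot's [Cpow], written [z ^ n], has
   exponents in [nat]. *)
Definition Cpower (z s : C) : C := Cexp (s * Clog z).

(* As with [Lim_seq] and [Series], these are total, and meaningful when the
   sequence (resp. series) converges. *)
Definition Clim_seq (a : nat -> C) : C :=
  (real (Lim_seq (fun n => Re (a n))), real (Lim_seq (fun n => Im (a n)))).

Definition CSeries (a : nat -> C) : C :=
  (Series (fun n => Re (a n)), Series (fun n => Im (a n))).

(* [Cprod a n] is the product of [a 0], ..., [a (n-1)]. *)
Fixpoint Cprod (a : nat -> C) (n : nat) : C :=
  match n with
  | O => RtoC 1
  | S m => (Cprod a m * a m)%C
  end.

(* Euler's limit  n! n^s / (s (s+1) ... (s+n)),  valid for every s other than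
   0, -1, -2, ... *)
Definition CGamma (s : C) : C :=
  Clim_seq (fun n =>
    (RtoC (INR (fact n)) * Cpower (RtoC (INR n)) s
     / Cprod (fun j => s + RtoC (INR j)) (S n))%C).

(* The defining series, for Cmod y <= 1. *)
Definition Li2 (y : C) : C :=
  CSeries (fun n => (y ^ S n / RtoC (INR (S n) ^ 2))%C).

(* exp (2 PI i w) *)
Definition e2pi (w : C) : C := Cexp (RtoC (2 * PI) * Ci * w).

Definition P (x u : C) : C :=
  Clim_seq (Cprod (fun j => RtoC 1 / (RtoC 1 - x * u ^ S j))%C).

Definition hk (h k : nat) : C := RtoC (INR h / INR k).

Definition Qseries (x : C) (h k : nat) (s : C) : C :=
  CSeries (fun m' => CSeries (fun l' =>
    let m := INR (S m') in
    let l := INR (S l') in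
    (x ^ S l' * e2pi (RtoC (l * m) * hk h k) / RtoC l
     * Cpower (RtoC (l * m)) (- s))%C)).

(* Q is the analytic continuation of the double series to C \ {1} (its value
   at 1 is irrelevant).  As C \ {1} is connected, Q is unique there. *)
Definition is_continuation (x : C) (h k : nat) (Q : C -> C) : Prop :=
  (forall s : C, s <> RtoC 1 -> @ex_derive C_AbsRing C_NormedModule Q s) /\
  (forall s : C, 1 < Re s -> Q s = Qseries x h k s).

Definition Psi (x : C) (k : nat) (z : C) : C :=
  (Li2 (x ^ k) / RtoC (2 * PI * INR k ^ 2) * (RtoC 1 / z))%C.

(* The terms with k | l are replaced by 0. *)
Definition w (x : C) (h k : nat) : C :=
  (RtoC (/ (2 * INR k)) * Clog (RtoC 1 - x ^ k)
   + CSeries (fun l' =>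
       let l := S l' in
       if (l mod k =? 0)%nat then RtoC 0
       else x ^ l / RtoC (INR l)
            * (RtoC 1 / (e2pi (- (RtoC (INR l) * hk h k)) - RtoC 1))))%C.

(* The line integral over Re s = -3/4 is parametrised by s = -3/4 + i t,
   ds = i dt. *)
Definition j_integrand (Q : C -> C) (z : C) (t : R) : C :=
  let s : C := (- (3 / 4), t) in
  (Q s * CGamma s * Cpower (RtoC (2 * PI) * z) (- s) * Ci)%C.

Definition j_converges (Q : C -> C) (z : C) : Prop :=
  @ex_RInt_gen C_R_NormedModule (j_integrand Q z)
    (Rbar_locally m_infty) (Rbar_locally p_infty).

Definition j (Q : C -> C) (z : C) : C :=
  (RtoC 1 / (RtoC (2 * PI) * Ci)
   * @RInt_gen C_R_CompleteNormedModule (j_integrand Q z)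
       (Rbar_locally m_infty) (Rbar_locally p_infty))%C.

(* Main.v *)
(* Write [u = e(h/k) exp (- y)] with [y = 2 PI z]. Expanding the logarithm of the
   product gives [log P = sum_m sum_l (x u^m)^l / l], and the Cahen-Mellin formula
   [exp (- y) = 1/(2 PI i) int Gamma(s) y^(-s) ds] turns this double sum into the
   integral of [Q(s) Gamma(s) y^(-s)] over [Re s = 3/2]. Moving the line to
   [Re s = - 3/4] crosses the poles [s = 1] and [s = 0], whose residues are
   [Psi_k(z)] and [Q(0) = w]. Nothing in this argument needs [u] to be close to
   [e(h/k)], so the neighborhood is the whole plane.

   Splitting the sum over [m] into residue classes mod [k] expresses [Q] through
   Hurwitz zeta functions, and these are continued by
     (s - 1) zeta(s, a) = a^(1-s) + (s - 1) int_0^1 (1 - g) s zeta(s + 1, a + g) dg,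
   which also yields their polynomial growth in vertical strips and their values
   at [s = 0] and [s = 1]. The decay [exp (- PI |t| / 2)] of [Gamma] comes from
   comparing the logarithm of Euler's product with an integral. *)

Require Import Defs.
From Stdlib Require Import Lra Lia ZArith.

(** What makes every line integral converge is that [Re z > 0] forces [|arg y| < PI / 2]: [y^(-s)]
    grows at most like [exp (|arg y| |t|)], strictly slower than [Gamma] decays, and the gap absorbs
    the polynomial growth of [Q]. The proof therefore carries a logarithm [L] of [y]: the powers
    [(l m y)^(-s)] are [exp (- s (L + ln l + ln m))], with one and the same imaginary part of the
    logarithm, so one bound serves all terms and no branch has to be tracked. [Q(s) Gamma(s) y^(-s)]
    is written as [N(s) / (s (s - 1))] with [N] holomorphic for [Re s > -1]; by partial fractions
    the two residues are [N(1)] and [- N(0)], and [-3/4] lies between the poles [0] and [-1] of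
    [Gamma]. [Gamma] is a limit and zeta a parametric integral, so holomorphy must survive both
    operations. It is carried through them by an inequality between the values at three points,
    linear in the function, whose constant comes from Cauchy estimates. Cauchy's formula in turn
    comes from differentiating a circle integral with respect to the radius, and lines are moved by
    differentiating with respect to the abscissa. *)

(** * Elementary facts about complex numbers and the modulus *)

Lemma Ceq_parts (a b : C) : Re a = Re b -> Im a = Im b -> a = b.
Proof. destruct a, b; simpl; intros; subst; reflexivity. Qed.

Lemma Cmod_minus_sym (a b : C) : Cmod (a - b) = Cmod (b - a).
Proof. rewrite <- Cmod_opp. f_equal. ring. Qed.

Lemma im_le_Cmod (c : C) : Rabs (Im c) <= Cmod c.
Proof.
  unfold Im. eapply Rle_trans; [| apply Rmax_Cmod]. apply Rmax_r.
Qed.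

Lemma Cmod_le_parts (c : C) : Cmod c <= Rabs (Re c) + Rabs (Im c).
Proof.
  replace c with (RtoC (Re c) + Ci * RtoC (Im c))%C at 1
    by (apply Ceq_parts; simpl; ring).
  eapply Rle_trans; [apply Cmod_triangle|].
  rewrite Cmod_mult, !Cmod_R, Cmod_Ci. lra.
Qed.

Lemma Cmod_diag (a : C) : Cmod (a - a) = 0.
Proof. unfold Cminus. rewrite Cplus_opp_r. apply Cmod_0. Qed.

Lemma Cmod_triangle_minus (a b : C) : Cmod (a - b) <= Cmod a + Cmod b.
Proof.
  unfold Cminus. eapply Rle_trans; [apply Cmod_triangle|]. rewrite Cmod_opp. lra.
Qed.

Lemma Cmod_triangle_dist (a b c : C) : Cmod (a - c) <= Cmod (a - b) + Cmod (b - c).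
Proof.
  replace (a - c)%C with ((a - b) + (b - c))%C by ring. apply Cmod_triangle.
Qed.

Lemma Cmod_sub_lower (a b : C) : Cmod a - Cmod b <= Cmod (a - b).
Proof.
  assert (H := Cmod_triangle (a - b) b). replace (a - b + b)%C with a in H by ring. lra.
Qed.

Lemma Cmod_sum_lower (a b : C) : Cmod a - Cmod b <= Cmod (a + b).
Proof.
  assert (H := Cmod_sub_lower a (- b)). rewrite Cmod_opp in H.
  replace (a - - b)%C with (a + b)%C in H by ring. lra.
Qed.

Lemma re_minus (a b : C) : Re (a - b) = Re a - Re b.
Proof. unfold Re; simpl; ring. Qed.

Lemma im_minus (a b : C) : Im (a - b) = Im a - Im b.
Proof. unfold Im; simpl; ring. Qed.

Lemma Cmod_dec (c : C) : Cmod c * Cmod c = Re c * Re c + Im c * Im c.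
Proof. assert (H := Cmod2_alt c). simpl in H. lra. Qed.

Lemma Cmod_small_eq (a b : C) : (forall e, 0 < e -> Cmod (a - b) <= e) -> a = b.
Proof.
  intros H. apply Ceq_minus, Cmod_eq_0. apply Rle_antisym; [|apply Cmod_ge_0].
  apply le_epsilon. intros e He. rewrite Rplus_0_l. auto.
Qed.

Lemma Rbound_pos (x : R) : 0 < Rabs x + 1.
Proof. generalize (Rabs_pos x); lra. Qed.

(** * Differentiation along a real parameter *)

(** Stated on components so that [auto_derive] and real calculus apply directly. *)
Definition cder (f : R -> C) (t : R) (l : C) : Prop :=
  is_derive (fun u => Re (f u)) t (Re l) /\ is_derive (fun u => Im (f u)) t (Im l).

Lemma cder_ext f g t l : (forall u, f u = g u) -> cder f t l -> cder g t l.
Proof.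
  intros E [H1 H2]; split; [apply is_derive_ext with (2 := H1)|apply is_derive_ext with (2 := H2)];
  intros u; rewrite E; reflexivity.
Qed.

Lemma cder_eq f t l m : cder f t l -> l = m -> cder f t m.
Proof. intros H E. rewrite <- E. exact H. Qed.

Lemma cder_plus f g t l m :
  cder f t l -> cder g t m -> cder (fun u => f u + g u)%C t (l + m)%C.
Proof. intros [H1 H2] [H3 H4]; split; simpl; apply @is_derive_plus; assumption. Qed.

Lemma cder_minus f g t l m :
  cder f t l -> cder g t m -> cder (fun u => f u - g u)%C t (l - m)%C.
Proof. intros [H1 H2] [H3 H4]; split; simpl; apply @is_derive_minus; assumption. Qed.

Lemma cder_mult f g t l m :
  cder f t l -> cder g t m -> cder (fun u => f u * g u)%C t (l * g t + f t * m)%C.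
Proof.
  intros [H1 H2] [H3 H4]; split.
  - evar_last.
    { apply (is_derive_ext (fun u => minus (mult (Re (f u)) (Re (g u))) (mult (Im (f u)) (Im (g u))))).
      { intros u. reflexivity. }
      apply @is_derive_minus; apply @is_derive_mult; try eassumption; intros; apply Rmult_comm. }
    unfold minus, plus, opp, mult; simpl. unfold mult; simpl. unfold Re, Im; ring.
  - evar_last.
    { apply (is_derive_ext (fun u => plus (mult (Re (f u)) (Im (g u))) (mult (Im (f u)) (Re (g u))))).
      { intros u. reflexivity. }
      apply @is_derive_plus; apply @is_derive_mult; try eassumption; intros; apply Rmult_comm. }
    unfold minus, plus, opp, mult; simpl. unfold mult; simpl. unfold Re, Im; ring.
Qed.

Lemma cder_const c t : cder (fun _ => c) t 0%C.
Proof. split; apply @is_derive_const. Qed.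

Lemma cder_scal (c : C) (t : R) : cder (fun u => RtoC u * c)%C t c.
Proof. split; unfold Re, Im; simpl; auto_derive; trivial; ring. Qed.

Lemma cder_Cexp_line (c : C) (t : R) : cder (fun u => Cexp (RtoC u * c)) t (c * Cexp (RtoC t * c))%C.
Proof.
  destruct c as [a b]; split; unfold Cexp, Re, Im; simpl; auto_derive; trivial; rewrite ?Rmult_0_l, ?Ropp_0, ?Rminus_0_r, ?Rplus_0_r; ring.
Qed.

Lemma cder_RtoC (f : R -> R) (t l : R) : is_derive f t l -> cder (fun u => RtoC (f u)) t (RtoC l).
Proof.
  intros H. split.
  - apply (is_derive_ext f); [reflexivity|exact H].
  - change (is_derive (fun _ : R => 0) t 0). auto_derive; trivial.
Qed.

(** The real mean value theorem is applied to the projection of [f] on the direction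
    [c = f b - f a], whose increment is [|c|^2]; the projected derivative is at most [|c| M]. *)
Lemma mean_value_le (f f' : R -> C) (a b M : R) :
  a <= b -> (forall t, a <= t <= b -> cder f t (f' t)) ->
  (forall t, a <= t <= b -> Cmod (f' t) <= M) -> Cmod (f b - f a) <= M * (b - a).
Proof.
  intros Hab Hd HM.
  destruct (Req_dec a b) as [E|E].
  { subst. replace (f b - f b)%C with (RtoC 0) by ring. rewrite Cmod_0. lra. }
  set (c := (f b - f a)%C).
  pose (psi := fun t => Re c * Re (f t) + Im c * Im (f t)).
  destruct (MVT_cor2 psi (fun t => Re c * Re (f' t) + Im c * Im (f' t)) a b) as [x [Hx Hx2]].
  { lra. }
  { intros t Ht. destruct (Hd t Ht) as [H1 H2].
    apply is_derive_Reals. unfold psi.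
    apply @is_derive_plus; apply is_derive_scal; assumption. }
  assert (E1 : psi b - psi a = Cmod c * Cmod c).
  { rewrite Cmod_dec. unfold psi, c. rewrite re_minus, im_minus. ring. }
  assert (E2 : Re c * Re (f' x) + Im c * Im (f' x) <= Cmod c * M).
  { eapply Rle_trans with (Cmod c * Cmod (f' x)).
    - replace (Re c * Re (f' x) + Im c * Im (f' x)) with (Re (Cconj c * f' x)%C)
        by (simpl; unfold Re, Im; simpl; ring).
      eapply Rle_trans; [apply Rle_abs|]. eapply Rle_trans; [apply re_le_Cmod|].
      rewrite Cmod_mult, Cmod_conj. lra.
    - apply Rmult_le_compat_l; [apply Cmod_ge_0|]. apply HM. lra. }
  rewrite E1 in Hx.
  destruct (Cmod_ge_0 c) as [Hc|Hc]; [|rewrite <- Hc; specialize (HM x); generalize (Cmod_ge_0 (f' x)); nra].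
  apply Rmult_le_reg_l with (Cmod c); [assumption|].
  rewrite Hx. rewrite <- Rmult_assoc. apply Rmult_le_compat_r; lra.
Qed.

(** * The complex exponential and logarithm *)

Lemma Cexp_plus (a b : C) : Cexp (a + b) = (Cexp a * Cexp b)%C.
Proof.
  unfold Cexp. apply Ceq_parts; unfold Re, Im; simpl; rewrite exp_plus, ?cos_plus, ?sin_plus; ring.
Qed.

Lemma Cexp_0 : Cexp 0 = RtoC 1.
Proof. unfold Cexp; apply Ceq_parts; simpl; rewrite exp_0, ?cos_0, ?sin_0; ring. Qed.

Lemma Cmod_Cexp (a : C) : Cmod (Cexp a) = exp (Re a).
Proof.
  assert (H := Cmod_dec (Cexp a)). unfold Cexp in H at 3 4 5 6. unfold Re at 2 4, Im at 2 4 in H. simpl in H.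
  assert (Hs := sin2_cos2 (Im a)). unfold Rsqr in Hs.
  assert (He := exp_pos (Re a)). assert (Hc := Cmod_ge_0 (Cexp a)).
  assert (Cmod (Cexp a) * Cmod (Cexp a) = exp (Re a) * exp (Re a)).
  { rewrite H. unfold Re, Im in *. simpl. 
    transitivity (exp (fst a) * exp (fst a) * (sin (snd a) * sin (snd a) + cos (snd a) * cos (snd a))).
    ring. rewrite Hs. ring. }
  nra.
Qed.

Lemma Cexp_neq_0 (a : C) : Cexp a <> RtoC 0.
Proof. apply Cmod_gt_0. rewrite Cmod_Cexp. apply exp_pos. Qed.

Lemma Cexp_opp (a : C) : Cexp (- a) = (/ Cexp a)%C.
Proof.
  assert (H : (Cexp (- a) * Cexp a = 1)%C).
  { rewrite <- Cexp_plus. replace (- a + a)%C with (RtoC 0) by ring. apply Cexp_0. }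
  rewrite <- (Cmult_1_r (Cexp (- a))). rewrite <- (Cinv_r (Cexp a)) by apply Cexp_neq_0.
  rewrite Cmult_assoc, H. ring.
Qed.

Lemma Cexp_nat (a : C) (n : nat) : Cexp (RtoC (INR n) * a) = (Cexp a ^ n)%C.
Proof.
  induction n.
  - simpl. rewrite Cmult_0_l. apply Cexp_0.
  - rewrite S_INR, RtoC_plus, Cmult_plus_distr_r, Cexp_plus, IHn, Cmult_1_l, Cpow_S. ring.
Qed.

Lemma Cexp_R (r : R) : Cexp (RtoC r) = RtoC (exp r).
Proof. unfold Cexp. apply Ceq_parts; simpl; rewrite ?cos_0, ?sin_0; ring. Qed.

Lemma Cexp_2PI_int (n : nat) : Cexp (RtoC (2 * PI * INR n) * Ci) = RtoC 1.
Proof.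
  replace (RtoC (2 * PI * INR n) * Ci)%C with (RtoC (INR n) * (RtoC (2 * PI) * Ci))%C.
  - rewrite Cexp_nat. replace (Cexp (RtoC (2 * PI) * Ci)) with (RtoC 1). apply Cpow_1_l.
    apply Ceq_parts; unfold Cexp, Re, Im; simpl;
    replace (2 * PI * 0 - 0 * 1) with 0 by ring; replace (2 * PI * 1 + 0 * 0) with (2 * PI) by ring;
    rewrite exp_0, ?cos_2PI, ?sin_2PI; ring.
  - rewrite (RtoC_mult (2 * PI)). ring.
Qed.

Lemma exp_le_compat (a b : R) : a <= b -> exp a <= exp b.
Proof. intros [H|H]; [left; apply exp_increasing; assumption|subst; lra]. Qed.

Lemma Cexp_minus_1_le (v : C) : Cmod (Cexp v - 1) <= Cmod v * exp (Cmod v).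
Proof.
  assert (H := mean_value_le (fun u => Cexp (RtoC u * v)) (fun t => v * Cexp (RtoC t * v))%C 0 1
     (Cmod v * exp (Cmod v))).
  cbv beta in H. rewrite Cmult_0_l, Cexp_0, Cmult_1_l in H.
  eapply Rle_trans; [apply H|right; ring].
  - lra.
  - intros. apply cder_Cexp_line.
  - intros t Ht. rewrite Cmod_mult, Cmod_Cexp. apply Rmult_le_compat_l; [apply Cmod_ge_0|].
    apply exp_le_compat. eapply Rle_trans; [apply Rle_abs|]. eapply Rle_trans; [apply re_le_Cmod|].
    rewrite Cmod_mult, Cmod_R, Rabs_pos_eq by lra. generalize (Cmod_ge_0 v); nra.
Qed.

Lemma Cexp_taylor_2 (v : C) : Cmod (Cexp v - 1 - v) <= Cmod v ^ 2 * exp (Cmod v).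
Proof.
  assert (H := mean_value_le (fun u => Cexp (RtoC u * v) - RtoC u * v)%C
     (fun t => v * Cexp (RtoC t * v) - v)%C 0 1 (Cmod v ^ 2 * exp (Cmod v))).
  cbv beta in H. rewrite !Cmult_0_l, Cexp_0, !Cmult_1_l in H.
  replace (Cexp v - 1 - v)%C with (Cexp v - v - (RtoC 1 - RtoC 0))%C by ring.
  eapply Rle_trans; [apply H|right; ring].
  - lra.
  - intros. apply cder_minus; [apply cder_Cexp_line|apply cder_scal].
  - intros t Ht. replace (v * Cexp (t * v) - v)%C with (v * (Cexp (t * v) - 1))%C by ring.
    rewrite Cmod_mult. simpl. rewrite Rmult_1_r, Rmult_assoc.
    apply Rmult_le_compat_l; [apply Cmod_ge_0|].
    eapply Rle_trans; [apply Cexp_minus_1_le|].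
    assert (Cmod (t * v) <= Cmod v).
    { rewrite Cmod_mult, Cmod_R, Rabs_pos_eq by lra. generalize (Cmod_ge_0 v); nra. }
    apply Rmult_le_compat; try apply Cmod_ge_0; [left; apply exp_pos|assumption|].
    apply exp_le_compat; assumption.
Qed.

Lemma Carg_R_pos (u : R) : 0 < u -> Carg (RtoC u) = 0.
Proof.
  intros H. unfold Carg. simpl. destruct (Rle_dec 0 0); [|lra].
  rewrite Cmod_R, Rabs_pos_eq by lra. unfold Rdiv. rewrite Rinv_r by lra. apply acos_1.
Qed.

Lemma Cpower_R_pos (u : R) (s : C) : 0 < u -> Cpower (RtoC u) s = Cexp (s * RtoC (ln u)).
Proof.
  intros H. unfold Cpower, Clog. rewrite Carg_R_pos by assumption.
  rewrite Cmod_R, Rabs_pos_eq by lra. reflexivity.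
Qed.

Lemma Clog_Cexp (v : C) : - PI < Im v < PI -> Clog (Cexp v) = v.
Proof.
  intros H. unfold Clog. rewrite Cmod_Cexp, ln_exp. apply Ceq_parts; simpl; [reflexivity|].
  unfold Carg. rewrite Cmod_Cexp. unfold Cexp, Re at 1 3, Im at 1; simpl.
  assert (He := exp_pos (Re v)).
  replace (exp (Re v) * cos (Im v) / exp (Re v)) with (cos (Im v)) by (field; lra).
  destruct (Rle_dec 0 (Im v)) as [Hi|Hi].
  - assert (Hs : 0 <= sin (Im v)) by (apply sin_ge_0; lra).
    destruct (Rle_dec 0 (exp (Re v) * sin (Im v))) as [_|K]; [|exfalso; apply K; nra].
    apply acos_cos; lra.
  - assert (Hs : sin (Im v) < 0) by (apply sin_lt_0_var; lra).
    destruct (Rle_dec 0 (exp (Re v) * sin (Im v))) as [K|_]; [exfalso; nra|].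
    rewrite <- cos_neg, acos_cos; lra.
Qed.

Lemma Cmod_right_half_pos (w : C) : 0 < Re w -> 0 < Cmod w.
Proof.
  intros H. eapply Rlt_le_trans; [apply H|]. eapply Rle_trans; [apply Rle_abs|apply re_le_Cmod].
Qed.

Lemma Cexp_polar_right_half (w : C) : 0 < Re w -> Cexp (ln (Cmod w), atan (Im w / Re w)) = w.
Proof.
  intros H. assert (Hm := Cmod_right_half_pos w H).
  unfold Cexp. simpl. rewrite exp_ln by assumption.
  set (q := Im w / Re w).
  assert (Hq : sqrt (1 + q²) = Cmod w / Re w).
  { apply sqrt_lem_1.
    - assert (0 <= q²) by apply Rle_0_sqr. lra.
    - apply Rlt_le, Rdiv_lt_0_compat; assumption.
    - unfold q, Rsqr. transitivity ((Cmod w * Cmod w) / (Re w * Re w)); [field; lra|].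
      rewrite Cmod_dec. field; lra. }
  rewrite cos_atan, sin_atan, Hq. unfold q. apply Ceq_parts; simpl; field; lra.
Qed.

(** The arctangent form of the argument can be differentiated on the whole right half plane, whereas
    the [acos] of [Carg] sits at an endpoint of its domain on the positive real axis. *)
Lemma Clog_right_half (w : C) : 0 < Re w -> Clog w = (ln (Cmod w), atan (Im w / Re w)).
Proof.
  intros H. rewrite <- (Cexp_polar_right_half w H) at 1. apply Clog_Cexp.
  simpl. assert (A := atan_bound (Im w / Re w)). lra.
Qed.

Lemma Cexp_Clog_right_half (w : C) : 0 < Re w -> Cexp (Clog w) = w.
Proof. intros H. rewrite Clog_right_half by assumption. apply Cexp_polar_right_half, H. Qed.

Lemma Clog_right_half_im (w : C) : 0 < Re w -> Rabs (Im (Clog w)) < PI / 2.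
Proof.
  intros H. rewrite Clog_right_half by assumption. simpl.
  assert (A := atan_bound (Im w / Re w)). apply Rabs_def1; lra.
Qed.

(** * Limits of complex sequences *)

Definition Ccv (u : nat -> C) (l : C) : Prop :=
  forall e, 0 < e -> exists N, forall n, (N <= n)%nat -> Cmod (u n - l) < e.

Lemma Ccv_parts (u : nat -> C) (l : C) :
  Ccv u l <-> is_lim_seq (fun n => Re (u n)) (Re l) /\ is_lim_seq (fun n => Im (u n)) (Im l).
Proof.
  split.
  - intros H; split; apply is_lim_seq_spec; intros e; destruct (H e (cond_pos e)) as [N HN];
    exists N; intros n Hn; specialize (HN n Hn).
    + eapply Rle_lt_trans; [|apply HN]. rewrite <- re_minus. apply re_le_Cmod.
    + eapply Rle_lt_trans; [|apply HN]. rewrite <- im_minus. apply im_le_Cmod.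
  - intros [H1 H2] e He. apply is_lim_seq_spec in H1. apply is_lim_seq_spec in H2.
    assert (He2 : 0 < e / 2) by lra.
    destruct (H1 (mkposreal _ He2)) as [N1 HN1]. destruct (H2 (mkposreal _ He2)) as [N2 HN2].
    exists (Nat.max N1 N2). intros n Hn.
    specialize (HN1 n ltac:(lia)). specialize (HN2 n ltac:(lia)). simpl in HN1, HN2.
    eapply Rle_lt_trans; [apply Cmod_le_parts|]. rewrite re_minus, im_minus. lra.
Qed.

Lemma Ccv_Clim_seq (u : nat -> C) (l : C) : Ccv u l -> Clim_seq u = l.
Proof.
  intros H. apply Ccv_parts in H. destruct H as [H1 H2].
  unfold Clim_seq. rewrite (is_lim_seq_unique _ _ H1), (is_lim_seq_unique _ _ H2).
  apply Ceq_parts; reflexivity.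
Qed.

Lemma Ccv_unique (u : nat -> C) (l m : C) : Ccv u l -> Ccv u m -> l = m.
Proof. intros H1 H2. rewrite <- (Ccv_Clim_seq _ _ H1). apply Ccv_Clim_seq; assumption. Qed.

Lemma Ccv_eq (u : nat -> C) (l m : C) : Ccv u l -> l = m -> Ccv u m.
Proof. intros H E. rewrite <- E. exact H. Qed.

Lemma Ccv_const (c : C) : Ccv (fun _ => c) c.
Proof.
  intros e He. exists O. intros. rewrite Cmod_diag. exact He.
Qed.

Lemma Ccv_ext_loc (u v : nat -> C) (l : C) N :
  (forall n, (N <= n)%nat -> u n = v n) -> Ccv u l -> Ccv v l.
Proof.
  intros E H e He. destruct (H e He) as [N1 H1]. exists (Nat.max N N1).
  intros n Hn. rewrite <- E by lia. apply H1. lia.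
Qed.

Lemma Ccv_ext (u v : nat -> C) (l : C) : (forall n, u n = v n) -> Ccv u l -> Ccv v l.
Proof. intros E. apply (Ccv_ext_loc u v l 0). intros; apply E. Qed.

Lemma Ccv_le (u : nat -> C) (l : C) (g : nat -> R) N :
  (forall n, (N <= n)%nat -> Cmod (u n - l) <= g n) -> is_lim_seq g 0 -> Ccv u l.
Proof.
  intros H Hg e He. apply is_lim_seq_spec in Hg. destruct (Hg (mkposreal e He)) as [M HM].
  exists (Nat.max M N). intros n Hn. eapply Rle_lt_trans; [apply H; lia|].
  specialize (HM n ltac:(lia)). simpl in HM. rewrite Rminus_0_r in HM.
  eapply Rle_lt_trans; [apply Rle_abs|exact HM].
Qed.

Lemma Ccv_plus u v l m : Ccv u l -> Ccv v m -> Ccv (fun n => u n + v n)%C (l + m)%C.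
Proof.
  rewrite !Ccv_parts. intros [H1 H2] [H3 H4]. split.
  - apply (is_lim_seq_ext (fun n => Re (u n) + Re (v n))); [reflexivity|]. rewrite re_plus.
    apply is_lim_seq_plus'; assumption.
  - apply (is_lim_seq_ext (fun n => Im (u n) + Im (v n))); [reflexivity|]. rewrite im_plus.
    apply is_lim_seq_plus'; assumption.
Qed.

Lemma Ccv_mult u v l m : Ccv u l -> Ccv v m -> Ccv (fun n => u n * v n)%C (l * m)%C.
Proof.
  rewrite !Ccv_parts. intros [H1 H2] [H3 H4]. split.
  - apply (is_lim_seq_ext (fun n => Re (u n) * Re (v n) - Im (u n) * Im (v n))); [reflexivity|].
    rewrite re_mult. apply is_lim_seq_minus'; apply is_lim_seq_mult'; assumption.
  - apply (is_lim_seq_ext (fun n => Re (u n) * Im (v n) + Im (u n) * Re (v n))); [reflexivity|].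
    rewrite im_mult. apply is_lim_seq_plus'; apply is_lim_seq_mult'; assumption.
Qed.

Lemma Ccv_scal u l c : Ccv u l -> Ccv (fun n => c * u n)%C (c * l)%C.
Proof. intros H. apply (Ccv_mult (fun _ => c)); [apply Ccv_const|exact H]. Qed.

Lemma Ccv_minus u v l m : Ccv u l -> Ccv v m -> Ccv (fun n => u n - v n)%C (l - m)%C.
Proof.
  intros H1 H2. apply (Ccv_ext (fun n => u n + (- (1)) * v n)%C).
  { intros; ring. }
  replace (l - m)%C with (l + (- (1)) * m)%C by ring.
  apply Ccv_plus; [assumption|apply Ccv_scal; assumption].
Qed.

Lemma Ccv_Cmod u l : Ccv u l -> is_lim_seq (fun n => Cmod (u n)) (Cmod l).
Proof.
  intros H. apply is_lim_seq_spec. intros e. destruct (H e (cond_pos e)) as [N HN].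
  exists N. intros n Hn. specialize (HN n Hn).
  assert (A := Cmod_sub_lower (u n) l). assert (B := Cmod_sub_lower l (u n)).
  rewrite Cmod_minus_sym in B. apply Rabs_def1; lra.
Qed.

Lemma Ccv_Cmod_le u l M : Ccv u l -> (forall n, Cmod (u n) <= M) -> Cmod l <= M.
Proof.
  intros H HM. apply (is_lim_seq_le (fun n => Cmod (u n)) (fun _ => M) (Cmod l) M); try assumption.
  - apply Ccv_Cmod; assumption.
  - apply is_lim_seq_const.
Qed.

Lemma Ccv_incr_1 u l : Ccv (fun n => u (S n)) l -> Ccv u l.
Proof.
  intros H e He. destruct (H e He) as [N HN]. exists (S N). intros n Hn.
  destruct n; [lia|]. apply HN. lia.
Qed.

Lemma Ccauchy_cv (u : nat -> C) :
  (forall e, 0 < e -> exists N, forall n m, (N <= n)%nat -> (N <= m)%nat -> Cmod (u n - u m) < e) ->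
  exists l, Ccv u l.
Proof.
  intros H.
  assert (H1 : ex_finite_lim_seq (fun n => Re (u n))).
  { apply ex_lim_seq_cauchy_corr. intros e. destruct (H e (cond_pos e)) as [N HN]. exists N.
    intros n m Hn Hm. rewrite <- re_minus. eapply Rle_lt_trans; [apply re_le_Cmod|apply HN; assumption]. }
  assert (H2 : ex_finite_lim_seq (fun n => Im (u n))).
  { apply ex_lim_seq_cauchy_corr. intros e. destruct (H e (cond_pos e)) as [N HN]. exists N.
    intros n m Hn Hm. rewrite <- im_minus. eapply Rle_lt_trans; [apply im_le_Cmod|apply HN; assumption]. }
  destruct H1 as [a Ha]. destruct H2 as [b Hb]. exists (a, b). apply Ccv_parts. split; assumption.
Qed.

(** * Holomorphic functions *)

(* A quadratic remainder, uniform near [s], is equivalent to holomorphy near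
   [s]; unlike complex differentiability at each point it gives the continuity
   of the derivative for free, so that no Goursat argument is needed. *)
Definition holo_at (f : C -> C) (s : C) : Prop :=
  exists (f' : C -> C) (K d : R), 0 < d /\
    forall a b, Cmod (a - s) < d -> Cmod (b - s) < d ->
      Cmod (f b - f a - f' a * (b - a)) <= K * Cmod (b - a) ^ 2.

(** Up to sign, the left side is the second divided difference of [f] times [(b - c)(c - a)(a - b)],
    so this bounds that divided difference by [K] without dividing. It is linear in [f] and involves
    only its values, hence passes to pointwise limits and to integrals. *)
Definition three_point (f : C -> C) (K : R) (a b c : C) : Prop :=
  Cmod (f a * (b - c) + f b * (c - a) + f c * (a - b))
  <= K * (Cmod (b - c) * Cmod (c - a) * Cmod (a - b)).

Definition Ccont (f : C -> C) (s : C) : Prop :=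
  forall e, 0 < e -> exists d, 0 < d /\ forall b, Cmod (b - s) < d -> Cmod (f b - f s) < e.

Lemma is_derive_quadratic (f : C -> C) (a l : C) (K d : R) : 0 < d ->
  (forall b, Cmod (b - a) < d -> Cmod (f b - f a - l * (b - a)) <= K * Cmod (b - a) ^ 2) ->
  @is_derive C_AbsRing C_NormedModule f a l.
Proof.
  intros Hd H. split; [apply is_linear_scal_l|].
  intros x Hx. apply (@is_filter_lim_locally_unique C_AbsRing (AbsRing_NormedModule C_AbsRing) a x) in Hx. subst x.
  intros e.
  assert (HK : 0 < Rabs K + 1) by apply Rbound_pos.
  assert (Hm : 0 < Rmin d (e / (Rabs K + 1))).
  { apply Rmin_pos; [assumption|]. apply Rdiv_lt_0_compat; [apply cond_pos|assumption]. }
  exists (mkposreal _ Hm). intros y Hy.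
  change (Cmod (y - a) < Rmin d (e / (Rabs K + 1))) in Hy.
  change (Cmod (f y - f a - (y - a) * l) <= e * Cmod (y - a)).
  assert (H1 : Cmod (y - a) < d) by (eapply Rlt_le_trans; [exact Hy|apply Rmin_l]).
  assert (H2 : Cmod (y - a) < e / (Rabs K + 1)) by (eapply Rlt_le_trans; [exact Hy|apply Rmin_r]).
  rewrite (Cmult_comm _ l). eapply Rle_trans; [apply H; assumption|].
  assert (P := Cmod_ge_0 (y - a)). assert (A := Rle_abs K). assert (A' := Rabs_pos K).
  assert (H3 : Cmod (y - a) * (Rabs K + 1) < e).
  { apply Rmult_lt_reg_r with (/ (Rabs K + 1)); [apply Rinv_0_lt_compat; assumption|].
    rewrite Rmult_assoc, Rinv_r, Rmult_1_r by lra. exact H2. }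
  simpl. rewrite Rmult_1_r, <- Rmult_assoc. apply Rmult_le_compat_r; [assumption|]. nra.
Qed.

(** Gathers, on one ball and with one constant, all the local estimates that later proofs use, and
    identifies the witness of [holo_at] with [C_derive f]. *)
Lemma holo_at_C_derive (f : C -> C) (s : C) : holo_at f s ->
  exists K d, 0 < d <= 1 /\ 0 <= K /\
    (forall a b, Cmod (a - s) < d -> Cmod (b - s) < d ->
       Cmod (f b - f a - C_derive f a * (b - a)) <= K * Cmod (b - a) ^ 2) /\
    (forall a b, Cmod (a - s) < d -> Cmod (b - s) < d ->
       Cmod (C_derive f b - C_derive f a) <= K * Cmod (b - a)) /\
    (forall a b, Cmod (a - s) < d -> Cmod (b - s) < d ->
       Cmod (f b - f a) <= K * Cmod (b - a)) /\
    (forall a, Cmod (a - s) < d -> Cmod (f a) <= K /\ Cmod (C_derive f a) <= K).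
Proof.
  intros (f' & K0 & d0 & Hd & H0).
  set (d := Rmin d0 1). set (K := Rabs K0).
  assert (Hdd : 0 < d <= 1).
  { split; [apply Rmin_pos; lra|apply Rmin_r]. }
  assert (Hd0 : d <= d0) by apply Rmin_l.
  assert (HK : 0 <= K) by apply Rabs_pos.
  assert (E : forall a, Cmod (a - s) < d -> C_derive f a = f' a).
  { intros a Ha. apply is_C_derive_unique.
    apply is_derive_quadratic with K (d - Cmod (a - s)); [lra|].
    intros b Hb. eapply Rle_trans; [apply H0|].
    - lra.
    - eapply Rle_lt_trans; [apply (Cmod_triangle_dist b a s)|]. lra.
    - apply Rmult_le_compat_r; [apply pow_le, Cmod_ge_0|apply Rle_abs]. }
  assert (Q : forall a b, Cmod (a - s) < d -> Cmod (b - s) < d ->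
       Cmod (f b - f a - C_derive f a * (b - a)) <= K * Cmod (b - a) ^ 2).
  { intros a b Ha Hb. rewrite E by assumption.
    eapply Rle_trans; [apply H0; lra|]. apply Rmult_le_compat_r; [apply pow_le, Cmod_ge_0|apply Rle_abs]. }
  (* The expansions from [a] to [b] and from [b] to [a] are added: the values of [f] cancel, which
     leaves the increment of the derivative times [b - a]. *)
  assert (L : forall a b, Cmod (a - s) < d -> Cmod (b - s) < d ->
       Cmod (C_derive f b - C_derive f a) <= 2 * K * Cmod (b - a)).
  { intros a b Ha Hb. destruct (Ceq_dec a b) as [Eab|Nab].
    { subst. rewrite Cmod_diag.
      generalize (Cmod_ge_0 (b - b)); nra. }
    assert (P : 0 < Cmod (b - a)).
    { apply Cmod_gt_0. apply Cminus_eq_contra. auto. }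
    apply Rmult_le_reg_r with (Cmod (b - a)); [assumption|]. rewrite <- Cmod_mult.
    replace ((C_derive f b - C_derive f a) * (b - a))%C with
      ((f b - f a - C_derive f a * (b - a)) + (f a - f b - C_derive f b * (a - b)))%C by ring.
    eapply Rle_trans; [apply Cmod_triangle|].
    assert (Q1 := Q a b Ha Hb). assert (Q2 := Q b a Hb Ha). rewrite (Cmod_minus_sym a b) in Q2. simpl in *. nra. }
  set (D := Cmod (C_derive f s) + 2 * K).
  assert (HD : forall a, Cmod (a - s) < d -> Cmod (C_derive f a) <= D).
  { intros a Ha. replace (C_derive f a) with ((C_derive f a - C_derive f s) + C_derive f s)%C by ring.
    eapply Rle_trans; [apply Cmod_triangle|]. 
    assert (Hs : Cmod (s - s) < d) by (rewrite Cmod_diag; lra).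
    assert (A := L s a Hs Ha). unfold D. nra. }
  assert (HD0 : 0 <= D) by (unfold D; generalize (Cmod_ge_0 (C_derive f s)); lra).
  assert (F : forall a b, Cmod (a - s) < d -> Cmod (b - s) < d ->
       Cmod (f b - f a) <= (2 * K + D) * Cmod (b - a)).
  { intros a b Ha Hb.
    replace (f b - f a)%C with ((f b - f a - C_derive f a * (b - a)) + C_derive f a * (b - a))%C by ring.
    eapply Rle_trans; [apply Cmod_triangle|]. rewrite Cmod_mult.
    assert (A1 := Q a b Ha Hb). assert (A2 := HD a Ha).
    (* The cap [d <= 1] enters here: it turns the quadratic remainder into a linear one. *)
    assert (A3 : Cmod (b - a) <= 2).
    { eapply Rle_trans; [apply (Cmod_triangle_dist b s a)|]. rewrite (Cmod_minus_sym s a). lra. }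
    assert (A4 := Cmod_ge_0 (b - a)).
    assert (K * Cmod (b - a) ^ 2 <= 2 * K * Cmod (b - a)).
    { simpl. rewrite Rmult_1_r. assert (0 <= K * Cmod (b-a)) by (apply Rmult_le_pos; assumption). nra. }
    assert (Cmod (C_derive f a) * Cmod (b - a) <= D * Cmod (b - a)) by (apply Rmult_le_compat_r; assumption).
    lra. }
  assert (B : forall a, Cmod (a - s) < d -> Cmod (f a) <= Cmod (f s) + (2 * K + D)).
  { intros a Ha. replace (f a) with ((f a - f s) + f s)%C by ring.
    eapply Rle_trans; [apply Cmod_triangle|].
    assert (Hs : Cmod (s - s) < d) by (rewrite Cmod_diag; lra).
    assert (A := F s a Hs Ha). generalize (Cmod_ge_0 (a - s)). nra. }
  assert (Hfs := Cmod_ge_0 (f s)).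
  exists (Cmod (f s) + (2 * K + D)), d. split; [assumption|]. split; [lra|].
  repeat split.
  - intros a b Ha Hb. eapply Rle_trans; [apply Q; assumption|].
    apply Rmult_le_compat_r; [apply pow_le, Cmod_ge_0|lra].
  - intros a b Ha Hb. eapply Rle_trans; [apply L; assumption|].
    apply Rmult_le_compat_r; [apply Cmod_ge_0|lra].
  - intros a b Ha Hb. eapply Rle_trans; [apply F; assumption|].
    apply Rmult_le_compat_r; [apply Cmod_ge_0|lra].
  - apply B; assumption.
  - eapply Rle_trans; [apply HD; assumption|]. lra.
Qed.

Lemma holo_at_is_derive (f : C -> C) (s : C) : holo_at f s ->
  @is_derive C_AbsRing C_NormedModule f s (C_derive f s).
Proof.
  intros H. destruct (holo_at_C_derive f s H) as (K & d & Hd & HK & Q & _).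
  apply is_derive_quadratic with K d; [lra|]. intros b Hb. apply Q; [|assumption].
  rewrite Cmod_diag. lra.
Qed.

Lemma Ccont_lipschitz (f : C -> C) (s : C) (K d : R) : 0 < d -> 0 <= K ->
  (forall b, Cmod (b - s) < d -> Cmod (f b - f s) <= K * Cmod (b - s)) -> Ccont f s.
Proof.
  intros Hd HK L e He.
  exists (Rmin d (e / (K + 1))). split.
  { apply Rmin_pos; [assumption|]. apply Rdiv_lt_0_compat; lra. }
  intros b Hb.
  assert (H1 : Cmod (b - s) < d) by (eapply Rlt_le_trans; [exact Hb|apply Rmin_l]).
  assert (H2 : Cmod (b - s) < e / (K + 1)) by (eapply Rlt_le_trans; [exact Hb|apply Rmin_r]).
  eapply Rle_lt_trans; [apply L; assumption|].
  apply Rmult_lt_compat_r with (r := K + 1) in H2; [|lra].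
  replace (e / (K + 1) * (K + 1)) with e in H2 by (field; lra).
  generalize (Cmod_ge_0 (b - s)). nra.
Qed.

Lemma Ccont_C_derive (f : C -> C) (s : C) : holo_at f s -> Ccont (C_derive f) s.
Proof.
  intros H. destruct (holo_at_C_derive f s H) as (K & d & Hd & HK & _ & L & _).
  apply (Ccont_lipschitz _ s K d); [lra|assumption|].
  intros b Hb. apply L; [rewrite Cmod_diag; lra|assumption].
Qed.

Lemma Ccont_holo (f : C -> C) (s : C) : holo_at f s -> Ccont f s.
Proof.
  intros H. destruct (holo_at_C_derive f s H) as (K & d & Hd & HK & _ & _ & L & _).
  apply (Ccont_lipschitz _ s K d); [lra|assumption|].
  intros b Hb. apply L; [rewrite Cmod_diag; lra|assumption].
Qed.

Lemma holo_at_ext_loc (f g : C -> C) (s : C) (d : R) : 0 < d ->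
  (forall a, Cmod (a - s) < d -> f a = g a) -> holo_at f s -> holo_at g s.
Proof.
  intros Hd E (f' & K & d0 & Hd0 & H). exists f', K, (Rmin d d0). split; [apply Rmin_pos; assumption|].
  intros a b Ha Hb. assert (Rmin d d0 <= d) by apply Rmin_l. assert (Rmin d d0 <= d0) by apply Rmin_r.
  rewrite <- !E by lra. apply H; lra.
Qed.

Lemma holo_at_ext (f g : C -> C) (s : C) : (forall a, f a = g a) -> holo_at f s -> holo_at g s.
Proof. intros E. apply (holo_at_ext_loc f g s 1); [lra|auto]. Qed.

Lemma holo_const (c s : C) : holo_at (fun _ => c) s.
Proof.
  exists (fun _ => RtoC 0), 0, 1. split; [lra|]. intros a b _ _.
  replace (c - c - 0 * (b - a))%C with (RtoC 0) by ring. rewrite Cmod_0. lra.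
Qed.

Lemma holo_id (s : C) : holo_at (fun x => x) s.
Proof.
  exists (fun _ => RtoC 1), 0, 1. split; [lra|]. intros a b _ _.
  replace (b - a - 1 * (b - a))%C with (RtoC 0) by ring. rewrite Cmod_0. lra.
Qed.

Lemma holo_plus (f g : C -> C) (s : C) : holo_at f s -> holo_at g s -> holo_at (fun x => f x + g x)%C s.
Proof.
  intros (f' & K1 & d1 & Hd1 & H1) (g' & K2 & d2 & Hd2 & H2).
  exists (fun x => f' x + g' x)%C, (K1 + K2), (Rmin d1 d2). split; [apply Rmin_pos; assumption|].
  intros a b Ha Hb. assert (Rmin d1 d2 <= d1) by apply Rmin_l. assert (Rmin d1 d2 <= d2) by apply Rmin_r.
  replace (f b + g b - (f a + g a) - (f' a + g' a) * (b - a))%C with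
   ((f b - f a - f' a * (b - a)) + (g b - g a - g' a * (b - a)))%C by ring.
  eapply Rle_trans; [apply Cmod_triangle|].
  specialize (H1 a b ltac:(lra) ltac:(lra)). specialize (H2 a b ltac:(lra) ltac:(lra)). lra.
Qed.

Lemma holo_mult (f g : C -> C) (s : C) : holo_at f s -> holo_at g s -> holo_at (fun x => f x * g x)%C s.
Proof.
  intros H1 H2.
  destruct (holo_at_C_derive f s H1) as (K1 & d1 & Hd1 & HK1 & Q1 & _ & L1 & B1).
  destruct (holo_at_C_derive g s H2) as (K2 & d2 & Hd2 & HK2 & Q2 & _ & L2 & B2).
  exists (fun x => C_derive f x * g x + f x * C_derive g x)%C, (3 * K1 * K2), (Rmin d1 d2).
  split; [apply Rmin_pos; lra|].
  intros a b Ha Hb. assert (Rmin d1 d2 <= d1) by apply Rmin_l. assert (Rmin d1 d2 <= d2) by apply Rmin_r.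
  specialize (Q1 a b ltac:(lra) ltac:(lra)). specialize (Q2 a b ltac:(lra) ltac:(lra)).
  specialize (L1 a b ltac:(lra) ltac:(lra)). specialize (L2 a b ltac:(lra) ltac:(lra)).
  destruct (B1 a ltac:(lra)) as [B1a _]. destruct (B2 a ltac:(lra)) as [B2a _].
  replace (f b * g b - f a * g a - (C_derive f a * g a + f a * C_derive g a) * (b - a))%C with
   ((f b - f a) * (g b - g a) + (f b - f a - C_derive f a * (b - a)) * g a
     + f a * (g b - g a - C_derive g a * (b - a)))%C by ring.
  eapply Rle_trans; [apply Cmod_triangle|].
  eapply Rle_trans; [apply Rplus_le_compat_r, Cmod_triangle|]. rewrite !Cmod_mult.
  replace (3 * K1 * K2 * Cmod (b - a) ^ 2) with
    (K1 * Cmod (b - a) * (K2 * Cmod (b - a)) + K1 * Cmod (b - a) ^ 2 * K2 + K1 * (K2 * Cmod (b - a) ^ 2)) by ring.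
  apply Rplus_le_compat; [apply Rplus_le_compat|]; apply Rmult_le_compat; try apply Cmod_ge_0; assumption.
Qed.

Lemma holo_opp (f : C -> C) (s : C) : holo_at f s -> holo_at (fun x => - f x)%C s.
Proof.
  intros H. apply (holo_at_ext (fun x => (- (1)) * f x)%C); [intros; ring|].
  apply holo_mult; [apply holo_const|assumption].
Qed.

Lemma holo_minus (f g : C -> C) (s : C) : holo_at f s -> holo_at g s -> holo_at (fun x => f x - g x)%C s.
Proof. intros H1 H2. apply holo_plus; [assumption|apply holo_opp; assumption]. Qed.

Lemma holo_comp (g f : C -> C) (s : C) :
  holo_at f s -> holo_at g (f s) -> holo_at (fun x => g (f x)) s.
Proof.
  intros H1 H2.
  destruct (holo_at_C_derive f s H1) as (K1 & d1 & Hd1 & HK1 & Q1 & _ & L1 & B1).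
  destruct (holo_at_C_derive g (f s) H2) as (K2 & d2 & Hd2 & HK2 & Q2 & _ & L2 & B2).
  set (d := Rmin d1 (d2 / (K1 + 1))).
  assert (Hd : 0 < d) by (apply Rmin_pos; [lra|apply Rdiv_lt_0_compat; lra]).
  assert (D1 : d <= d1) by apply Rmin_l. assert (D2 : d <= d2 / (K1 + 1)) by apply Rmin_r.
  assert (M : forall a, Cmod (a - s) < d -> Cmod (f a - f s) < d2).
  { intros a Ha. eapply Rle_lt_trans; [apply L1; [|lra]|].
    { rewrite Cmod_diag. lra. }
    assert (A : Cmod (a - s) < d2 / (K1 + 1)) by lra.
    apply Rmult_lt_compat_r with (r := K1 + 1) in A; [|lra].
    replace (d2 / (K1 + 1) * (K1 + 1)) with d2 in A by (field; lra).
    generalize (Cmod_ge_0 (a - s)). nra. }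
  exists (fun x => C_derive g (f x) * C_derive f x)%C, (K2 * K1 ^ 2 + K2 * K1), d. split; [assumption|].
  intros a b Ha Hb.
  specialize (Q1 a b ltac:(lra) ltac:(lra)). specialize (L1 a b ltac:(lra) ltac:(lra)).
  specialize (Q2 (f a) (f b) (M a Ha) (M b Hb)). destruct (B2 (f a) (M a Ha)) as [_ B2a].
  replace (g (f b) - g (f a) - C_derive g (f a) * C_derive f a * (b - a))%C with
   ((g (f b) - g (f a) - C_derive g (f a) * (f b - f a))
     + C_derive g (f a) * (f b - f a - C_derive f a * (b - a)))%C by ring.
  eapply Rle_trans; [apply Cmod_triangle|]. rewrite Cmod_mult.
  rewrite Rmult_plus_distr_r. apply Rplus_le_compat.
  - eapply Rle_trans; [apply Q2|]. rewrite Rmult_assoc, <- Rpow_mult_distr.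
    apply Rmult_le_compat_l; [assumption|]. apply pow_incr. split; [apply Cmod_ge_0|assumption].
  - rewrite Rmult_assoc. apply Rmult_le_compat; try apply Cmod_ge_0; assumption.
Qed.

(** The remainder is exactly [(b - a)^2 / (a^2 b)], and on the ball of radius [|s| / 2] each factor
    of the denominator is at least [|s| / 2], whence [8 / |s|^3]. *)
Lemma holo_Cinv (s : C) : s <> RtoC 0 -> holo_at Cinv s.
Proof.
  intros Hs. assert (P : 0 < Cmod s) by (apply Cmod_gt_0; assumption).
  exists (fun a => - / (a * a))%C, (8 / Cmod s ^ 3), (Cmod s / 2). split; [lra|].
  intros a b Ha Hb.
  assert (LB : forall c, Cmod (c - s) < Cmod s / 2 -> Cmod s / 2 <= Cmod c).
  { intros c Hc. assert (A := Cmod_sub_lower s c). rewrite Cmod_minus_sym in A. lra. }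
  assert (LBa := LB a Ha). assert (LBb := LB b Hb).
  assert (Na : a <> RtoC 0) by (apply Cmod_gt_0; lra).
  assert (Nb : b <> RtoC 0) by (apply Cmod_gt_0; lra).
  replace (/ b - / a - - / (a * a) * (b - a))%C with ((b - a) * (b - a) * / (a * a * b))%C
    by (field; auto).
  rewrite !Cmod_mult, Cmod_inv, !Cmod_mult by (repeat apply Cmult_neq_0; assumption).
  replace (Cmod (b - a) ^ 2) with (Cmod (b - a) * Cmod (b - a)) by ring.
  rewrite Rmult_comm. apply Rmult_le_compat_r.
  { apply Rmult_le_pos; apply Cmod_ge_0. }
  apply Rmult_le_reg_r with (Cmod a * Cmod a * Cmod b).
  { repeat apply Rmult_lt_0_compat; lra. }
  rewrite Rinv_l by (apply Rgt_not_eq; repeat apply Rmult_lt_0_compat; lra).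
  apply Rmult_le_reg_l with (Cmod s ^ 3).
  { apply pow_lt; lra. }
  replace (Cmod s ^ 3 * (8 / Cmod s ^ 3 * (Cmod a * Cmod a * Cmod b)))
    with (8 * (Cmod a * Cmod a * Cmod b)) by (field; lra).
  assert (Cmod s / 2 * (Cmod s / 2) * (Cmod s / 2) <= Cmod a * Cmod a * Cmod b).
  { apply Rmult_le_compat; [nra|lra|apply Rmult_le_compat; lra|lra]. }
  nra.
Qed.

Lemma holo_inv (f : C -> C) (s : C) : f s <> RtoC 0 -> holo_at f s -> holo_at (fun x => / f x)%C s.
Proof. intros N H. apply (holo_comp Cinv f s H (holo_Cinv _ N)). Qed.

Lemma holo_div (f g : C -> C) (s : C) :
  g s <> RtoC 0 -> holo_at f s -> holo_at g s -> holo_at (fun x => f x / g x)%C s.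
Proof. intros N H1 H2. apply holo_mult; [assumption|apply holo_inv; assumption]. Qed.

Lemma Cexp_remainder (a b : C) : Cmod (b - a) <= 2 ->
  Cmod (Cexp b - Cexp a - Cexp a * (b - a)) <= exp (Re a) * exp 2 * Cmod (b - a) ^ 2.
Proof.
  intros H.
  replace (Cexp b) with (Cexp a * Cexp (b - a))%C by (rewrite <- Cexp_plus; f_equal; ring).
  replace (Cexp a * Cexp (b - a) - Cexp a - Cexp a * (b - a))%C with
    (Cexp a * (Cexp (b - a) - 1 - (b - a)))%C by ring.
  rewrite Cmod_mult, Cmod_Cexp, Rmult_assoc.
  apply Rmult_le_compat_l; [left; apply exp_pos|].
  eapply Rle_trans; [apply Cexp_taylor_2|]. rewrite Rmult_comm.
  apply Rmult_le_compat_r; [apply pow_le, Cmod_ge_0|]. apply exp_le_compat, H.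
Qed.

Lemma C_derive_Cexp (a : C) : C_derive Cexp a = Cexp a.
Proof.
  apply is_C_derive_unique, (is_derive_quadratic _ _ _ (exp (Re a) * exp 2) 2); [lra|].
  intros b Hb. apply Cexp_remainder. lra.
Qed.

Lemma holo_Cexp (s : C) : holo_at Cexp s.
Proof.
  exists Cexp, (exp (Re s + 1) * exp 2), 1. split; [lra|].
  intros a b Ha Hb. eapply Rle_trans; [apply Cexp_remainder|].
  - eapply Rle_trans; [apply (Cmod_triangle_dist b s a)|]. rewrite (Cmod_minus_sym s a). lra.
  - apply Rmult_le_compat_r; [apply pow_le, Cmod_ge_0|].
    apply Rmult_le_compat_r; [left; apply exp_pos|]. apply exp_le_compat.
    assert (A := re_le_Cmod (a - s)). rewrite re_minus in A. assert (B := Rle_abs (Re a - Re s)). lra.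
Qed.

Lemma holo_Cexp_comp (f : C -> C) (s : C) : holo_at f s -> holo_at (fun x => Cexp (f x)) s.
Proof. intros H. apply (holo_comp Cexp f s H (holo_Cexp _)). Qed.

(** * Holomorphy and the three-point inequality *)

(** For fixed [a] the inequality says that the slopes [q b = (f b - f a) / (b - a)] are Lipschitz in
    [b]. They thus have a limit [l] as [b] tends to [a], and the remainder [(q b - l)(b - a)] is
    quadratic. *)
Lemma holo_three_point (f : C -> C) (s : C) (d K : R) : 0 < d ->
  (forall a b c, Cmod (a - s) < d -> Cmod (b - s) < d -> Cmod (c - s) < d -> three_point f K a b c) ->
  holo_at f s.
Proof.
  intros Hd H.
  assert (S3 : forall a, Cmod (a - s) < d / 2 -> exists l, forall b, Cmod (b - s) < d / 2 ->
     Cmod (f b - f a - l * (b - a)) <= Rabs K * Cmod (b - a) ^ 2).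
  { intros a Ha.
    pose (q := fun b => ((f b - f a) / (b - a))%C).
    assert (Q : forall b c, Cmod (b - s) < d -> Cmod (c - s) < d -> b <> a -> c <> a ->
       Cmod (q b - q c) <= Rabs K * Cmod (b - c)).
    { intros b c Hb Hc Nb Nc.
      assert (Pb : (b - a)%C <> RtoC 0) by (apply Cminus_eq_contra; assumption).
      assert (Pc : (c - a)%C <> RtoC 0) by (apply Cminus_eq_contra; assumption).
      assert (Mb : 0 < Cmod (b - a)) by (apply Cmod_gt_0; assumption).
      assert (Mc : 0 < Cmod (c - a)) by (apply Cmod_gt_0; assumption).
      assert (T := H a b c ltac:(lra) Hb Hc). unfold three_point in T.
      replace (f a * (b - c) + f b * (c - a) + f c * (a - b))%C with
        ((q b - q c) * ((c - a) * (b - a)))%C in T by (unfold q; field; split; assumption).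
      rewrite !Cmod_mult, (Cmod_minus_sym a b) in T.
      apply Rmult_le_reg_r with (Cmod (c - a) * Cmod (b - a)); [apply Rmult_lt_0_compat; assumption|].
      eapply Rle_trans; [apply T|].
      replace (K * (Cmod (b - c) * Cmod (c - a) * Cmod (b - a))) with
        (K * Cmod (b - c) * (Cmod (c - a) * Cmod (b - a))) by ring.
      apply Rmult_le_compat_r; [nra|]. apply Rmult_le_compat_r; [apply Cmod_ge_0|apply Rle_abs]. }
    (* Points tending to [a] at distance at most [d / 4]; as [a] lies in the ball of radius [d / 2],
       they stay in the ball of radius [d]. *)
    pose (c := fun n => (a + RtoC (d / 4 / (INR n + 1)))%C).
    assert (Hc : forall n, Cmod (c n - a) = d / 4 / (INR n + 1)).
    { intros n. unfold c. replace (a + (d / 4 / (INR n + 1))%R - a)%C with (RtoC (d / 4 / (INR n + 1))) by ring.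
      rewrite Cmod_R. apply Rabs_pos_eq. apply Rlt_le, Rdiv_lt_0_compat; [lra|].
      generalize (pos_INR n); lra. }
    assert (Hc2 : forall n, 0 < Cmod (c n - a) <= d / 4).
    { intros n. rewrite Hc. assert (P := pos_INR n). split; [apply Rdiv_lt_0_compat; lra|].
      apply Rmult_le_reg_r with (INR n + 1); [lra|].
      replace (d / 4 / (INR n + 1) * (INR n + 1)) with (d / 4) by (field; lra). nra. }
    assert (Hcb : forall n, Cmod (c n - s) < d).
    { intros n. eapply Rle_lt_trans; [apply (Cmod_triangle_dist (c n) a s)|]. destruct (Hc2 n). lra. }
    assert (Nc : forall n, c n <> a).
    { intros n E. destruct (Hc2 n) as [A _]. rewrite E in A.
      replace (a - a)%C with (RtoC 0) in A by ring. rewrite Cmod_0 in A. lra. }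
    assert (Lc : is_lim_seq (fun n => Cmod (c n - a)) 0).
    { apply (is_lim_seq_ext (fun n => (d / 4) * / (INR n + 1))); [intros; rewrite Hc; reflexivity|].
      replace (Finite 0) with (Rbar_mult (d / 4) 0) by (simpl; f_equal; ring).
      apply is_lim_seq_scal_l.
      apply (is_lim_seq_ext (fun n => / INR (S n))); [intros; rewrite S_INR; reflexivity|].
      apply (is_lim_seq_incr_1 (fun n => / INR n)).
      replace (Finite 0) with (Rbar_inv p_infty) by reflexivity.
      apply is_lim_seq_inv; [apply is_lim_seq_INR|discriminate]. }
    destruct (Ccauchy_cv (fun n => q (c n))) as [l Hl].
    { intros e He. apply is_lim_seq_spec in Lc.
      assert (HK1 : 0 < Rabs K + 1) by apply Rbound_pos.
      assert (He' : 0 < e / (2 * (Rabs K + 1))) by (apply Rdiv_lt_0_compat; lra).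
      destruct (Lc (mkposreal _ He')) as [N HN]. simpl in HN. exists N. intros n m Hn Hm.
      assert (A1 := HN n Hn). assert (A2 := HN m Hm). rewrite Rminus_0_r in A1, A2.
      assert (B1 := Rle_abs (Cmod (c n - a))). assert (B2 := Rle_abs (Cmod (c m - a))).
      eapply Rle_lt_trans; [apply Q; auto|].
      assert (B3 : Cmod (c n - c m) < e / (Rabs K + 1)).
      { eapply Rle_lt_trans; [apply (Cmod_triangle_dist (c n) a (c m))|].
        rewrite (Cmod_minus_sym a (c m)).
        replace (e / (Rabs K + 1)) with (e / (2 * (Rabs K + 1)) + e / (2 * (Rabs K + 1))) by (field; lra). lra. }
      apply Rmult_lt_compat_r with (r := Rabs K + 1) in B3; [|lra].
      replace (e / (Rabs K + 1) * (Rabs K + 1)) with e in B3 by (field; lra).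
      generalize (Cmod_ge_0 (c n - c m)). nra. }
    exists l. intros b Hb.
    destruct (Ceq_dec b a) as [E|Nb].
    { subst. replace (f a - f a - l * (a - a))%C with (RtoC 0) by ring. rewrite Cmod_0.
      apply Rmult_le_pos; [apply Rabs_pos|apply pow_le, Cmod_ge_0]. }
    assert (Pb : (b - a)%C <> RtoC 0) by (apply Cminus_eq_contra; assumption).
    assert (R1 : Cmod (q b - l) <= Rabs K * Cmod (b - a)).
    { apply (is_lim_seq_le (fun n => Cmod (q b - q (c n))) (fun n => Rabs K * (Cmod (b - a) + Cmod (c n - a)))
        (Cmod (q b - l)) (Rabs K * Cmod (b - a))).
      - intros n. eapply Rle_trans; [apply Q; auto; lra|]. apply Rmult_le_compat_l; [apply Rabs_pos|].
        eapply Rle_trans; [apply (Cmod_triangle_dist b a (c n))|]. rewrite (Cmod_minus_sym a (c n)). lra.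
      - apply (Ccv_Cmod (fun n => q b - q (c n))%C). apply (Ccv_minus (fun _ => q b)); [apply Ccv_const|assumption].
      - replace (Finite (Rabs K * Cmod (b - a))) with (Rbar_mult (Rabs K) (Finite (Cmod (b - a) + 0)))
          by (simpl; f_equal; ring).
        apply is_lim_seq_scal_l. apply is_lim_seq_plus'; [apply is_lim_seq_const|assumption]. }
    replace (f b - f a - l * (b - a))%C with ((q b - l) * (b - a))%C by (unfold q; field; assumption).
    rewrite Cmod_mult. simpl. rewrite Rmult_1_r, <- Rmult_assoc.
    apply Rmult_le_compat_r; [apply Cmod_ge_0|assumption]. }
  exists (C_derive f), (Rabs K), (d / 2). split; [lra|].
  intros a b Ha Hb. destruct (S3 a Ha) as [l Hl].
  rewrite (is_C_derive_unique f a l); [apply Hl; assumption|].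
  apply is_derive_quadratic with (Rabs K) (d / 2 - Cmod (a - s)); [lra|].
  intros b' Hb'. apply Hl. eapply Rle_lt_trans; [apply (Cmod_triangle_dist b' a s)|]. lra.
Qed.

Lemma three_point_rot (f : C -> C) (K : R) (a b c : C) : three_point f K a b c -> three_point f K b c a.
Proof.
  unfold three_point. intros H.
  replace (f b * (c - a) + f c * (a - b) + f a * (b - c))%C with
    (f a * (b - c) + f b * (c - a) + f c * (a - b))%C by ring.
  eapply Rle_trans; [apply H|]. right. ring.
Qed.

(** When [f b] and [f c] are expanded at [a], the linear terms cancel in the combination. Two
    remainders are left, each at most [K] times the product of the three sides if the side opposite
    to [a] is the longest. *)
Lemma three_point_quadratic (f f' : C -> C) (K : R) (D : C -> Prop) : 0 <= K ->
  (forall a b, D a -> D b -> Cmod (f b - f a - f' a * (b - a)) <= K * Cmod (b - a) ^ 2) ->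
  forall a b c, D a -> D b -> D c -> three_point f (2 * K) a b c.
Proof.
  intros HK Q.
  (* base the expansion at the vertex opposite to the longest side *)
  assert (W : forall a b c, D a -> D b -> D c -> Cmod (c - a) <= Cmod (b - c) -> Cmod (a - b) <= Cmod (b - c) ->
    three_point f (2 * K) a b c).
  { intros a b c Ha Hb Hc L1 L2. unfold three_point.
    replace (f a * (b - c) + f b * (c - a) + f c * (a - b))%C with
      ((f b - f a - f' a * (b - a)) * (c - a) - (f c - f a - f' a * (c - a)) * (b - a))%C by ring.
    eapply Rle_trans; [apply Cmod_triangle_minus|]. rewrite !Cmod_mult.
    assert (Q1 := Q a b Ha Hb). assert (Q2 := Q a c Ha Hc).
    rewrite (Cmod_minus_sym b a) in *.
    assert (P1 := Cmod_ge_0 (c - a)). assert (P2 := Cmod_ge_0 (a - b)).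
    apply Rmult_le_compat_r with (r := Cmod (c - a)) in Q1; [|assumption].
    apply Rmult_le_compat_r with (r := Cmod (a - b)) in Q2; [|assumption].
    set (x := Cmod (c - a)) in *. set (y := Cmod (a - b)) in *. set (z := Cmod (b - c)) in *.
    assert (K * y ^ 2 * x <= K * (z * x * y)).
    { replace (K * y ^ 2 * x) with (K * (y * (x * y))) by ring.
      replace (K * (z * x * y)) with (K * (z * (x * y))) by ring.
      apply Rmult_le_compat_l; [assumption|]. apply Rmult_le_compat_r; [nra|assumption]. }
    assert (K * x ^ 2 * y <= K * (z * x * y)).
    { replace (K * x ^ 2 * y) with (K * (x * (x * y))) by ring.
      replace (K * (z * x * y)) with (K * (z * (x * y))) by ring.
      apply Rmult_le_compat_l; [assumption|]. apply Rmult_le_compat_r; [nra|assumption]. }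
    lra. }
  intros a b c Ha Hb Hc.
  destruct (Rle_dec (Cmod (c - a)) (Cmod (b - c))) as [L1|L1]; destruct (Rle_dec (Cmod (a - b)) (Cmod (b - c))) as [L2|L2].
  - apply W; assumption.
  - apply three_point_rot. apply W; try assumption; lra.
  - apply three_point_rot, three_point_rot. apply W; try assumption; lra.
  - destruct (Rle_dec (Cmod (c - a)) (Cmod (a - b))) as [L3|L3].
    + apply three_point_rot. apply W; try assumption; lra.
    + apply three_point_rot, three_point_rot. apply W; try assumption; lra.
Qed.

Lemma three_point_lim (fn : nat -> C -> C) (f : C -> C) (K : R) (a b c : C) :
  (forall n, three_point (fn n) K a b c) ->
  Ccv (fun n => fn n a) (f a) -> Ccv (fun n => fn n b) (f b) -> Ccv (fun n => fn n c) (f c) ->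
  three_point f K a b c.
Proof.
  intros H Ha Hb Hc. unfold three_point.
  apply (Ccv_Cmod_le (fun n => fn n a * (b - c) + fn n b * (c - a) + fn n c * (a - b))%C).
  - repeat apply Ccv_plus; (apply Ccv_mult; [assumption|apply Ccv_const]).
  - intros n. apply H.
Qed.

(** * Continuity and differentiation with respect to real parameters *)

Definition rcont (f : R -> C) (t : R) : Prop :=
  forall e, 0 < e -> exists d, 0 < d /\ forall u, Rabs (u - t) < d -> Cmod (f u - f t) < e.

(** Joint continuity, as demanded of the partial derivative when an integral is differentiated under
    the integral sign. *)
Definition rcont2 (F : R -> R -> C) (x t : R) : Prop :=
  forall e, 0 < e -> exists d, 0 < d /\
    forall u v, Rabs (u - x) < d -> Rabs (v - t) < d -> Cmod (F u v - F x t) < e.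

Lemma rcont_parts (f : R -> C) (t : R) : rcont f t ->
  continuous (fun u => Re (f u)) t /\ continuous (fun u => Im (f u)) t.
Proof.
  intros H. split; apply continuity_pt_filterlim; intros e He;
  destruct (H e He) as [d [Hd H']]; exists d; split; try assumption; intros u [_ Hu];
  simpl; unfold R_dist; eapply Rle_lt_trans; try (apply H'; exact Hu).
  - rewrite <- re_minus. apply re_le_Cmod.
  - rewrite <- im_minus. apply im_le_Cmod.
Qed.

Lemma rcont2_parts (F : R -> R -> C) (x t : R) : rcont2 F x t ->
  continuity_2d_pt (fun u v => Re (F u v)) x t /\ continuity_2d_pt (fun u v => Im (F u v)) x t.
Proof.
  intros H. split; intros e; destruct (H e (cond_pos e)) as [d [Hd H']]; exists (mkposreal d Hd);
  intros u v Hu Hv; eapply Rle_lt_trans; try (apply H'; [exact Hu|exact Hv]).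
  - rewrite <- re_minus. apply re_le_Cmod.
  - rewrite <- im_minus. apply im_le_Cmod.
Qed.

Lemma rcont2_r F x t : rcont2 F x t -> rcont (F x) t.
Proof.
  intros H e He. destruct (H e He) as [d [Hd H']]. exists d. split; [assumption|].
  intros u Hu. apply H'; [|assumption]. rewrite Rminus_diag, Rabs_R0. assumption.
Qed.

Lemma rcont2_comp (g : C -> C) F x t : Ccont g (F x t) -> rcont2 F x t -> rcont2 (fun u v => g (F u v)) x t.
Proof.
  intros Hg HF e He. destruct (Hg e He) as [d [Hd H]]. destruct (HF d Hd) as [d' [Hd' H']].
  exists d'. split; [assumption|]. intros u v Hu Hv. apply H, H'; assumption.
Qed.

Lemma rcont_comp (g : C -> C) (f : R -> C) t : Ccont g (f t) -> rcont f t -> rcont (fun u => g (f u)) t.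
Proof.
  intros Hg HF e He. destruct (Hg e He) as [d [Hd H]]. destruct (HF d Hd) as [d' [Hd' H']].
  exists d'. split; [assumption|]. intros u Hu. apply H, H'; assumption.
Qed.

Lemma rcont_const c t : rcont (fun _ => c) t.
Proof.
  intros e He. exists 1. split; [lra|]. intros. rewrite Cmod_diag. assumption.
Qed.

Lemma rcont_RtoC t : rcont RtoC t.
Proof.
  intros e He. exists e. split; [assumption|]. intros u Hu.
  rewrite <- RtoC_minus, Cmod_R. assumption.
Qed.

Lemma rcont_plus f g t : rcont f t -> rcont g t -> rcont (fun u => f u + g u)%C t.
Proof.
  intros Hf Hg e He. destruct (Hf (e / 2)) as [d [Hd H]]; [lra|].
  destruct (Hg (e / 2)) as [d' [Hd' H']]; [lra|].
  exists (Rmin d d'). split; [apply Rmin_pos; assumption|]. intros u Hu.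
  assert (Rmin d d' <= d) by apply Rmin_l. assert (Rmin d d' <= d') by apply Rmin_r.
  replace (f u + g u - (f t + g t))%C with ((f u - f t) + (g u - g t))%C by ring.
  eapply Rle_lt_trans; [apply Cmod_triangle|].
  specialize (H u ltac:(lra)). specialize (H' u ltac:(lra)). lra.
Qed.

Lemma rcont_mult f g t : rcont f t -> rcont g t -> rcont (fun u => f u * g u)%C t.
Proof.
  intros Hf Hg e He.
  set (M := Cmod (f t) + Cmod (g t) + 1).
  assert (HM : 1 <= M) by (unfold M; generalize (Cmod_ge_0 (f t)) (Cmod_ge_0 (g t)); lra).
  assert (He' : 0 < Rmin 1 (e / (3 * M))).
  { apply Rmin_pos; [lra|]. apply Rdiv_lt_0_compat; lra. }
  destruct (Hf _ He') as [d [Hd H]]. destruct (Hg _ He') as [d' [Hd' H']].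
  exists (Rmin d d'). split; [apply Rmin_pos; assumption|]. intros u Hu.
  assert (Rmin d d' <= d) by apply Rmin_l. assert (Rmin d d' <= d') by apply Rmin_r.
  specialize (H u ltac:(lra)). specialize (H' u ltac:(lra)).
  set (eta := Rmin 1 (e / (3 * M))) in *.
  assert (E1 : eta <= 1) by apply Rmin_l.
  assert (E2 : eta * M <= e / 3).
  { apply Rle_trans with (e / (3 * M) * M).
    - apply Rmult_le_compat_r; [lra|apply Rmin_r].
    - right. field. lra. }
  replace (f u * g u - f t * g t)%C with
    ((f u - f t) * (g u - g t) + (f u - f t) * g t + f t * (g u - g t))%C by ring.
  eapply Rle_lt_trans; [apply Cmod_triangle|].
  eapply Rle_lt_trans; [apply Rplus_le_compat_r, Cmod_triangle|]. rewrite !Cmod_mult.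
  assert (P1 := Cmod_ge_0 (f u - f t)). assert (P2 := Cmod_ge_0 (g u - g t)).
  assert (P3 := Cmod_ge_0 (f t)). assert (P4 := Cmod_ge_0 (g t)).
  unfold M in *. nra.
Qed.

Lemma rcont_minus f g t : rcont f t -> rcont g t -> rcont (fun u => f u - g u)%C t.
Proof.
  intros Hf Hg. apply rcont_plus; [assumption|]. intros e He. destruct (Hg e He) as [d [Hd H]].
  exists d. split; [assumption|]. intros u Hu.
  replace (- g u - - g t)%C with (- (g u - g t))%C by ring. rewrite Cmod_opp. auto.
Qed.

Lemma rcont_ext f g t : (forall u, f u = g u) -> rcont f t -> rcont g t.
Proof.
  intros E H e He. destruct (H e He) as [d [Hd H']]. exists d. split; [assumption|].
  intros u Hu. rewrite <- !E. auto.
Qed.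

Lemma rcont2_line (x t : R) : rcont2 (fun u v => (RtoC u + Ci * RtoC v)%C) x t.
Proof.
  intros e He. exists (e / 2). split; [lra|]. intros u v Hu Hv.
  replace (u + Ci * v - (x + Ci * t))%C with (RtoC (u - x) + Ci * RtoC (v - t))%C
    by (rewrite !RtoC_minus; ring).
  eapply Rle_lt_trans; [apply Cmod_triangle|]. rewrite Cmod_mult, Cmod_Ci, !Cmod_R. lra.
Qed.

(** The form without components or quotients, in which the chain rule with a holomorphic function
    can be estimated by the modulus. *)
Lemma cder_eps (f : R -> C) (t : R) (l : C) : cder f t l <->
  forall e, 0 < e -> exists d, 0 < d /\
    forall h, Rabs h < d -> Cmod (f (t + h) - f t - RtoC h * l) <= e * Rabs h.
Proof.
  split.
  - intros [H1 H2] e He. apply is_derive_Reals in H1. apply is_derive_Reals in H2.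
    destruct (H1 (e / 2)) as [[d1 Hd1] D1]; [lra|]. destruct (H2 (e / 2)) as [[d2 Hd2] D2]; [lra|].
    simpl in D1, D2.
    exists (Rmin d1 d2). split; [apply Rmin_pos; assumption|]. intros h Hh.
    assert (Rmin d1 d2 <= d1) by apply Rmin_l. assert (Rmin d1 d2 <= d2) by apply Rmin_r.
    destruct (Req_dec h 0) as [E|E].
    { subst. rewrite Rplus_0_r. replace (f t - f t - 0 * l)%C with (RtoC 0) by ring.
      rewrite Cmod_0, Rabs_R0. lra. }
    specialize (D1 h E ltac:(lra)). specialize (D2 h E ltac:(lra)).
    assert (Ph : 0 < Rabs h) by (apply Rabs_pos_lt; assumption).
    assert (U : forall A B, Rabs (A / h - B) < e / 2 -> Rabs (A - h * B) <= e / 2 * Rabs h).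
    { intros A B HAB. replace (A - h * B) with ((A / h - B) * h) by (field; assumption).
      rewrite Rabs_mult. apply Rmult_le_compat_r; lra. }
    apply U in D1. apply U in D2.
    eapply Rle_trans; [apply Cmod_le_parts|].
    rewrite !re_minus, !im_minus, re_scal_l, im_scal_l. lra.
  - intros H. split; apply is_derive_Reals; intros e He; (destruct (H (e / 2)) as [d [Hd D]]; [lra|]);
    exists (mkposreal d Hd); simpl; intros h E Hh; specialize (D h Hh);
    assert (Ph : 0 < Rabs h) by (apply Rabs_pos_lt; assumption).
    + replace ((Re (f (t + h)) - Re (f t)) / h - Re l) with ((Re (f (t + h) - f t - h * l)) / h).
      2:{ rewrite !re_minus, re_scal_l. field; assumption. }
      unfold Rdiv. rewrite Rabs_mult, Rabs_inv.
      apply Rmult_lt_reg_r with (Rabs h); [assumption|]. rewrite Rmult_assoc, Rinv_l, Rmult_1_r by lra.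
      eapply Rle_lt_trans; [apply re_le_Cmod|]. nra.
    + replace ((Im (f (t + h)) - Im (f t)) / h - Im l) with ((Im (f (t + h) - f t - h * l)) / h).
      2:{ rewrite !im_minus, im_scal_l. field; assumption. }
      unfold Rdiv. rewrite Rabs_mult, Rabs_inv.
      apply Rmult_lt_reg_r with (Rabs h); [assumption|]. rewrite Rmult_assoc, Rinv_l, Rmult_1_r by lra.
      eapply Rle_lt_trans; [apply im_le_Cmod|]. nra.
Qed.

Lemma cder_rcont f t l : cder f t l -> rcont f t.
Proof.
  intros H e He. destruct (proj1 (cder_eps f t l) H 1) as [d [Hd D]]; [lra|].
  assert (Pl : 0 < Cmod l + 1) by (generalize (Cmod_ge_0 l); lra).
  exists (Rmin d (e / (Cmod l + 1))). split; [apply Rmin_pos; [assumption|apply Rdiv_lt_0_compat; assumption]|].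
  intros u Hu. assert (M1 : Rmin d (e / (Cmod l + 1)) <= d) by apply Rmin_l.
  assert (M2 : Rmin d (e / (Cmod l + 1)) <= e / (Cmod l + 1)) by apply Rmin_r.
  specialize (D (u - t) ltac:(lra)). replace (t + (u - t)) with u in D by ring.
  replace (f u - f t)%C with ((f u - f t - (u - t)%R * l) + (u - t)%R * l)%C by ring.
  eapply Rle_lt_trans; [apply Cmod_triangle|]. rewrite Cmod_mult, Cmod_R.
  assert (A : Rabs (u - t) < e / (Cmod l + 1)) by lra.
  apply Rmult_lt_compat_r with (r := Cmod l + 1) in A; [|assumption].
  replace (e / (Cmod l + 1) * (Cmod l + 1)) with e in A by (field; lra). lra.
Qed.

Lemma cder_holo (g : C -> C) (f : R -> C) t l :
  holo_at g (f t) -> cder f t l -> cder (fun u => g (f u)) t (C_derive g (f t) * l)%C.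
Proof.
  intros Hg Hf. assert (Cf := cder_rcont _ _ _ Hf).
  destruct (holo_at_C_derive g _ Hg) as (K & d & Hd & HK & Q & _ & _ & B).
  assert (Z : Cmod (f t - f t) < d) by (rewrite Cmod_diag; lra).
  destruct (B _ Z) as [_ B1].
  apply cder_eps. intros e He.
  set (L := Cmod l + 1). assert (HL : 1 <= L) by (unfold L; generalize (Cmod_ge_0 l); lra).
  assert (Hc : 0 < Rmin 1 (e / (2 * (K + 1)))).
  { apply Rmin_pos; [lra|apply Rdiv_lt_0_compat; lra]. }
  destruct (proj1 (cder_eps f t l) Hf _ Hc) as [d1 [Hd1 D1]].
  destruct (Cf d) as [d2 [Hd2 D2]]; [lra|].
  (* Chosen so that the quadratic remainder [K (L |h|)^2] of [g] is at most [e / 2 * |h|]; the other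
     half of [e] pays for the remainder of [f]. *)
  set (d3 := e / (2 * (K + 1) * (L * L))).
  assert (Hd3 : 0 < d3) by (apply Rdiv_lt_0_compat; [assumption|nra]).
  exists (Rmin d3 (Rmin d1 d2)). split; [repeat apply Rmin_pos; assumption|]. intros h Hh.
  assert (H3 : Rabs h < d3) by (eapply Rlt_le_trans; [exact Hh|apply Rmin_l]).
  assert (H1 : Rabs h < d1).
  { eapply Rlt_le_trans; [exact Hh|]. eapply Rle_trans; [apply Rmin_r|apply Rmin_l]. }
  assert (H2 : Rabs h < d2).
  { eapply Rlt_le_trans; [exact Hh|]. eapply Rle_trans; [apply Rmin_r|apply Rmin_r]. }
  specialize (D1 h H1). specialize (D2 (t + h) ltac:(replace (t + h - t) with h by ring; assumption)).
  specialize (Q (f t) (f (t + h)) Z D2).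
  set (eta := Rmin 1 (e / (2 * (K + 1)))) in *.
  assert (E1 : eta <= 1) by apply Rmin_l.
  assert (E2 : K * eta <= e / 2).
  { apply Rle_trans with ((K + 1) * (e / (2 * (K + 1)))).
    - apply Rmult_le_compat; try lra. apply Rmin_r.
    - right. field. lra. }
  assert (Ph := Rabs_pos h).
  assert (F : Cmod (f (t + h) - f t) <= L * Rabs h).
  { replace (f (t + h)%R - f t)%C with ((f (t + h)%R - f t - h * l) + h * l)%C by ring.
    eapply Rle_trans; [apply Cmod_triangle|]. rewrite Cmod_mult, Cmod_R. unfold L. nra. }
  replace (g (f (t + h)%R) - g (f t) - h * (C_derive g (f t) * l))%C with
    ((g (f (t + h)%R) - g (f t) - C_derive g (f t) * (f (t + h)%R - f t))
      + C_derive g (f t) * (f (t + h)%R - f t - h * l))%C by ring.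
  eapply Rle_trans; [apply Cmod_triangle|]. rewrite Cmod_mult.
  assert (A1 : Cmod (C_derive g (f t)) * Cmod (f (t + h) - f t - h * l) <= e / 2 * Rabs h).
  { apply Rle_trans with (K * (eta * Rabs h)).
    - apply Rmult_le_compat; try apply Cmod_ge_0; assumption.
    - rewrite <- Rmult_assoc. apply Rmult_le_compat_r; assumption. }
  assert (A2 : K * Cmod (f (t + h) - f t) ^ 2 <= e / 2 * Rabs h).
  { apply Rle_trans with (K * (L * Rabs h) ^ 2).
    - apply Rmult_le_compat_l; [assumption|]. apply pow_incr. split; [apply Cmod_ge_0|assumption].
    - replace (K * (L * Rabs h) ^ 2) with (K * (L * L) * Rabs h * Rabs h) by ring.
      apply Rmult_le_compat_r; [assumption|].
      apply Rle_trans with ((K + 1) * (L * L) * d3).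
      + apply Rmult_le_compat; try lra; nra.
      + right. unfold d3. field. split; lra. }
  lra.
Qed.

(** * Integrals of complex-valued functions *)

Definition CInt (f : R -> C) (a b : R) : C :=
  (RInt (fun t => Re (f t)) a b, RInt (fun t => Im (f t)) a b).

Definition cint (f : R -> C) (a b : R) : Prop :=
  ex_RInt (fun t => Re (f t)) a b /\ ex_RInt (fun t => Im (f t)) a b.

Lemma cint_rcont f a b : (forall t, Rmin a b <= t <= Rmax a b -> rcont f t) -> cint f a b.
Proof.
  intros H. split; apply (@ex_RInt_continuous R_CompleteNormedModule); intros t Ht;
  destruct (rcont_parts f t (H t Ht)); assumption.
Qed.

Lemma cint_rcont_all f a b : (forall t, rcont f t) -> cint f a b.
Proof. intros H. apply cint_rcont. auto. Qed.

Lemma is_RInt_CInt f a b : cint f a b -> @is_RInt C_R_NormedModule f a b (CInt f a b).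
Proof.
  intros [H1 H2]. apply (@is_RInt_fct_extend_pair R_NormedModule R_NormedModule);
  apply (@RInt_correct R_CompleteNormedModule); assumption.
Qed.

Lemma CInt_ext f g a b : (forall t, Rmin a b < t < Rmax a b -> f t = g t) -> CInt f a b = CInt g a b.
Proof.
  intros H. unfold CInt. f_equal; apply RInt_ext; intros t Ht; rewrite H by assumption; reflexivity.
Qed.

Lemma cint_ext f g a b : (forall t, f t = g t) -> cint f a b -> cint g a b.
Proof.
  intros E [H1 H2]. split; [apply ex_RInt_ext with (2 := H1)|apply ex_RInt_ext with (2 := H2)];
  intros; rewrite E; reflexivity.
Qed.

Lemma cint_plus f g a b : cint f a b -> cint g a b -> cint (fun t => f t + g t)%C a b.
Proof.
  intros [H1 H2] [H3 H4].
  split; apply (@ex_RInt_plus R_NormedModule); assumption.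
Qed.

Lemma CInt_plus f g a b : cint f a b -> cint g a b ->
  CInt (fun t => f t + g t)%C a b = (CInt f a b + CInt g a b)%C.
Proof.
  intros [H1 H2] [H3 H4]. unfold CInt, Cplus. simpl. f_equal;
  apply (@RInt_plus R_CompleteNormedModule); assumption.
Qed.

Lemma cint_scal (c : C) f a b : cint f a b -> cint (fun t => c * f t)%C a b.
Proof.
  intros [H1 H2]. split.
  - apply (ex_RInt_ext (fun t => minus (scal (Re c) (Re (f t))) (scal (Im c) (Im (f t))))); [reflexivity|].
    apply (@ex_RInt_minus R_NormedModule); apply (@ex_RInt_scal R_NormedModule); assumption.
  - apply (ex_RInt_ext (fun t => plus (scal (Re c) (Im (f t))) (scal (Im c) (Re (f t))))); [reflexivity|].
    apply (@ex_RInt_plus R_NormedModule); apply (@ex_RInt_scal R_NormedModule); assumption.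
Qed.

Lemma CInt_scal (c : C) f a b : cint f a b -> CInt (fun t => c * f t)%C a b = (c * CInt f a b)%C.
Proof.
  intros [H1 H2].
  apply (@RInt_correct R_CompleteNormedModule) in H1. apply (@RInt_correct R_CompleteNormedModule) in H2.
  apply Ceq_parts; unfold CInt; simpl; apply is_RInt_unique.
  - apply (is_RInt_ext (fun t => minus (scal (Re c) (Re (f t))) (scal (Im c) (Im (f t))))); [reflexivity|].
    apply (@is_RInt_minus R_NormedModule); apply (@is_RInt_scal R_NormedModule); assumption.
  - apply (is_RInt_ext (fun t => plus (scal (Re c) (Im (f t))) (scal (Im c) (Re (f t))))); [reflexivity|].
    apply (@is_RInt_plus R_NormedModule); apply (@is_RInt_scal R_NormedModule); assumption.
Qed.

Lemma cint_minus f g a b : cint f a b -> cint g a b -> cint (fun t => f t - g t)%C a b.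
Proof.
  intros H1 H2. apply (cint_ext (fun t => f t + (- (1)) * g t)%C); [intros; ring|].
  apply cint_plus; [assumption|apply cint_scal; assumption].
Qed.

Lemma CInt_minus f g a b : cint f a b -> cint g a b ->
  CInt (fun t => f t - g t)%C a b = (CInt f a b - CInt g a b)%C.
Proof.
  intros H1 H2. rewrite (CInt_ext _ (fun t => f t + (- (1)) * g t)%C) by (intros; ring).
  rewrite CInt_plus, CInt_scal; try assumption; [ring|apply cint_scal; assumption].
Qed.

Lemma cint_const c a b : cint (fun _ => c) a b.
Proof. split; apply (@ex_RInt_const R_NormedModule). Qed.

Lemma CInt_const c a b : CInt (fun _ => c) a b = (RtoC (b - a) * c)%C.
Proof.
  unfold CInt. rewrite !(RInt_const (V := R_CompleteNormedModule)).
  apply Ceq_parts; unfold scal, Re, Im; simpl; unfold mult; simpl; ring.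
Qed.

(** With [c] the value of the integral, [|c|^2] is the real part of the integral of [conj c * f],
    hence at most [|c|] times the integral of [g]. *)
Lemma CInt_Cmod_le f (g : R -> R) a b : a <= b -> cint f a b -> ex_RInt g a b ->
  (forall t, a < t < b -> Cmod (f t) <= g t) -> Cmod (CInt f a b) <= RInt g a b.
Proof.
  intros Hab Hf Hg H. set (c := CInt f a b).
  assert (P := Cmod_ge_0 c).
  assert (E : Cmod c * Cmod c <= Cmod c * RInt g a b).
  { replace (Cmod c * Cmod c) with (Re (CInt (fun t => Cconj c * f t)%C a b)).
    2:{ rewrite CInt_scal by assumption. fold c. rewrite Cmod_dec, re_mult, re_conj, im_conj. ring. }
    change (Cmod c * RInt g a b) with (scal (Cmod c) (RInt g a b)).
    rewrite <- (RInt_scal (V := R_CompleteNormedModule) g a b (Cmod c) Hg).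
    unfold CInt at 1; simpl. apply RInt_le; [assumption| | |].
    - destruct (cint_scal (Cconj c) f a b Hf) as [H1 _]. exact H1.
    - apply (@ex_RInt_scal R_NormedModule); assumption.
    - intros t Ht. unfold scal; simpl; unfold mult; simpl.
      apply Rle_trans with (Cmod (Cconj c * f t)).
      + eapply Rle_trans; [apply Rle_abs|]. apply (re_le_Cmod (Cconj c * f t)).
      + rewrite Cmod_mult, Cmod_conj. apply Rmult_le_compat_l; [assumption|]. apply H; assumption. }
  destruct P as [P|P]; [apply Rmult_le_reg_l with (Cmod c); assumption|].
  rewrite <- P. apply RInt_ge_0; [assumption..|]. intros t Ht. eapply Rle_trans; [apply Cmod_ge_0|apply H; assumption].
Qed.

Lemma CInt_Cmod_le_const f M a b : a <= b -> cint f a b ->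
  (forall t, a < t < b -> Cmod (f t) <= M) -> Cmod (CInt f a b) <= M * (b - a).
Proof.
  intros Hab Hf H. replace (M * (b - a)) with (RInt (fun _ => M) a b).
  - apply CInt_Cmod_le; try assumption. apply (@ex_RInt_const R_NormedModule).
  - rewrite (RInt_const (V := R_CompleteNormedModule)). unfold scal; simpl; unfold mult; simpl; ring.
Qed.

Lemma CInt_Chasles f a b c : cint f a b -> cint f b c -> (CInt f a b + CInt f b c = CInt f a c)%C.
Proof.
  intros [H1 H2] [H3 H4]. apply Ceq_parts; unfold CInt; simpl;
  apply (RInt_Chasles (V := R_CompleteNormedModule)); assumption.
Qed.

Lemma CInt_cder f f' a b : (forall t, Rmin a b <= t <= Rmax a b -> cder f t (f' t)) ->
  (forall t, Rmin a b <= t <= Rmax a b -> rcont f' t) -> CInt f' a b = (f b - f a)%C.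
Proof.
  intros H Hc. apply Ceq_parts; unfold CInt; simpl; apply is_RInt_unique.
  - apply (is_RInt_derive (V := R_CompleteNormedModule) (fun t => Re (f t))); intros t Ht.
    + apply (H t Ht).
    + apply (rcont_parts f' t (Hc t Ht)).
  - apply (is_RInt_derive (V := R_CompleteNormedModule) (fun t => Im (f t))); intros t Ht.
    + apply (H t Ht).
    + apply (rcont_parts f' t (Hc t Ht)).
Qed.

Lemma cder_CInt_param (F dF : R -> R -> C) (x0 r a b : R) : 0 < r ->
  (forall x t, Rabs (x - x0) < r -> cder (fun u => F u t) x (dF x t)) ->
  (forall t, rcont2 dF x0 t) ->
  (forall x, Rabs (x - x0) < r -> cint (F x) a b) ->
  cder (fun x => CInt (F x) a b) x0 (CInt (dF x0) a b).
Proof.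
  intros Hr HD HC HI.
  assert (Z : Rabs (x0 - x0) < r) by (rewrite Rminus_diag, Rabs_R0; assumption).
  split; unfold CInt; simpl.
  - replace (RInt (fun t => Re (dF x0 t)) a b) with (RInt (fun t => Derive (fun u => Re (F u t)) x0) a b).
    2:{ apply RInt_ext. intros t _. apply is_derive_unique, HD, Z. }
    apply (is_derive_RInt_param (fun x t => Re (F x t))).
    + exists (mkposreal r Hr). intros x Hx t _. exists (Re (dF x t)). exact (proj1 (HD x t Hx)).
    + intros t _. apply continuity_2d_pt_ext_loc with (fun u v => Re (dF u v)).
      * exists (mkposreal r Hr). intros u v Hu Hv. symmetry. apply is_derive_unique, (HD u v Hu).
      * apply (rcont2_parts _ _ _ (HC t)).
    + exists (mkposreal r Hr). intros x Hx. apply (HI x Hx).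
  - replace (RInt (fun t => Im (dF x0 t)) a b) with (RInt (fun t => Derive (fun u => Im (F u t)) x0) a b).
    2:{ apply RInt_ext. intros t _. apply is_derive_unique, HD, Z. }
    apply (is_derive_RInt_param (fun x t => Im (F x t))).
    + exists (mkposreal r Hr). intros x Hx t _. exists (Im (dF x t)). exact (proj2 (HD x t Hx)).
    + intros t _. apply continuity_2d_pt_ext_loc with (fun u v => Im (dF u v)).
      * exists (mkposreal r Hr). intros u v Hu Hv. symmetry. apply is_derive_unique, (HD u v Hu).
      * apply (rcont2_parts _ _ _ (HC t)).
    + exists (mkposreal r Hr). intros x Hx. apply (HI x Hx).
Qed.

(** * Cauchy estimates *)

Definition cis (t : R) : C := Cexp (RtoC t * Ci).

Lemma Cmod_cis t : Cmod (cis t) = 1.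
Proof.
  unfold cis. rewrite Cmod_Cexp. unfold Re; simpl.
  replace (t * 0 - 0 * 1) with 0 by ring. apply exp_0.
Qed.

Lemma cis_neq_0 t : cis t <> RtoC 0.
Proof. apply Cexp_neq_0. Qed.

Lemma cder_cis t : cder cis t (Ci * cis t)%C.
Proof. apply cder_Cexp_line. Qed.

Lemma rcont_cis t : rcont cis t.
Proof. apply (cder_rcont _ _ _ (cder_cis t)). Qed.

Lemma Ccont_Cinv s : s <> RtoC 0 -> Ccont Cinv s.
Proof. intros H. apply Ccont_holo, holo_Cinv, H. Qed.

Lemma rcont_cis_inv t : rcont (fun u => / cis u)%C t.
Proof. apply (rcont_comp Cinv cis); [apply Ccont_Cinv, cis_neq_0|apply rcont_cis]. Qed.

Lemma cder_cis_inv t : cder (fun u => / cis u)%C t (- Ci * / cis t)%C.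
Proof.
  assert (E : forall u, Cexp (RtoC u * - Ci) = (/ cis u)%C).
  { intros u. unfold cis. rewrite <- Cexp_opp. f_equal. ring. }
  apply (cder_ext (fun u => Cexp (RtoC u * - Ci))); [exact E|].
  rewrite <- E. apply cder_Cexp_line.
Qed.

Lemma rcont_circle w (l t : R) : rcont (fun u => w + RtoC l * cis u)%C t.
Proof.
  apply (rcont_plus (fun _ => w)); [apply rcont_const|].
  apply (rcont_mult (fun _ => RtoC l)); [apply rcont_const|apply rcont_cis].
Qed.

Lemma rcont2_circle w (l t : R) : rcont2 (fun u v => w + RtoC u * cis v)%C l t.
Proof.
  intros e He.
  assert (P : 0 < Rabs l + 1) by apply Rbound_pos.
  destruct (rcont_cis t (e / (2 * (Rabs l + 1)))) as [d [Hd H]]; [apply Rdiv_lt_0_compat; lra|].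
  exists (Rmin d (e / 2)). split; [apply Rmin_pos; lra|]. intros u v Hu Hv.
  assert (M1 : Rmin d (e / 2) <= d) by apply Rmin_l. assert (M2 : Rmin d (e / 2) <= e / 2) by apply Rmin_r.
  replace (w + u * cis v - (w + l * cis t))%C with (RtoC (u - l) * cis v + RtoC l * (cis v - cis t))%C
    by (rewrite RtoC_minus; ring).
  eapply Rle_lt_trans; [apply Cmod_triangle|]. rewrite !Cmod_mult, !Cmod_R, Cmod_cis.
  specialize (H v ltac:(lra)).
  apply Rmult_lt_compat_r with (r := Rabs l + 1) in H; [|assumption].
  replace (e / (2 * (Rabs l + 1)) * (Rabs l + 1)) with (e / 2) in H by (field; lra).
  generalize (Cmod_ge_0 (cis v - cis t)). nra.
Qed.

Lemma Cmod_circle w (l t : R) : Cmod (w + RtoC l * cis t - w) = Rabs l.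
Proof.
  replace (w + l * cis t - w)%C with (RtoC l * cis t)%C by ring.
  rewrite Cmod_mult, Cmod_cis, Cmod_R. ring.
Qed.

Lemma cder_circle_radius w (t l : R) : cder (fun u => w + RtoC u * cis t)%C l (cis t).
Proof.
  eapply cder_eq; [apply (cder_plus (fun _ => w)); [apply cder_const|apply cder_scal]|ring].
Qed.

Lemma cder_circle_angle w (l t : R) : cder (fun u => w + RtoC l * cis u)%C t (RtoC l * (Ci * cis t))%C.
Proof.
  replace (RtoC l * (Ci * cis t))%C with (0 + (0 * cis t + RtoC l * (Ci * cis t)))%C by ring.
  apply (cder_plus (fun _ => w)); [apply cder_const|].
  apply (cder_mult (fun _ => RtoC l)); [apply cder_const|apply cder_cis].
Qed.

Lemma two_PI_pos : 0 < 2 * PI.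
Proof. generalize PI_RGT_0; lra. Qed.

(** [B l] is the integral in the formula on the circle of radius [l], and [D l] is [2 PI] times the
    mean of the derivative on that circle. Differentiation in the radius gives [B' = D], integration
    by parts in the angle gives [B l = l * D l], so [D] is constant; as [l] tends to [0] it tends to
    [2 PI] times the derivative at the centre. *)
Lemma cauchy_derivative (f : C -> C) (w : C) (R0 r : R) : 0 < r < R0 ->
  (forall b, Cmod (b - w) < R0 -> holo_at f b) ->
  C_derive f w = (/ RtoC (2 * PI * r) * CInt (fun t => f (w + RtoC r * cis t) * / cis t) 0 (2 * PI))%C.
Proof.
  intros Hr Hf.
  pose (B := fun l => CInt (fun t => f (w + RtoC l * cis t) * / cis t)%C 0 (2 * PI)).
  pose (D := fun l => CInt (fun t => C_derive f (w + RtoC l * cis t)) 0 (2 * PI)).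
  assert (Hc : forall l t, Rabs l < R0 -> holo_at f (w + RtoC l * cis t)%C).
  { intros l t Hl. apply Hf. rewrite Cmod_circle. assumption. }
  assert (CB : forall l t, Rabs l < R0 -> rcont (fun t => f (w + RtoC l * cis t) * / cis t)%C t).
  { intros l t Hl. apply rcont_mult; [|apply rcont_cis_inv].
    apply (rcont_comp f); [apply Ccont_holo; auto|apply rcont_circle]. }
  assert (CD : forall l t, Rabs l < R0 -> rcont (fun t => C_derive f (w + RtoC l * cis t))%C t).
  { intros l t Hl. apply (rcont_comp (C_derive f)); [apply Ccont_C_derive; auto|apply rcont_circle]. }
  assert (DB : forall l, Rabs l < R0 -> cder B l (D l)).
  { intros l Hl. unfold B, D. 
    apply (cder_CInt_param (fun l t => f (w + RtoC l * cis t) * / cis t)%C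
      (fun l t => C_derive f (w + RtoC l * cis t)) l (R0 - Rabs l)); [lra| | |].
    - intros x t Hx. assert (Hx2 : Rabs x < R0).
      { replace x with ((x - l) + l) by ring. eapply Rle_lt_trans; [apply Rabs_triang|]. lra. }
      replace (C_derive f (w + x * cis t)) with
        (C_derive f (w + x * cis t) * cis t * / cis t + f (w + x * cis t) * 0)%C
        by (field; apply cis_neq_0).
      apply (cder_mult (fun u => f (w + RtoC u * cis t)%C) (fun _ => / cis t)%C); [|apply cder_const].
      apply cder_holo; [auto|apply cder_circle_radius].
    - intros t. apply (rcont2_comp (C_derive f)); [apply Ccont_C_derive; auto|apply rcont2_circle].
    - intros x Hx. assert (Hx2 : Rabs x < R0).
      { replace x with ((x - l) + l) by ring. eapply Rle_lt_trans; [apply Rabs_triang|]. lra. }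
      apply cint_rcont_all. intros t. apply CB; assumption. }
  assert (BD : forall l, Rabs l < R0 -> B l = (RtoC l * D l)%C).
  { intros l Hl. unfold B, D.
    rewrite <- CInt_scal by (apply cint_rcont_all; auto).
    apply Ceq_minus. rewrite <- CInt_minus.
    (* This primitive has period [2 PI], so the integral of its derivative vanishes. *)
    - rewrite (CInt_cder (fun t => Ci * (f (w + RtoC l * cis t) * / cis t))%C).
      + unfold cis. replace (RtoC (2 * PI) * Ci)%C with (RtoC (2 * PI * INR 1) * Ci)%C
          by (simpl; rewrite Rmult_1_r; reflexivity).
        rewrite Cexp_2PI_int, Cmult_0_l, Cexp_0. ring.
      + intros t _.
        eapply cder_eq.
        { apply (cder_mult (fun _ => Ci)); [apply cder_const|].
          apply (cder_mult (fun u => f (w + RtoC l * cis u)%C)); [|apply cder_cis_inv].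
          apply cder_holo; [auto|apply cder_circle_angle]. }
        assert (E : (Ci * Ci = - (1))%C) by (apply Ceq_parts; simpl; ring).
        transitivity (- (Ci * Ci) * (f (w + l * cis t) * / cis t) + (Ci * Ci) * (l * C_derive f (w + l * cis t)))%C.
        * field. apply cis_neq_0.
        * rewrite E. ring.
      + intros t _. apply rcont_minus; [apply CB; assumption|].
        apply (rcont_mult (fun _ => RtoC l)); [apply rcont_const|apply CD; assumption].
    - apply cint_rcont_all; auto.
    - apply cint_scal, cint_rcont_all; auto. }
  (* [B l / l] has derivative [0], hence is constant on [(0, r]] *)
  assert (K : forall l, 0 < l <= r -> D l = D r).
  { intros l Hl.
    apply Cmod_small_eq. intros e He. eapply Rle_trans; [|apply Rlt_le, He].
    assert (H := mean_value_le (fun l => B l * RtoC (/ l))%C (fun _ => RtoC 0) l r 0 ltac:(lra)).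
    assert (E : forall u, 0 < u < R0 -> (B u * RtoC (/ u))%C = D u).
    { intros u Hu. rewrite BD by (rewrite Rabs_pos_eq; lra). rewrite RtoC_inv by lra. field.
      intros Q. apply RtoC_inj in Q. lra. }
    cbv beta in H. rewrite !E in H by lra. rewrite Cmod_minus_sym. replace 0 with (0 * (r - l)) at 1 by ring. apply H.
    - intros t Ht.
      assert (Nt : RtoC t <> RtoC 0) by (intros Q; apply RtoC_inj in Q; lra).
      replace (RtoC 0) with (D t * RtoC (/ t) + B t * RtoC (- / (t * t)))%C.
      2:{ rewrite BD by (rewrite Rabs_pos_eq; lra). rewrite RtoC_opp, !RtoC_inv, RtoC_mult by nra.
          field. assumption. }
      apply (cder_mult B (fun u => RtoC (/ u))); [apply DB; rewrite Rabs_pos_eq; lra|].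
      split; simpl; [auto_derive; [lra|field; lra]|auto_derive; trivial].
    - intros. rewrite Cmod_0. lra. }
  assert (L : D r = (RtoC (2 * PI) * C_derive f w)%C).
  { destruct (holo_at_C_derive f w) as (K0 & d & Hd & HK & _ & L & _).
    { apply Hf. rewrite Cmod_diag. lra. }
    assert (P2 := two_PI_pos).
    apply Cmod_small_eq. intros e He.
    (* A radius so small that, by the Lipschitz bound [K0] on the derivative, [D l] is within [e] of
       its limit. *)
    set (l := Rmin r (Rmin (d / 2) (e / ((K0 + 1) * (2 * PI))))).
    assert (Hl : 0 < l) by (repeat apply Rmin_pos; try lra; apply Rdiv_lt_0_compat; try lra; apply Rmult_lt_0_compat; lra).
    assert (Hl1 : l <= r) by apply Rmin_l.
    assert (Hl2 : l <= d / 2) by (eapply Rle_trans; [apply Rmin_r|apply Rmin_l]).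
    assert (Hl3 : l <= e / ((K0 + 1) * (2 * PI))) by (eapply Rle_trans; [apply Rmin_r|apply Rmin_r]).
    rewrite <- (K l) by lra. unfold D.
    replace (RtoC (2 * PI) * C_derive f w)%C with (CInt (fun _ => C_derive f w) 0 (2 * PI)).
    2:{ rewrite CInt_const, Rminus_0_r. reflexivity. }
    rewrite <- CInt_minus; [|apply cint_rcont_all; intros; apply CD; rewrite Rabs_pos_eq; lra|apply cint_const].
    eapply Rle_trans; [apply (CInt_Cmod_le_const _ (K0 * l))|].
    - lra.
    - apply cint_minus; [apply cint_rcont_all; intros; apply CD; rewrite Rabs_pos_eq; lra|apply cint_const].
    - intros t _. eapply Rle_trans; [apply L|].
      + rewrite Cmod_diag. lra.
      + rewrite Cmod_circle, Rabs_pos_eq; lra.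
      + rewrite Cmod_circle, Rabs_pos_eq; lra.
    - rewrite Rminus_0_r. apply Rle_trans with ((K0 + 1) * l * (2 * PI)).
      + apply Rmult_le_compat_r; [lra|]. apply Rmult_le_compat_r; lra.
      + replace ((K0 + 1) * l * (2 * PI)) with (l * ((K0 + 1) * (2 * PI))) by ring.
        apply Rle_trans with (e / ((K0 + 1) * (2 * PI)) * ((K0 + 1) * (2 * PI))).
        * apply Rmult_le_compat_r; [|assumption]. apply Rmult_le_pos; lra.
        * right. field. lra. }
  fold (B r). rewrite BD by (rewrite Rabs_pos_eq; lra). rewrite L, !RtoC_mult.
  assert (P := PI_RGT_0).
  field. repeat split; intros Q; apply RtoC_inj in Q; lra.
Qed.

(** The factor 2 comes from using the circle of radius [R0 / 2], since [f] is controlled only on the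
    open ball. *)
Lemma cauchy_bound (f : C -> C) (w : C) (R0 M : R) : 0 < R0 ->
  (forall b, Cmod (b - w) < R0 -> holo_at f b) ->
  (forall b, Cmod (b - w) < R0 -> Cmod (f b) <= M) ->
  Cmod (C_derive f w) <= 2 * M / R0.
Proof.
  intros HR Hf HM. assert (P := two_PI_pos).
  rewrite (cauchy_derivative f w R0 (R0 / 2)) by (assumption || lra).
  assert (Hc : forall t, Cmod (w + RtoC (R0 / 2) * cis t - w) < R0).
  { intros t. rewrite Cmod_circle, Rabs_pos_eq; lra. }
  rewrite Cmod_mult, Cmod_inv, Cmod_R.
  2:{ intros Q. apply RtoC_inj in Q. nra. }
  rewrite Rabs_pos_eq by nra.
  apply Rle_trans with (/ (2 * PI * (R0 / 2)) * (M * (2 * PI - 0))).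
  - apply Rmult_le_compat_l; [apply Rlt_le, Rinv_0_lt_compat; nra|].
    apply CInt_Cmod_le_const; [lra| |].
    + apply cint_rcont_all. intros t. apply rcont_mult; [|apply rcont_cis_inv].
      apply (rcont_comp f); [apply Ccont_holo; auto|apply rcont_circle].
    + intros t _. rewrite Cmod_mult, Cmod_inv, Cmod_cis by apply cis_neq_0.
      rewrite Rinv_1, Rmult_1_r. auto.
  - right. field. lra.
Qed.

Lemma cder_segment (a b : C) (t : R) : cder (fun u => a + RtoC u * (b - a))%C t (b - a)%C.
Proof.
  eapply cder_eq; [apply (cder_plus (fun _ => a)); [apply cder_const|apply cder_scal]|ring].
Qed.

Lemma Cmod_segment (s a b : C) (r t : R) : 0 <= t <= 1 -> Cmod (a - s) < r -> Cmod (b - s) < r ->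
  Cmod (a + RtoC t * (b - a) - s) < r.
Proof.
  intros Ht Ha Hb.
  replace (a + t * (b - a) - s)%C with (RtoC (1 - t) * (a - s) + RtoC t * (b - s))%C
    by (rewrite RtoC_minus; ring).
  eapply Rle_lt_trans; [apply Cmod_triangle|]. rewrite !Cmod_mult, !Cmod_R, !Rabs_pos_eq by lra.
  destruct (Req_dec t 0) as [E|E]; [subst; lra|]. nra.
Qed.

(** [cauchy_bound] makes [f] Lipschitz on the half ball; the difference of Cauchy's formula at two
    centres then makes the derivative Lipschitz on the quarter ball, and integration along a segment
    gives a quadratic remainder. The point is the constant: it depends on [M] and [R0] alone, hence
    is uniform over bounded families. *)
Lemma cauchy_three_point (f : C -> C) (s : C) (R0 M : R) : 0 < R0 ->
  (forall b, Cmod (b - s) < R0 -> holo_at f b) ->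
  (forall b, Cmod (b - s) < R0 -> Cmod (f b) <= M) ->
  forall a b c, Cmod (a - s) < R0 / 4 -> Cmod (b - s) < R0 / 4 -> Cmod (c - s) < R0 / 4 ->
    three_point f (2 * (16 * M / (R0 * R0))) a b c.
Proof.
  intros HR Hf HM.
  assert (M0 : 0 <= M).
  { apply Rle_trans with (Cmod (f s)); [apply Cmod_ge_0|]. apply HM.
    rewrite Cmod_diag. assumption. }
  assert (P := two_PI_pos).
  assert (HK : 0 <= 16 * M / (R0 * R0)) by (apply Rmult_le_pos; [lra|apply Rlt_le, Rinv_0_lt_compat; nra]).
  assert (D1 : forall a, Cmod (a - s) < R0 / 2 -> Cmod (C_derive f a) <= 4 * M / R0).
  { intros a Ha. replace (4 * M / R0) with (2 * M / (R0 / 2)) by (field; lra).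
    apply cauchy_bound; [lra| |]; intros b Hb; [apply Hf|apply HM];
    (eapply Rle_lt_trans; [apply (Cmod_triangle_dist b a s)|]; lra). }
  assert (F : forall a b, Cmod (a - s) < R0 / 2 -> Cmod (b - s) < R0 / 2 ->
    Cmod (f b - f a) <= 4 * M / R0 * Cmod (b - a)).
  { intros a b Ha Hb.
    assert (H := mean_value_le (fun t => f (a + RtoC t * (b - a))%C)
      (fun t => C_derive f (a + RtoC t * (b - a)) * (b - a))%C 0 1 (4 * M / R0 * Cmod (b - a)) ltac:(lra)).
    cbv beta in H.
    replace (a + 1 * (b - a))%C with b in H by ring. replace (a + 0 * (b - a))%C with a in H by ring.
    eapply Rle_trans; [apply H|right; ring].
    - intros t Ht. apply cder_holo; [|apply cder_segment]. apply Hf.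
      assert (Cmod (a + t * (b - a) - s) < R0 / 2) by (apply Cmod_segment; assumption). lra.
    - intros t Ht. rewrite Cmod_mult. apply Rmult_le_compat_r; [apply Cmod_ge_0|].
      apply D1. apply Cmod_segment; assumption. }
  assert (D2 : forall a b, Cmod (a - s) < R0 / 4 -> Cmod (b - s) < R0 / 4 ->
    Cmod (C_derive f b - C_derive f a) <= 16 * M / (R0 * R0) * Cmod (b - a)).
  { intros a b Ha Hb.
    assert (Hin : forall a t, Cmod (a - s) < R0 / 4 -> Cmod (a + RtoC (R0 / 4) * cis t - s) < R0 / 2).
    { intros a' t Ha'. eapply Rle_lt_trans; [apply (Cmod_triangle_dist _ a' s)|].
      rewrite Cmod_circle, Rabs_pos_eq by lra. lra. }
    assert (CI : forall a, Cmod (a - s) < R0 / 4 ->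
      cint (fun t => f (a + RtoC (R0 / 4) * cis t) * / cis t)%C 0 (2 * PI)).
    { intros a' Ha'. apply cint_rcont_all. intros t. apply rcont_mult; [|apply rcont_cis_inv].
      apply (rcont_comp f); [|apply rcont_circle]. apply Ccont_holo, Hf. specialize (Hin a' t Ha'). lra. }
    rewrite !(cauchy_derivative f _ (R0 / 2) (R0 / 4)); try lra.
    2, 3: intros b' Hb'; apply Hf.
    2: eapply Rle_lt_trans; [apply (Cmod_triangle_dist _ a s)|]; lra.
    2: eapply Rle_lt_trans; [apply (Cmod_triangle_dist _ b s)|]; lra.
    match goal with |- Cmod (?x * ?A - ?x * ?B) <= _ => replace (x * A - x * B)%C with (x * (A - B))%C by ring end.
    rewrite <- CInt_minus by auto.
    rewrite Cmod_mult, Cmod_inv, Cmod_R.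
    2:{ intros Q. apply RtoC_inj in Q. nra. }
    rewrite Rabs_pos_eq by nra.
    apply Rle_trans with (/ (2 * PI * (R0 / 4)) * (4 * M / R0 * Cmod (b - a) * (2 * PI - 0))).
    - apply Rmult_le_compat_l; [apply Rlt_le, Rinv_0_lt_compat; nra|].
      apply CInt_Cmod_le_const; [lra|apply cint_minus; auto|].
      intros t _.
      match goal with |- Cmod (?A * ?x - ?B * ?x) <= _ => replace (A * x - B * x)%C with ((A - B) * x)%C by ring end.
      rewrite Cmod_mult, Cmod_inv, Cmod_cis by apply cis_neq_0. rewrite Rinv_1, Rmult_1_r.
      eapply Rle_trans; [apply F; apply Hin; assumption|]. right. f_equal. f_equal. ring.
    - right. field. lra. }
  apply (three_point_quadratic f (C_derive f) (16 * M / (R0 * R0)) (fun a => Cmod (a - s) < R0 / 4) HK).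
  intros a b Ha Hb.
  assert (H := mean_value_le (fun t => f (a + RtoC t * (b - a)) - RtoC t * (C_derive f a * (b - a)))%C
    (fun t => C_derive f (a + RtoC t * (b - a)) * (b - a) - C_derive f a * (b - a))%C 0 1
    (16 * M / (R0 * R0) * Cmod (b - a) ^ 2) ltac:(lra)).
  cbv beta in H.
  replace (a + 1 * (b - a))%C with b in H by ring. replace (a + 0 * (b - a))%C with a in H by ring.
  replace (f b - f a - C_derive f a * (b - a))%C with
    (f b - 1 * (C_derive f a * (b - a)) - (f a - 0 * (C_derive f a * (b - a))))%C by ring.
  eapply Rle_trans; [apply H|right; ring].
  - intros t Ht. apply cder_minus; [|apply cder_scal]. apply cder_holo; [|apply cder_segment]. apply Hf.
    assert (Cmod (a + t * (b - a) - s) < R0 / 4) by (apply Cmod_segment; assumption). lra.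
  - intros t Ht.
    replace (C_derive f (a + t * (b - a)) * (b - a) - C_derive f a * (b - a))%C with
      ((C_derive f (a + t * (b - a)) - C_derive f a) * (b - a))%C by ring.
    rewrite Cmod_mult. 
    assert (A := D2 a (a + t * (b - a))%C Ha ltac:(apply Cmod_segment; assumption)).
    replace (a + t * (b - a) - a)%C with (t * (b - a))%C in A by ring.
    rewrite Cmod_mult, Cmod_R, Rabs_pos_eq in A by lra.
    replace (16 * M / (R0 * R0) * Cmod (b - a) ^ 2) with ((16 * M / (R0 * R0) * Cmod (b - a)) * Cmod (b - a)) by ring.
    apply Rmult_le_compat_r; [apply Cmod_ge_0|]. eapply Rle_trans; [apply A|].
    apply Rmult_le_compat_l; [assumption|]. generalize (Cmod_ge_0 (b - a)). nra.
Qed.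

(** Pointwise convergence of a uniformly bounded family suffices, because the three-point constants
    do not depend on [n]. *)
Lemma holo_lim (fn : nat -> C -> C) (f : C -> C) (s : C) (R0 M : R) : 0 < R0 ->
  (forall n b, Cmod (b - s) < R0 -> holo_at (fn n) b) ->
  (forall n b, Cmod (b - s) < R0 -> Cmod (fn n b) <= M) ->
  (forall b, Cmod (b - s) < R0 -> Ccv (fun n => fn n b) (f b)) -> holo_at f s.
Proof.
  intros HR H1 H2 H3. apply (holo_three_point f s (R0 / 4) (2 * (16 * M / (R0 * R0)))); [lra|].
  intros a b c Ha Hb Hc. apply (three_point_lim fn); [|apply H3; lra..].
  intros n. apply (cauchy_three_point (fn n) s R0 M); auto.
Qed.

(** By linearity the three-point combination moves under the integral sign, where
    [cauchy_three_point] bounds it uniformly in [t]. *)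
Lemma holo_CInt (F : C -> R -> C) (s : C) (R0 M a b : R) : 0 < R0 -> a <= b ->
  (forall t w, a < t < b -> Cmod (w - s) < R0 -> holo_at (fun x => F x t) w) ->
  (forall t w, a < t < b -> Cmod (w - s) < R0 -> Cmod (F w t) <= M) ->
  (forall w, Cmod (w - s) < R0 -> cint (F w) a b) ->
  holo_at (fun w => CInt (F w) a b) s.
Proof.
  intros HR Hab H1 H2 H3.
  apply (holo_three_point _ s (R0 / 4) (2 * (16 * M / (R0 * R0)) * (b - a))); [lra|].
  intros x y z Hx Hy Hz. unfold three_point.
  assert (I : forall w u, Cmod (w - s) < R0 / 4 -> cint (fun t => F w t * u)%C a b).
  { intros w u Hw. apply (cint_ext (fun t => u * F w t)%C); [intros; ring|]. apply cint_scal, H3; lra. }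
  assert (E : forall w u, Cmod (w - s) < R0 / 4 -> (CInt (F w) a b * u)%C = CInt (fun t => F w t * u)%C a b).
  { intros w u Hw. rewrite Cmult_comm, <- CInt_scal by (apply H3; lra). apply CInt_ext. intros; ring. }
  rewrite !E by assumption.
  assert (Ixy : cint (fun t => F x t * (y - z) + F y t * (z - x))%C a b) by (apply cint_plus; auto).
  rewrite <- CInt_plus by auto.
  rewrite <- (CInt_plus (fun t => F x t * (y - z) + F y t * (z - x))%C) by auto.
  eapply Rle_trans; [apply (CInt_Cmod_le_const _ (2 * (16 * M / (R0 * R0)) * (Cmod (y - z) * Cmod (z - x) * Cmod (x - y))))|].
  - assumption.
  - apply (cint_plus (fun t => F x t * (y - z) + F y t * (z - x))%C); auto.
  - intros t Ht. apply (cauchy_three_point (fun w => F w t) s R0 M); auto.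
  - right. ring.
Qed.

(** Cauchy's formula on circles of a fixed radius [r] displays the derivative as an integral whose
    integrand is holomorphic in the centre. *)
Lemma holo_C_derive (f : C -> C) (s : C) (R0 : R) : 0 < R0 ->
  (forall b, Cmod (b - s) < R0 -> holo_at f b) -> holo_at (C_derive f) s.
Proof.
  intros HR Hf.
  destruct (holo_at_C_derive f s) as (K & d & Hd & HK & _ & _ & _ & B).
  { apply Hf. rewrite Cmod_diag. assumption. }
  set (r := Rmin R0 d / 4).
  assert (Hr : 0 < r) by (unfold r; assert (0 < Rmin R0 d) by (apply Rmin_pos; lra); lra).
  assert (Hr1 : 4 * r <= R0) by (unfold r; assert (A := Rmin_l R0 d); lra).
  assert (Hr2 : 4 * r <= d) by (unfold r; assert (A := Rmin_r R0 d); lra).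
  assert (Hin : forall w t, Cmod (w - s) < r -> Cmod (w + RtoC r * cis t - s) < 2 * r).
  { intros w t Hw. eapply Rle_lt_trans; [apply (Cmod_triangle_dist _ w s)|].
    rewrite Cmod_circle, Rabs_pos_eq by lra. lra. }
  apply (holo_at_ext_loc (fun w => / RtoC (2 * PI * r) * CInt (fun t => f (w + RtoC r * cis t) * / cis t) 0 (2 * PI))%C
    _ s r Hr).
  { intros w Hw. symmetry. apply (cauchy_derivative f w (2 * r)); [lra|].
    intros b Hb. apply Hf. eapply Rle_lt_trans; [apply (Cmod_triangle_dist b w s)|]. lra. }
  apply holo_mult; [apply holo_const|].
  apply (holo_CInt (fun w t => f (w + RtoC r * cis t) * / cis t)%C s r K); [assumption| | | |].
  - generalize two_PI_pos; lra.
  - intros t w _ Hw. apply holo_mult; [|apply holo_const].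
    apply (holo_comp f (fun x => x + RtoC r * cis t)%C).
    + apply holo_plus; [apply holo_id|apply holo_const].
    + apply Hf. specialize (Hin w t Hw). lra.
  - intros t w _ Hw. rewrite Cmod_mult, Cmod_inv, Cmod_cis by apply cis_neq_0.
    rewrite Rinv_1, Rmult_1_r. apply B. specialize (Hin w t Hw). lra.
  - intros w Hw. apply cint_rcont_all. intros t. apply rcont_mult; [|apply rcont_cis_inv].
    apply (rcont_comp f); [|apply rcont_circle]. apply Ccont_holo, Hf. specialize (Hin w t Hw). lra.
Qed.

(** * Removal of the singularity of a difference quotient *)

Definition diff_quotient (f : C -> C) (p s : C) : C :=
  if Ceq_dec s p then C_derive f p else ((f s - f p) / (s - p))%C.

Lemma holo_diff_quotient_other (f : C -> C) (p s : C) : s <> p -> holo_at f s -> holo_at (diff_quotient f p) s.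
Proof.
  intros N H. assert (P : 0 < Cmod (s - p)) by (apply Cmod_gt_0, Cminus_eq_contra, N).
  apply (holo_at_ext_loc (fun s => (f s - f p) / (s - p))%C _ s (Cmod (s - p)) P).
  - intros a Ha. unfold diff_quotient. destruct (Ceq_dec a p) as [E|_]; [|reflexivity].
    subst. rewrite Cmod_minus_sym in Ha. lra.
  - apply holo_div; [apply Cminus_eq_contra, N| |];
    (apply holo_minus; [|apply holo_const]); [assumption|apply holo_id].
Qed.

(** Near [p] the quotient is the integral over [[0, 1]] of the derivative at [p + t (w - p)], to
    which [holo_CInt] applies; the value at [w = p] comes out as the derivative. *)
Lemma holo_diff_quotient_center (f : C -> C) (p : C) (R0 : R) : 0 < R0 ->
  (forall b, Cmod (b - p) < R0 -> holo_at f b) -> holo_at (diff_quotient f p) p.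
Proof.
  intros HR Hf.
  destruct (holo_at_C_derive f p) as (K & d & Hd & HK & _ & _ & _ & B).
  { apply Hf. rewrite Cmod_diag. assumption. }
  set (r := Rmin R0 d).
  assert (Hr : 0 < r) by (apply Rmin_pos; lra).
  assert (Hr1 : r <= R0) by apply Rmin_l. assert (Hr2 : r <= d) by apply Rmin_r.
  assert (Hp : Cmod (p - p) < r) by (rewrite Cmod_diag; assumption).
  assert (Hs : forall w t, 0 <= t <= 1 -> Cmod (w - p) < r -> Cmod (p + RtoC t * (w - p) - p) < r).
  { intros w t Ht Hw. apply Cmod_segment; assumption. }
  assert (Hc : forall w, Cmod (w - p) < r -> forall t, 0 <= t <= 1 -> rcont (fun t => C_derive f (p + RtoC t * (w - p))) t).
  { intros w Hw t Ht. apply (rcont_comp (C_derive f)).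
    - apply Ccont_C_derive, Hf. specialize (Hs w t Ht Hw). lra.
    - apply (cder_rcont _ _ _ (cder_segment p w t)). }
  assert (Hi : forall w, Cmod (w - p) < r -> cint (fun t => C_derive f (p + RtoC t * (w - p))) 0 1).
  { intros w Hw. apply cint_rcont. rewrite Rmin_left, Rmax_right by lra. auto. }
  apply (holo_at_ext_loc (fun w => CInt (fun t => C_derive f (p + RtoC t * (w - p))) 0 1) _ p r Hr).
  - intros w Hw. unfold diff_quotient. destruct (Ceq_dec w p) as [E|N].
    + subst. rewrite (CInt_ext _ (fun _ => C_derive f p)) by (intros; f_equal; ring).
      rewrite CInt_const, Rminus_0_r. ring.
    + assert (P := Cminus_eq_contra _ _ N).
      assert (E : ((w - p) * CInt (fun t => C_derive f (p + RtoC t * (w - p))) 0 1 = f w - f p)%C).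
      { rewrite <- CInt_scal by auto.
        rewrite (CInt_cder (fun t => f (p + RtoC t * (w - p))%C)).
        - f_equal; [f_equal; ring|]. f_equal. f_equal; ring.
        - rewrite Rmin_left, Rmax_right by lra. intros t Ht. rewrite Cmult_comm.
          apply cder_holo; [|apply cder_segment]. apply Hf. specialize (Hs w t Ht Hw). lra.
        - rewrite Rmin_left, Rmax_right by lra. intros t Ht.
          apply (rcont_mult (fun _ => w - p)%C); [apply rcont_const|apply Hc; assumption]. }
      rewrite <- E. field. assumption.
  - apply (holo_CInt (fun w t => C_derive f (p + RtoC t * (w - p))) p r K); [assumption|lra| | |assumption].
    + intros t w Ht Hw. apply (holo_comp (C_derive f) (fun x => p + RtoC t * (x - p))%C).
      * apply holo_plus; [apply holo_const|]. apply holo_mult; [apply holo_const|].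
        apply holo_minus; [apply holo_id|apply holo_const].
      * assert (A := Hs w t ltac:(lra) Hw).
        apply (holo_C_derive f _ (R0 - Cmod (p + t * (w - p) - p))); [lra|].
        intros b Hb. apply Hf. eapply Rle_lt_trans; [apply (Cmod_triangle_dist b (p + t * (w - p)) p)|]. lra.
    + intros t w Ht Hw. apply B. assert (A := Hs w t ltac:(lra) Hw). lra.
Qed.

Lemma holo_diff_quotient (f : C -> C) (p s : C) (R0 : R) : 0 < R0 ->
  (forall b, Cmod (b - p) < R0 -> holo_at f b) -> holo_at f s -> holo_at (diff_quotient f p) s.
Proof.
  intros HR Hp Hs. destruct (Ceq_dec s p) as [E|N].
  - subst. apply (holo_diff_quotient_center f p R0); assumption.
  - apply holo_diff_quotient_other; assumption.
Qed.

(** * Series *)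

Fixpoint Csum (u : nat -> C) (n : nat) : C :=
  match n with O => RtoC 0 | S m => (Csum u m + u m)%C end.

Fixpoint rsum (u : nat -> R) (n : nat) : R :=
  match n with O => 0 | S m => rsum u m + u m end.

Lemma rsum_sum_n u n : rsum u (S n) = sum_n u n.
Proof.
  induction n; [simpl; rewrite sum_O; ring|]. rewrite sum_Sn, <- IHn. reflexivity.
Qed.

Lemma is_series_rsum u l : is_series u l <-> is_lim_seq (rsum u) l.
Proof.
  split.
  - intros H. apply is_lim_seq_incr_1. apply (is_lim_seq_ext (sum_n u)); [|exact H].
    intros n. symmetry. apply rsum_sum_n.
  - intros H. apply is_lim_seq_incr_1 in H.
    apply (is_lim_seq_ext _ (sum_n u)) in H; [exact H|]. intros n. apply rsum_sum_n.
Qed.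

Lemma Re_Csum u n : Re (Csum u n) = rsum (fun k => Re (u k)) n.
Proof. induction n; [reflexivity|]. simpl Csum. rewrite re_plus, IHn. reflexivity. Qed.

Lemma Im_Csum u n : Im (Csum u n) = rsum (fun k => Im (u k)) n.
Proof. induction n; [reflexivity|]. simpl Csum. rewrite im_plus, IHn. reflexivity. Qed.

Lemma Ccv_CSeries u l : Ccv (Csum u) l -> CSeries u = l.
Proof.
  intros H. apply Ccv_parts in H. destruct H as [H1 H2].
  unfold CSeries. apply Ceq_parts; simpl; apply is_series_unique, is_series_rsum;
  [apply (is_lim_seq_ext _ _ _ (Re_Csum u)), H1|apply (is_lim_seq_ext _ _ _ (Im_Csum u)), H2].
Qed.

Lemma Csum_ext u v n : (forall k, (k < n)%nat -> u k = v k) -> Csum u n = Csum v n.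
Proof. induction n; intros H; [reflexivity|]. simpl. rewrite IHn, H by (auto with arith || lia). reflexivity. Qed.

Lemma Csum_plus u v n : Csum (fun k => u k + v k)%C n = (Csum u n + Csum v n)%C.
Proof. induction n; simpl; [ring|]. rewrite IHn. ring. Qed.

Lemma Csum_scal c u n : Csum (fun k => c * u k)%C n = (c * Csum u n)%C.
Proof. induction n; simpl; [ring|]. rewrite IHn. ring. Qed.

Lemma Csum_zero n : Csum (fun _ => RtoC 0) n = RtoC 0.
Proof. induction n; simpl; [reflexivity|]. rewrite IHn. ring. Qed.

Lemma Csum_add u n m : Csum u (n + m) = (Csum u n + Csum (fun k => u (n + k)%nat) m)%C.
Proof.
  induction m; simpl; [rewrite Nat.add_0_r; ring|].
  rewrite Nat.add_succ_r. simpl. rewrite IHm. ring.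
Qed.

Lemma Csum_swap (u : nat -> nat -> C) n m :
  Csum (fun i => Csum (u i) m) n = Csum (fun j => Csum (fun i => u i j) n) m.
Proof.
  induction n; simpl.
  - symmetry. apply Csum_zero.
  - rewrite IHn, <- Csum_plus. reflexivity.
Qed.

Lemma rsum_le u v n : (forall k, (k < n)%nat -> u k <= v k) -> rsum u n <= rsum v n.
Proof.
  induction n; intros H; simpl; [lra|]. apply Rplus_le_compat; [apply IHn|apply H; lia].
  intros; apply H; lia.
Qed.

Lemma Cmod_Csum u n : Cmod (Csum u n) <= rsum (fun k => Cmod (u k)) n.
Proof.
  induction n; simpl; [rewrite Cmod_0; lra|]. eapply Rle_trans; [apply Cmod_triangle|]. lra.
Qed.

Definition rtail (a : nat -> R) (n : nat) : R := Series a - rsum a n.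

Lemma rtail_lim a : ex_series a -> is_lim_seq (rtail a) 0.
Proof.
  intros H. apply Series_correct, is_series_rsum in H.
  replace (Finite 0) with (Finite (Series a - Series a)) by (f_equal; ring).
  apply is_lim_seq_minus'; [apply is_lim_seq_const|assumption].
Qed.

Lemma rsum_mono a n m : (forall k, 0 <= a k) -> (n <= m)%nat -> rsum a n <= rsum a m.
Proof. intros Ha H. induction H; [lra|]. simpl. specialize (Ha m). lra. Qed.

Lemma rsum_le_Series a n : (forall k, 0 <= a k) -> ex_series a -> rsum a n <= Series a.
Proof.
  intros Ha H. apply Series_correct, is_series_rsum in H.
  apply (is_lim_seq_le_loc (fun _ => rsum a n) (rsum a) (rsum a n) (Series a)); [|apply is_lim_seq_const|exact H].
  exists n. intros m Hm. apply rsum_mono; assumption.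
Qed.

Lemma Csum_diff_le u a n m : (forall k, Cmod (u k) <= a k) -> (n <= m)%nat ->
  Cmod (Csum u m - Csum u n) <= rsum a m - rsum a n.
Proof.
  intros H Hnm. induction Hnm as [|m Hnm IH].
  - rewrite Cmod_diag. lra.
  - simpl. replace (Csum u m + u m - Csum u n)%C with ((Csum u m - Csum u n) + u m)%C by ring.
    eapply Rle_trans; [apply Cmod_triangle|]. specialize (H m). lra.
Qed.

Lemma Csum_cv u a : (forall k, Cmod (u k) <= a k) -> ex_series a ->
  exists l, Ccv (Csum u) l.
Proof.
  intros H Ha.
  assert (Pa : forall k, 0 <= a k) by (intros k; eapply Rle_trans; [apply Cmod_ge_0|apply H]).
  apply Ccauchy_cv. intros e He.
  assert (L := rtail_lim a Ha). apply is_lim_seq_spec in L. destruct (L (mkposreal e He)) as [N HN].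
  simpl in HN. exists N.
  assert (W : forall n m, (N <= n)%nat -> (n <= m)%nat -> Cmod (Csum u m - Csum u n) < e).
  { intros n m Hn Hm. eapply Rle_lt_trans; [apply (Csum_diff_le u a); assumption|].
    specialize (HN n Hn). rewrite Rminus_0_r in HN. unfold rtail in HN.
    assert (A := rsum_le_Series a m Pa Ha). assert (B := Rle_abs (Series a - rsum a n)). lra. }
  intros n m Hn Hm. destruct (Nat.le_ge_cases n m).
  - rewrite Cmod_minus_sym. apply W; assumption.
  - apply W; assumption.
Qed.

Lemma Csum_tail u a l n : (forall k, Cmod (u k) <= a k) -> ex_series a -> Ccv (Csum u) l ->
  Cmod (l - Csum u n) <= rtail a n.
Proof.
  intros H Ha Hl.
  assert (Pa : forall k, 0 <= a k) by (intros k; eapply Rle_trans; [apply Cmod_ge_0|apply H]).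
  apply (is_lim_seq_le_loc (fun m => Cmod (Csum u m - Csum u n)) (fun _ => rtail a n)
    (Cmod (l - Csum u n)) (rtail a n)).
  - exists n. intros m Hm. eapply Rle_trans; [apply (Csum_diff_le u a); assumption|].
    unfold rtail. assert (A := rsum_le_Series a m Pa Ha). lra.
  - apply (Ccv_Cmod (fun m => Csum u m - Csum u n)%C). apply Ccv_minus; [assumption|apply Ccv_const].
  - apply is_lim_seq_const.
Qed.

Lemma Csum_Cmod_le u a n : (forall k, Cmod (u k) <= a k) -> ex_series a -> Cmod (Csum u n) <= Series a.
Proof.
  intros H Ha.
  assert (Pa : forall k, 0 <= a k) by (intros k; eapply Rle_trans; [apply Cmod_ge_0|apply H]).
  eapply Rle_trans; [apply Cmod_Csum|]. eapply Rle_trans; [apply rsum_le; intros; apply H|].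
  apply rsum_le_Series; assumption.
Qed.

Lemma Csum_lim_Cmod_le u a l : (forall k, Cmod (u k) <= a k) -> ex_series a -> Ccv (Csum u) l ->
  Cmod l <= Series a.
Proof. intros H Ha Hl. apply (Ccv_Cmod_le (Csum u)); [assumption|]. intros n. apply Csum_Cmod_le; assumption. Qed.

Lemma ex_series_le_pos (a b : nat -> R) : (forall n, 0 <= a n <= b n) -> ex_series b -> ex_series a.
Proof.
  intros H. apply (@ex_series_le R_AbsRing R_CompleteNormedModule). intros n.
  destruct (H n). unfold norm; simpl. unfold abs; simpl. rewrite Rabs_pos_eq; assumption.
Qed.

(** * Integrals over vertical lines *)

Lemma atan_le_id x : 0 <= x -> 0 <= atan x <= x.
Proof.
  intros Hx. split.
  - rewrite <- atan_0. destruct Hx as [Hx|Hx]; [left; apply atan_increasing; assumption|subst; lra].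
  - destruct Hx as [Hx|Hx]; [|subst; rewrite atan_0; lra].
    destruct (MVT_cor2 atan (fun x => / (1 + x ^ 2)) 0 x Hx) as [c [Hc1 Hc2]].
    { intros; apply derivable_pt_lim_atan. }
    rewrite atan_0, !Rminus_0_r in Hc1. rewrite Hc1.
    assert (P : 1 <= 1 + c ^ 2) by (generalize (pow2_ge_0 c); lra).
    assert (/ (1 + c ^ 2) <= 1) by (rewrite <- Rinv_1 at 2; apply Rinv_le_contravar; lra).
    nra.
Qed.

Lemma atan_PI2 x : 0 < x -> PI / 2 - / x <= atan x <= PI / 2.
Proof.
  intros Hx. assert (A := atan_inv x Hx).
  destruct (atan_le_id (/ x)); [apply Rlt_le, Rinv_0_lt_compat; assumption|]. lra.
Qed.

Lemma is_RInt_inv_1_plus_sq K a b :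
  is_RInt (fun t => K * / (1 + t ^ 2)) a b (K * (atan b - atan a)).
Proof.
  apply (is_RInt_scal (V := R_NormedModule) (fun t => / (1 + t ^ 2)) a b K (atan b - atan a)).
  apply (is_RInt_derive (V := R_CompleteNormedModule) atan).
  - intros. apply is_derive_Reals, derivable_pt_lim_atan.
  - intros x _. apply (@ex_derive_continuous R_AbsRing R_NormedModule). auto_derive.
    assert (A := pow2_ge_0 x). simpl in A. lra.
Qed.

(** One majorant for all vertical lines. Its primitive [K atan] gives total mass [K PI] and explicit
    tails of size [K / n]. *)
Definition dominated (F : R -> C) (K : R) : Prop :=
  (forall t, rcont F t) /\ (forall t, Cmod (F t) <= K * / (1 + t ^ 2)).

Lemma dominated_cint F K a b : dominated F K -> cint F a b.
Proof. intros [H _]. apply cint_rcont_all. assumption. Qed.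

Lemma dominated_nonneg F K : dominated F K -> 0 <= K.
Proof.
  intros [_ H]. specialize (H 0). assert (P := Cmod_ge_0 (F 0)). simpl in H.
  rewrite Rmult_0_l, Rplus_0_r, Rinv_1 in H. lra.
Qed.

Lemma dominated_CInt F K a b : a <= b -> dominated F K -> Cmod (CInt F a b) <= K * (atan b - atan a).
Proof.
  intros Hab H. rewrite <- (is_RInt_unique _ _ _ _ (is_RInt_inv_1_plus_sq K a b)).
  apply CInt_Cmod_le; [assumption|apply (dominated_cint F K); assumption| |].
  - eexists. apply is_RInt_inv_1_plus_sq.
  - intros t _. apply H.
Qed.

(** Integer symmetric bounds reduce improper integrals to limits of sequences. For dominated
    functions this agrees with the two-sided improper integral, by [dominated_is_RInt_gen]. *)
Definition pvint (F : R -> C) (l : C) : Prop :=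
  Ccv (fun n => CInt F (- INR n) (INR n)) l.

Lemma INR_large (M : R) : exists N, forall n, (N <= n)%nat -> M < INR n.
Proof.
  assert (H := is_lim_seq_INR). apply is_lim_seq_spec in H. destruct (H M) as [N HN]. exists N. exact HN.
Qed.

Lemma is_lim_seq_inv_INR (K : R) : is_lim_seq (fun n => K * / INR n) 0.
Proof.
  replace (Finite 0) with (Rbar_mult K 0) by (simpl; f_equal; ring).
  apply is_lim_seq_scal_l. replace (Finite 0) with (Rbar_inv p_infty) by reflexivity.
  apply is_lim_seq_inv; [apply is_lim_seq_INR|discriminate].
Qed.

Lemma dominated_tail F K a b n : dominated F K -> (0 < n)%nat -> a <= - INR n -> INR n <= b ->
  Cmod (CInt F a b - CInt F (- INR n) (INR n)) <= 2 * K * / INR n.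
Proof.
  intros H Hn Ha Hb. assert (Pn : 0 < INR n) by (apply lt_0_INR; assumption).
  rewrite <- (CInt_Chasles F a (- INR n) b) by (apply (dominated_cint F K); assumption).
  rewrite <- (CInt_Chasles F (- INR n) (INR n) b) by (apply (dominated_cint F K); assumption).
  match goal with |- Cmod (?x + (?y + ?z) - ?y) <= _ => replace (x + (y + z) - y)%C with (x + z)%C by ring end.
  eapply Rle_trans; [apply Cmod_triangle|].
  assert (H1 := dominated_CInt F K a (- INR n) Ha H). assert (H2 := dominated_CInt F K (INR n) b Hb H).
  rewrite atan_opp in H1. assert (A := atan_PI2 _ Pn).
  assert (B1 := atan_bound a). assert (B2 := atan_bound b). assert (PK := dominated_nonneg F K H).
  assert (K * (- atan (INR n) - atan a) <= K * / INR n) by (apply Rmult_le_compat_l; lra).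
  assert (K * (atan b - atan (INR n)) <= K * / INR n) by (apply Rmult_le_compat_l; lra).
  lra.
Qed.

Lemma dominated_pvint F K : dominated F K -> exists l, pvint F l.
Proof.
  intros H. apply Ccauchy_cv. intros e He.
  assert (L := is_lim_seq_inv_INR (2 * K)). apply is_lim_seq_spec in L.
  destruct (L (mkposreal e He)) as [N HN]. simpl in HN. exists (S N).
  assert (W : forall n m, (S N <= n)%nat -> (n <= m)%nat ->
    Cmod (CInt F (- INR m) (INR m) - CInt F (- INR n) (INR n)) < e).
  { intros n m Hn Hm. apply le_INR in Hm.
    eapply Rle_lt_trans; [apply (dominated_tail F K _ _ n H); [lia|lra..]|].
    specialize (HN n ltac:(lia)). rewrite Rminus_0_r in HN. eapply Rle_lt_trans; [apply Rle_abs|exact HN]. }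
  intros n m Hn Hm. destruct (Nat.le_ge_cases n m).
  - rewrite Cmod_minus_sym. apply W; assumption.
  - apply W; assumption.
Qed.

Lemma dominated_pvint_le F K l : dominated F K -> pvint F l -> Cmod l <= K * PI.
Proof.
  intros H Hl. apply (Ccv_Cmod_le _ _ _ Hl). intros n.
  assert (P := pos_INR n).
  eapply Rle_trans; [apply dominated_CInt; [lra|exact H]|].
  apply Rmult_le_compat_l; [apply (dominated_nonneg F K H)|].
  assert (B1 := atan_bound (INR n)). assert (B2 := atan_bound (- INR n)). lra.
Qed.

Lemma dominated_is_RInt_gen F K l : dominated F K -> pvint F l ->
  @is_RInt_gen C_R_NormedModule F (Rbar_locally m_infty) (Rbar_locally p_infty) l.
Proof.
  intros H Hl P [e He].
  destruct (Hl (e / 2)) as [N1 HN1]; [generalize (cond_pos e); lra|].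
  assert (L := is_lim_seq_inv_INR (2 * K)). apply is_lim_seq_spec in L.
  destruct (L (mkposreal (e / 2) ltac:(generalize (cond_pos e); lra))) as [N2 HN2]. simpl in HN2.
  (* The successor keeps [n] positive, as [dominated_tail] demands. *)
  set (n := S (Nat.max N1 N2)).
  exists (fun a => a < - INR n) (fun b => INR n < b).
  - exists (- INR n). intros; assumption.
  - exists (INR n). intros; assumption.
  - intros a b Ha Hb. exists (CInt F a b). split.
    + apply is_RInt_CInt. apply (dominated_cint F K); assumption.
    + apply He.
      assert (D : Cmod (CInt F a b - l) < e).
      { eapply Rle_lt_trans; [apply (Cmod_triangle_dist _ (CInt F (- INR n) (INR n)) _)|].
        assert (A := dominated_tail F K a b n H ltac:(unfold n; lia) ltac:(lra) ltac:(lra)).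
        specialize (HN1 n ltac:(unfold n; lia)). specialize (HN2 n ltac:(unfold n; lia)).
        rewrite Rminus_0_r in HN2. assert (B := Rle_abs (2 * K * / INR n)). lra. }
      split.
      * change (Rabs (Re (CInt F a b) - Re l) < e). rewrite <- re_minus.
        eapply Rle_lt_trans; [apply re_le_Cmod|exact D].
      * change (Rabs (Im (CInt F a b) - Im l) < e). rewrite <- im_minus.
        eapply Rle_lt_trans; [apply im_le_Cmod|exact D].
Qed.

Lemma pvint_plus F G l m : (forall t, rcont F t) -> (forall t, rcont G t) ->
  pvint F l -> pvint G m -> pvint (fun t => F t + G t)%C (l + m)%C.
Proof.
  intros HF HG H1 H2. unfold pvint.
  apply (Ccv_ext (fun n => CInt F (- INR n) (INR n) + CInt G (- INR n) (INR n))%C).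
  - intros n. symmetry. apply CInt_plus; apply cint_rcont_all; assumption.
  - apply Ccv_plus; assumption.
Qed.

Lemma pvint_scal c F l : (forall t, rcont F t) -> pvint F l -> pvint (fun t => c * F t)%C (c * l)%C.
Proof.
  intros HF H. unfold pvint. apply (Ccv_ext (fun n => c * CInt F (- INR n) (INR n))%C).
  - intros n. symmetry. apply CInt_scal, cint_rcont_all; assumption.
  - apply Ccv_scal; assumption.
Qed.

Lemma pvint_ext F G l : (forall t, F t = G t) -> pvint F l -> pvint G l.
Proof.
  intros E. apply Ccv_ext. intros n. apply CInt_ext. intros; apply E.
Qed.

Lemma pvint_zero : pvint (fun _ => RtoC 0) 0.
Proof.
  apply (Ccv_ext (fun _ => RtoC 0)); [|apply Ccv_const]. intros n. rewrite CInt_const. ring.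
Qed.

Lemma rcont_Csum (f : nat -> R -> C) n t : (forall k, rcont (f k) t) -> rcont (fun t => Csum (fun k => f k t) n) t.
Proof.
  intros H. induction n; simpl; [apply rcont_const|]. apply rcont_plus; auto.
Qed.

Lemma pvint_Csum (f : nat -> R -> C) (v : nat -> C) n : (forall k t, rcont (f k) t) ->
  (forall k, pvint (f k) (v k)) -> pvint (fun t => Csum (fun k => f k t) n) (Csum v n).
Proof.
  intros H1 H2. induction n; simpl; [apply pvint_zero|].
  apply pvint_plus; auto. intros t. apply rcont_Csum. auto.
Qed.

(** Since the majorant separates as [a k] times a function of [t], the remainder after [n] terms is
    itself dominated, with constant [rtail a n * K], and its integral is at most [PI] times that
    constant. *)
Lemma pvint_series (f : nat -> R -> C) (F : R -> C) (a : nat -> R) (K : R) (v : nat -> C) (l : C) :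
  (forall k t, rcont (f k) t) -> (forall t, rcont F t) ->
  (forall k t, Cmod (f k t) <= a k * (K * / (1 + t ^ 2))) -> (forall k, 0 <= a k) -> ex_series a -> 0 <= K ->
  (forall t, Ccv (Csum (fun k => f k t)) (F t)) ->
  (forall k, pvint (f k) (v k)) -> pvint F l -> Ccv (Csum v) l.
Proof.
  intros Cf CF Hf Pa Ha HK HF Hv Hl.
  apply (Ccv_le _ _ (fun n => rtail a n * K * PI) 0).
  - intros n _. rewrite Cmod_minus_sym.
    apply (dominated_pvint_le (fun t => F t + (- (1)) * Csum (fun k => f k t) n)%C).
    + split.
      * intros t. apply rcont_plus; [apply CF|].
        apply (rcont_mult (fun _ => (- (1))%C)); [apply rcont_const|apply rcont_Csum; auto].
      * intros t. set (g := K * / (1 + t ^ 2)).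
        assert (Pg : 0 <= g).
        { apply Rmult_le_pos; [assumption|]. apply Rlt_le, Rinv_0_lt_compat. generalize (pow2_ge_0 t); lra. }
        replace (F t + - (1) * Csum (fun k => f k t) n)%C with (F t - Csum (fun k => f k t) n)%C by ring.
        assert (E : ex_series (fun k => a k * g)) by (apply (ex_series_scal_r g a Ha)).
        assert (T := Csum_tail (fun k => f k t) (fun k => a k * g) (F t) n (fun k => Hf k t) E (HF t)).
        eapply Rle_trans; [apply T|]. right. unfold rtail.
        rewrite Series_scal_r.
        assert (S : rsum (fun k => a k * g) n = rsum a n * g).
        { clear. induction n; simpl; [ring|]. rewrite IHn. ring. }
        rewrite S. unfold g. ring.
    + replace (l - Csum v n)%C with (l + (- (1)) * Csum v n)%C by ring.
      apply pvint_plus; [assumption| |assumption|].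
      * intros t. apply (rcont_mult (fun _ => (- (1))%C)); [apply rcont_const|apply rcont_Csum; auto].
      * apply pvint_scal; [intros t; apply rcont_Csum; auto|]. apply pvint_Csum; assumption.
  - apply (is_lim_seq_ext (fun n => (K * PI) * rtail a n)); [intros; ring|].
    replace (Finite 0) with (Rbar_mult (K * PI) 0) by (simpl; f_equal; ring).
    apply is_lim_seq_scal_l, rtail_lim, Ha.
Qed.

(** * Shifting vertical lines of integration *)

Definition vline (x t : R) : C := (RtoC x + Ci * RtoC t)%C.

Lemma Re_vline x t : Re (vline x t) = x.
Proof. unfold vline, Re; simpl; ring. Qed.

Lemma Im_vline x t : Im (vline x t) = t.
Proof. unfold vline, Im; simpl; ring. Qed.

Lemma vline_pair x t : vline x t = (x, t).
Proof. apply Ceq_parts; [apply Re_vline|apply Im_vline]. Qed.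

Lemma rcont_vline x t : rcont (vline x) t.
Proof. apply (rcont2_r _ _ _ (rcont2_line x t)). Qed.

Lemma cder_vline_re t x : cder (fun u => vline u t) x 1%C.
Proof. unfold vline. split; simpl; auto_derive; trivial; ring. Qed.

Lemma cder_vline_im x t : cder (vline x) t Ci.
Proof. unfold vline. split; simpl; auto_derive; trivial; ring. Qed.

Lemma rcont_holo_vline H x t : holo_at H (vline x t) -> rcont (fun t => H (vline x t)) t.
Proof. intros A. apply (rcont_comp H); [apply Ccont_holo, A|apply rcont_vline]. Qed.

(** The integral over the segment of abscissa [x] is differentiated in [x]. As the derivative of
    [t |-> H (vline x t)] is [Ci] times that of [H], the result is, up to the factor [Ci], the
    difference of [H] at the two ends, so it is at most [2 M]. *)
Lemma rectangle_shift (H : C -> C) (a b d T M : R) : a <= b -> 0 < d ->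
  (forall s, a - d < Re s < b + d -> holo_at H s) ->
  (forall x, a <= x <= b -> Cmod (H (vline x T)) <= M /\ Cmod (H (vline x (- T))) <= M) ->
  Cmod (CInt (fun t => H (vline b t)) (- T) T - CInt (fun t => H (vline a t)) (- T) T) <= 2 * M * (b - a).
Proof.
  intros Hab Hd HH HM.
  assert (Hol : forall x t, a - d < x < b + d -> holo_at H (vline x t)).
  { intros x t Hx. apply HH. rewrite Re_vline. assumption. }
  apply (mean_value_le (fun x => CInt (fun t => H (vline x t)) (- T) T)
    (fun x => CInt (fun t => C_derive H (vline x t)) (- T) T)); [assumption| |].
  - intros x Hx.
    apply (cder_CInt_param (fun x t => H (vline x t)) (fun x t => C_derive H (vline x t)) x d); [assumption| | |].
    + intros u t Hu. apply Rabs_def2 in Hu.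
      rewrite <- (Cmult_1_r (C_derive H (vline u t))).
      apply (cder_holo H (fun u => vline u t)); [apply Hol; lra|apply cder_vline_re].
    + intros t. apply (rcont2_comp (C_derive H)); [apply Ccont_C_derive, Hol; lra|apply rcont2_line].
    + intros u Hu. apply Rabs_def2 in Hu. apply cint_rcont_all. intros t.
      apply rcont_holo_vline, Hol. lra.
  - intros x Hx.
    assert (E : (CInt (fun t => C_derive H (vline x t)) (- T) T * Ci = H (vline x T) - H (vline x (- T)))%C).
    { assert (Cc : forall t, rcont (fun t => C_derive H (vline x t)) t).
      { intros t. apply (rcont_comp (C_derive H)); [apply Ccont_C_derive, Hol; lra|apply rcont_vline]. }
      rewrite Cmult_comm, <- CInt_scal by (apply cint_rcont_all; assumption).
      apply (CInt_cder (fun t => H (vline x t))).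
      - intros t _. rewrite Cmult_comm. apply cder_holo; [apply Hol; lra|apply cder_vline_im].
      - intros t _. apply (rcont_mult (fun _ => Ci)); [apply rcont_const|apply Cc]. }
    rewrite <- (Rmult_1_r (Cmod _)). rewrite <- Cmod_Ci, <- Cmod_mult, E.
    eapply Rle_trans; [apply Cmod_triangle_minus|]. destruct (HM x Hx). lra.
Qed.

(** The primitive is [log (c + i t) / i] written with [atan (t / c)], which serves for both signs of
    [c]; the logarithmic part is even in [t] and cancels. The sign of [c] survives in the value, and
    it produces the residue when a line crosses the pole. *)
Lemma CInt_inv_vline (c T : R) : c <> 0 ->
  CInt (fun t => / vline c t)%C (- T) T = RtoC (2 * atan (T / c)).
Proof.
  intros Hc.
  assert (Pq : forall t, 0 < c ^ 2 + t ^ 2).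
  { intros t. assert (0 < c ^ 2) by (apply pow2_gt_0; assumption). generalize (pow2_ge_0 t); lra. }
  assert (N : forall t, vline c t <> RtoC 0).
  { intros t Q. apply (f_equal Re) in Q. rewrite Re_vline in Q. simpl in Q. contradiction. }
  rewrite (CInt_cder (fun t => (atan (t / c), - / 2 * ln (c ^ 2 + t ^ 2)))).
  - apply Ceq_parts; simpl.
    + replace (- T / c) with (- (T / c)) by (field; assumption). rewrite atan_opp. ring.
    + replace (- T * (- T * 1)) with (T * (T * 1)) by ring. ring.
  - intros t _. assert (A := Pq t). simpl in A. rewrite vline_pair. split; simpl.
    + auto_derive; [trivial|]. unfold Rsqr. field. split; [|assumption]. nra.
    + auto_derive; [nra|]. field. nra.
  - intros t _. apply (rcont_comp Cinv); [apply Ccont_Cinv, N|apply rcont_vline].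
Qed.

(** [N(s) / (s - p)] splits into the difference quotient of [N] at [p] plus [N(p) / (s - p)]. The
    quotient is at most [2 B / n] at height [n], so [rectangle_shift] makes its contribution vanish.
    The rest is explicit: [2 atan (n / (b - p)) + 2 atan (n / (p - a))] tends to [2 PI]. The
    integrals are in [dt], hence [2 PI] and not [2 PI i]. *)
Lemma residue_shift (N : C -> C) (a b d p B : R) : a < p < b -> 0 < d ->
  (forall s, a - d < Re s < b + d -> holo_at N s) ->
  (forall x t, a <= x <= b -> Cmod (N (vline x t)) <= B) ->
  Ccv (fun n => CInt (fun t => N (vline b t) / (vline b t - RtoC p)) (- INR n) (INR n)
              - CInt (fun t => N (vline a t) / (vline a t - RtoC p)) (- INR n) (INR n))%C
      (RtoC (2 * PI) * N (RtoC p))%C.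
Proof.
  intros Hp Hd HN HB.
  assert (Hol : forall x t, a - d < x < b + d -> holo_at N (vline x t)).
  { intros x t Hx. apply HN. rewrite Re_vline. assumption. }
  set (g := diff_quotient N (RtoC p)).
  assert (Hg : forall s, a - d < Re s < b + d -> holo_at g s).
  { intros s Hs. apply (holo_diff_quotient N (RtoC p) s (Rmin (p - a) (b - p))).
    - apply Rmin_pos; lra.
    - intros u Hu. apply HN.
      assert (A1 := Rmin_l (p - a) (b - p)). assert (A2 := Rmin_r (p - a) (b - p)).
      assert (A3 := re_le_Cmod (u - RtoC p)). rewrite re_minus, re_RtoC in A3.
      assert (A4 : Rabs (Re u - p) < Rmin (p - a) (b - p)) by lra. apply Rabs_def2 in A4. lra.
    - apply HN; assumption. }
  assert (Nz : forall x t, x <> p -> (vline x t - RtoC p)%C <> RtoC 0).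
  { intros x t Hx Q. apply (f_equal Re) in Q. rewrite re_minus, Re_vline, re_RtoC in Q. simpl in Q. lra. }
  assert (Eg : forall x t, vline x t <> RtoC p ->
    g (vline x t) = ((N (vline x t) - N (RtoC p)) / (vline x t - RtoC p))%C).
  { intros x t Hx. unfold g, diff_quotient. destruct (Ceq_dec (vline x t) p); [contradiction|reflexivity]. }
  assert (Sp : forall x t, vline x t <> RtoC p -> (vline x t - RtoC p)%C <> RtoC 0).
  { intros. apply Cminus_eq_contra; assumption. }
  assert (B0 : 0 <= B).
  { eapply Rle_trans; [apply Cmod_ge_0|apply (HB a 0); lra]. }
  assert (HBp : Cmod (N (RtoC p)) <= B).
  { assert (A := HB p 0 ltac:(lra)). replace (vline p 0) with (RtoC p) in A; [assumption|].
    unfold vline. ring. }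
  assert (D : forall x n, x <> p -> a <= x <= b ->
    CInt (fun t => N (vline x t) / (vline x t - RtoC p))%C (- INR n) (INR n) =
    (CInt (fun t => g (vline x t)) (- INR n) (INR n) + N (RtoC p) * RtoC (2 * atan (INR n / (x - p))))%C).
  { intros x n Hx Hxab. rewrite <- (CInt_inv_vline (x - p)) by lra.
    assert (Ci1 : cint (fun t => / vline (x - p) t)%C (- INR n) (INR n)).
    { apply cint_rcont_all. intros t. apply (rcont_comp Cinv); [|apply rcont_vline].
      apply Ccont_Cinv. intros Q. apply (f_equal Re) in Q. rewrite Re_vline in Q. simpl in Q. lra. }
    rewrite <- CInt_scal by assumption. rewrite <- CInt_plus.
    - apply CInt_ext. intros t _.
      assert (Nx := Nz x t Hx).
      rewrite Eg.
      2:{ intros Q. apply Nx. rewrite Q. ring. }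
      replace (vline (x - p) t) with (vline x t - RtoC p)%C by (unfold vline; rewrite RtoC_minus; ring).
      field. assumption.
    - apply cint_rcont_all. intros t. apply rcont_holo_vline, Hg. rewrite Re_vline. lra.
    - apply cint_scal; assumption. }
  apply (Ccv_ext (fun n => (CInt (fun t => g (vline b t)) (- INR n) (INR n)
     - CInt (fun t => g (vline a t)) (- INR n) (INR n))
     + RtoC (2 * atan (INR n / (b - p)) - 2 * atan (INR n / (a - p))) * N (RtoC p)))%C.
  { intros n. rewrite !D by lra. rewrite RtoC_minus. ring. }
  rewrite <- (Cplus_0_l (RtoC (2 * PI) * _)).
  apply Ccv_plus.
  - apply (Ccv_le _ _ (fun n => (2 * (2 * B) * (b - a)) * / INR n) 1); [|apply is_lim_seq_inv_INR].
    intros n Hn. assert (Pn : 0 < INR n) by (apply lt_0_INR; lia).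
    match goal with |- Cmod (?A - RtoC 0) <= _ => replace (A - RtoC 0)%C with A by ring end.
    replace (2 * (2 * B) * (b - a) * / INR n) with (2 * (2 * B * / INR n) * (b - a)) by ring.
    apply (rectangle_shift g a b d); [lra|assumption|assumption|].
    assert (W : forall x t, a <= x <= b -> Rabs t = INR n -> Cmod (g (vline x t)) <= 2 * B * / INR n).
    { intros x t Hx Ht.
      assert (Nx : vline x t <> RtoC p).
      { intros Q. apply (f_equal Im) in Q. rewrite Im_vline in Q. simpl in Q. rewrite Q, Rabs_R0 in Ht. lra. }
      assert (Nx2 := Sp x t Nx).
      rewrite Eg by assumption. rewrite Cmod_div by assumption.
      assert (Dn : INR n <= Cmod (vline x t - RtoC p)).
      { rewrite <- Ht. eapply Rle_trans; [|apply im_le_Cmod]. rewrite im_minus, Im_vline. simpl.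
        rewrite Rminus_0_r. lra. }
      unfold Rdiv. apply Rmult_le_compat.
      - apply Cmod_ge_0.
      - apply Rlt_le, Rinv_0_lt_compat, Cmod_gt_0. assumption.
      - eapply Rle_trans; [apply Cmod_triangle_minus|]. assert (A := HB x t Hx). lra.
      - apply Rinv_le_contravar; assumption. }
    intros x Hx. split; apply W; try assumption; [|rewrite Rabs_Ropp]; apply Rabs_pos_eq; lra.
  - apply Ccv_mult; [|apply Ccv_const].
    apply (Ccv_le _ _ (fun n => (2 * (b - a)) * / INR n) 1); [|apply is_lim_seq_inv_INR].
    intros n Hn. assert (Pn : 0 < INR n) by (apply lt_0_INR; lia).
    rewrite <- RtoC_minus, Cmod_R.
    replace (INR n / (a - p)) with (- (INR n / (p - a))) by (field; lra). rewrite atan_opp.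
    assert (A1 := atan_PI2 (INR n / (b - p)) ltac:(apply Rdiv_lt_0_compat; lra)).
    assert (A2 := atan_PI2 (INR n / (p - a)) ltac:(apply Rdiv_lt_0_compat; lra)).
    replace (/ (INR n / (b - p))) with ((b - p) * / INR n) in A1 by (field; split; lra).
    replace (/ (INR n / (p - a))) with ((p - a) * / INR n) in A2 by (field; split; lra).
    assert (0 < / INR n) by (apply Rinv_0_lt_compat; assumption).
    rewrite Rabs_left1 by lra. nra.
Qed.

(** * Convergence of p-series *)

Lemma is_derive_exp_ln (c u : R) : 0 < u ->
  is_derive (fun v => exp (c * ln v)) u (c * exp ((c - 1) * ln u)).
Proof.
  intros Hu. auto_derive; [assumption|].
  replace ((c - 1) * ln u) with (c * ln u + - ln u) by ring.
  rewrite exp_plus, exp_Ropp, exp_ln by assumption. ring.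
Qed.

Lemma ln_le_compat a b : 0 < a -> a <= b -> ln a <= ln b.
Proof. intros Ha [H|H]; [left; apply ln_increasing; assumption|subst; lra]. Qed.

Lemma ex_series_bounded (a : nat -> R) (M : R) :
  (forall n, 0 <= a n) -> (forall n, rsum a n <= M) -> ex_series a.
Proof.
  intros Ha HM. destruct (ex_finite_lim_seq_incr (rsum a) M) as [l Hl].
  - intros n. simpl. specialize (Ha n). lra.
  - assumption.
  - exists l. apply is_series_rsum. exact Hl.
Qed.

(** By the mean value theorem [(u + 1)^(-c)] is at most [(u^(1-c) - (u+1)^(1-c)) / (c - 1)], so the
    partial sums are bounded by a telescoping sum. *)
Lemma ex_series_power (c al : R) : 1 < c -> 0 < al -> ex_series (fun n => exp (- c * ln (INR n + al))).
Proof.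
  intros Hc Hal.
  assert (Step : forall u, 0 < u ->
    exp (- c * ln (u + 1)) <= / (c - 1) * (exp ((1 - c) * ln u) - exp ((1 - c) * ln (u + 1)))).
  { intros u Hu.
    destruct (MVT_cor2 (fun v => exp ((1 - c) * ln v)) (fun v => (1 - c) * exp ((1 - c - 1) * ln v)) u (u + 1))
      as [x [Hx1 Hx2]]; [lra| |].
    { intros x Hx. apply is_derive_Reals, is_derive_exp_ln. lra. }
    replace (u + 1 - u) with 1 in Hx1 by ring.
    replace (exp ((1 - c) * ln u) - exp ((1 - c) * ln (u + 1))) with ((c - 1) * exp ((1 - c - 1) * ln x)) by lra.
    rewrite <- Rmult_assoc, Rinv_l, Rmult_1_l by lra.
    replace (1 - c - 1) with (- c) by ring. apply exp_le_compat.
    assert (ln x <= ln (u + 1)) by (apply ln_le_compat; lra). nra. }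
  apply ex_series_bounded with (exp (- c * ln al) + / (c - 1) * exp ((1 - c) * ln al)).
  { intros n. left; apply exp_pos. }
  assert (B : forall n, rsum (fun n => exp (- c * ln (INR n + al))) (S n) <=
    exp (- c * ln al) + / (c - 1) * (exp ((1 - c) * ln al) - exp ((1 - c) * ln (INR n + al)))).
  { induction n.
    - simpl. rewrite !Rplus_0_l. lra.
    - cbn [rsum] in *. rewrite S_INR.
      assert (St := Step (INR n + al) ltac:(generalize (pos_INR n); lra)).
      replace (INR n + al + 1) with (INR n + 1 + al) in St by ring. lra. }
  intros n. destruct n.
  - simpl. assert (0 < / (c - 1)) by (apply Rinv_0_lt_compat; lra).
    generalize (exp_pos (- c * ln al)) (exp_pos ((1 - c) * ln al)). nra.
  - eapply Rle_trans; [apply B|]. assert (0 < / (c - 1)) by (apply Rinv_0_lt_compat; lra).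
    generalize (exp_pos ((1 - c) * ln (INR n + al))). nra.
Qed.

Lemma ex_series_inv_sq : ex_series (fun n => / (INR n + 1) ^ 2).
Proof.
  apply (ex_series_ext (fun n => exp (- (2) * ln (INR n + 1)))); [|apply (ex_series_power 2 1); lra].
  intros n. assert (P := pos_INR n).
  replace (- (2) * ln (INR n + 1)) with (- (ln (INR n + 1) + ln (INR n + 1))) by ring.
  rewrite exp_Ropp, exp_plus, exp_ln by lra. f_equal. ring.
Qed.

(** * Euler's limit for the Gamma function *)

Definition Gn (n : nat) (s : C) : C :=
  (RtoC (INR (fact n)) * Cpower (RtoC (INR n)) s / Cprod (fun j => s + RtoC (INR j)) (S n))%C.

Lemma Cprod_neq_0 a n : (forall j, (j < n)%nat -> a j <> RtoC 0) -> Cprod a n <> RtoC 0.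
Proof.
  induction n; intros H; simpl; [apply C1_nz|].
  apply Cmult_neq_0; [apply IHn; intros; apply H; lia|apply H; lia].
Qed.

Lemma holo_Cprod (a : nat -> C -> C) n s : (forall j, holo_at (a j) s) ->
  holo_at (fun s => Cprod (fun j => a j s) n) s.
Proof. intros H. induction n; simpl; [apply holo_const|apply holo_mult; auto]. Qed.

(** From [|r n| <= 1 + a n <= exp (a n)] the products are bounded, and then the increments
    [v n * (r n - 1)] are summable. The explicit bound matters as much as the limit: it gives
    uniformity in strips. *)
Lemma product_cv (v r : nat -> C) (a : nat -> R) :
  (forall n, v (S n) = (v n * r n)%C) -> (forall n, Cmod (r n - 1) <= a n) -> ex_series a ->
  (forall n, Cmod (v n) <= Cmod (v O) * exp (Series a)) /\ exists l, Ccv v l.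
Proof.
  intros Hv Hr Ha.
  assert (Pa : forall k, 0 <= a k) by (intros k; eapply Rle_trans; [apply Cmod_ge_0|apply Hr]).
  assert (B : forall n, Cmod (v n) <= Cmod (v O) * exp (Series a)).
  { intros n. apply Rle_trans with (Cmod (v O) * exp (rsum a n)).
    - induction n; [simpl; rewrite exp_0; lra|].
      rewrite Hv, Cmod_mult. simpl. rewrite exp_plus, <- Rmult_assoc.
      apply Rmult_le_compat; try apply Cmod_ge_0; [assumption|].
      replace (r n) with ((r n - 1) + 1)%C by ring.
      eapply Rle_trans; [apply Cmod_triangle|]. rewrite Cmod_1. specialize (Hr n).
      assert (A := exp_ineq1_le (a n)). lra.
    - apply Rmult_le_compat_l; [apply Cmod_ge_0|]. apply exp_le_compat, rsum_le_Series; assumption. }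
  split; [exact B|].
  destruct (Csum_cv (fun n => v (S n) - v n)%C (fun n => (Cmod (v O) * exp (Series a)) * a n)) as [l Hl].
  - intros n. rewrite Hv. replace (v n * r n - v n)%C with (v n * (r n - 1))%C by ring.
    rewrite Cmod_mult. apply Rmult_le_compat; try apply Cmod_ge_0; auto.
  - exact (ex_series_scal_l (Cmod (v O) * exp (Series a)) a Ha).
  - exists (l + v O)%C. apply (Ccv_ext (fun n => Csum (fun n => v (S n) - v n)%C n + v O)%C).
    + intros n. induction n; simpl; [ring|]. rewrite <- IHn. ring.
    + apply Ccv_plus; [assumption|apply Ccv_const].
Qed.

(** The quotient of consecutive terms of Euler's sequence, [(1 + 1/n)^s / (1 + s/(n+1))]; see
    [Gn_succ]. *)
Definition Gn_ratio (n : nat) (s : C) : C :=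
  (Cexp (s * RtoC (ln (1 + / INR n))) / (1 + s * RtoC (/ (INR n + 1))))%C.

Lemma ln_1_plus_bounds x : 0 < x -> x / (1 + x) <= ln (1 + x) <= x.
Proof.
  intros Hx. split.
  - assert (A := exp_ineq1_le (- ln (1 + x))). rewrite exp_Ropp, exp_ln in A by lra.
    replace (x / (1 + x)) with (1 - / (1 + x)) by (field; lra). lra.
  - assert (A := exp_ineq1_le x). apply ln_le_compat in A; [|lra]. rewrite ln_exp in A. lra.
Qed.

(** Numerator and denominator agree to first order in [1 / n], so the error is [O(1 / n^2)] and
    summable. The condition [2 R0 <= n] keeps the denominator at least [1 / 2]. *)
Lemma Gn_ratio_near_1 (R0 : R) : 0 < R0 -> exists K, 0 <= K /\ forall n s, (0 < n)%nat -> 2 * R0 <= INR n ->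
  Cmod s <= R0 -> Cmod (Gn_ratio n s - 1) <= K * / INR n ^ 2.
Proof.
  intros HR. exists (2 * (R0 ^ 2 * exp R0 + R0)). split.
  { generalize (exp_pos R0) (pow2_ge_0 R0). nra. }
  intros n s Hn Hn2 Hs. assert (Pn : 1 <= INR n) by (apply (le_INR 1); lia).
  assert (Pi : 0 < / INR n <= 1).
  { split; [apply Rinv_0_lt_compat; lra|]. rewrite <- Rinv_1. apply Rinv_le_contravar; lra. }
  set (la := ln (1 + / INR n)).
  assert (L : / (INR n + 1) <= la <= / INR n).
  { unfold la. assert (A := ln_1_plus_bounds (/ INR n) ltac:(lra)).
    replace (/ INR n / (1 + / INR n)) with (/ (INR n + 1)) in A by (field; lra). exact A. }
  assert (Pi1 : 0 < / (INR n + 1)) by (apply Rinv_0_lt_compat; lra).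
  assert (S0 := Cmod_ge_0 s).
  assert (T : Cmod (s * RtoC (/ (INR n + 1))) <= 1 / 2).
  { rewrite Cmod_mult, Cmod_R, Rabs_pos_eq by lra.
    apply Rle_trans with (R0 * / (INR n + 1)); [apply Rmult_le_compat_r; lra|].
    apply Rmult_le_reg_r with (INR n + 1); [lra|]. rewrite Rmult_assoc, Rinv_l by lra. lra. }
  assert (D : 1 / 2 <= Cmod (1 + s * RtoC (/ (INR n + 1)))).
  { eapply Rle_trans; [|apply Cmod_sum_lower]. rewrite Cmod_1. lra. }
  assert (N : (1 + s * RtoC (/ (INR n + 1)))%C <> RtoC 0) by (apply Cmod_gt_0; lra).
  unfold Gn_ratio. fold la.
  replace (Cexp (s * la) / (1 + s * (/ (INR n + 1))%R) - 1)%C with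
    (((Cexp (s * la) - 1 - s * la) + s * (la - RtoC (/ (INR n + 1)))) / (1 + s * RtoC (/ (INR n + 1))))%C
    by (field; exact N).
  rewrite Cmod_div by exact N.
  assert (M1 : Cmod (s * la) <= R0 * / INR n).
  { rewrite Cmod_mult, Cmod_R, Rabs_pos_eq by lra. apply Rmult_le_compat; lra. }
  assert (M2 : Cmod (Cexp (s * la) - 1 - s * la) <= (R0 * / INR n) ^ 2 * exp R0).
  { eapply Rle_trans; [apply Cexp_taylor_2|].
    apply Rmult_le_compat; [apply pow_le, Cmod_ge_0|left; apply exp_pos| |].
    - apply pow_incr. split; [apply Cmod_ge_0|assumption].
    - apply exp_le_compat. eapply Rle_trans; [apply M1|]. nra. }
  assert (M3 : Cmod (s * (la - RtoC (/ (INR n + 1)))) <= R0 * / INR n ^ 2).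
  { rewrite Cmod_mult, <- RtoC_minus, Cmod_R, Rabs_pos_eq by lra.
    apply Rmult_le_compat; try lra.
    apply Rle_trans with (/ INR n - / (INR n + 1)); [lra|].
    replace (/ INR n - / (INR n + 1)) with (/ INR n * / (INR n + 1)) by (field; lra).
    replace (/ INR n ^ 2) with (/ INR n * / INR n) by (field; lra).
    apply Rmult_le_compat_l; [lra|]. apply Rinv_le_contravar; lra. }
  assert (M4 : / Cmod (1 + s * RtoC (/ (INR n + 1))) <= 2).
  { replace 2 with (/ (1 / 2)) by field. apply Rinv_le_contravar; lra. }
  apply Rle_trans with (((R0 * / INR n) ^ 2 * exp R0 + R0 * / INR n ^ 2) * 2).
  - apply Rmult_le_compat; [apply Cmod_ge_0|left; apply Rinv_0_lt_compat; lra| |assumption].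
    eapply Rle_trans; [apply Cmod_triangle|]. lra.
  - right. field. lra.
Qed.

Lemma plus_INR_neq_0 s j : 0 < Re s -> (s + RtoC (INR j))%C <> RtoC 0.
Proof.
  intros H Q. apply (f_equal Re) in Q. rewrite re_plus, re_RtoC in Q. simpl in Q.
  generalize (pos_INR j). lra.
Qed.

Lemma Gn_denominator_neq_0 s n : 0 < Re s -> Cprod (fun j => s + RtoC (INR j))%C n <> RtoC 0.
Proof. intros H. apply Cprod_neq_0. intros. apply plus_INR_neq_0; assumption. Qed.

Lemma Gn_succ n s : (0 < n)%nat -> 0 < Re s -> Gn (S n) s = (Gn n s * Gn_ratio n s)%C.
Proof.
  intros Hn Hs. assert (Pn : 1 <= INR n) by (apply (le_INR 1); lia).
  unfold Gn. rewrite !Cpower_R_pos by (rewrite ?S_INR; lra).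
  change (Cprod (fun j => s + RtoC (INR j))%C (S (S n))) with
    (Cprod (fun j => s + RtoC (INR j)) (S n) * (s + RtoC (INR (S n))))%C.
  assert (N1 := Gn_denominator_neq_0 s (S n) Hs). assert (N2 := plus_INR_neq_0 s (S n) Hs).
  set (P := Cprod (fun j => s + RtoC (INR j))%C (S n)) in *.
  replace (ln (INR (S n))) with (ln (INR n) + ln (1 + / INR n)).
  2:{ rewrite <- ln_mult; [f_equal; rewrite S_INR; field; lra|lra|].
      assert (0 < / INR n) by (apply Rinv_0_lt_compat; lra). lra. }
  rewrite RtoC_plus, Cmult_plus_distr_l, Cexp_plus.
  rewrite fact_simpl, mult_INR, RtoC_mult. unfold Gn_ratio.
  rewrite S_INR in *. rewrite RtoC_inv by lra.
  assert (N3 : RtoC (INR n + 1) <> RtoC 0) by (intros Q; apply RtoC_inj in Q; lra).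
  rewrite RtoC_plus in *. field. repeat split; try assumption.
  intros Q. apply N2. rewrite <- Q. ring.
Qed.

Lemma Gn_cv s : 0 < Re s -> Ccv (fun n => Gn n s) (CGamma s).
Proof.
  intros Hs.
  assert (E : exists l, Ccv (fun n => Gn n s) l).
  { assert (PR : 0 < Cmod s + 1) by (generalize (Cmod_ge_0 s); lra).
    destruct (Gn_ratio_near_1 _ PR) as [K [HK H]].
    (* The product is started at [S N], beyond which the ratio estimate is valid; earlier terms do
       not affect the limit. *)
    destruct (INR_large (2 * (Cmod s + 1))) as [N HN].
    destruct (product_cv (fun n => Gn (S N + n) s) (fun n => Gn_ratio (S N + n) s)
      (fun n => K * / (INR n + 1) ^ 2)) as [_ [l Hl]].
    - intros n. rewrite Nat.add_succ_r. apply Gn_succ; [lia|assumption].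
    - intros n. eapply Rle_trans; [apply H; [lia| |lra]|].
      + apply Rlt_le, HN. lia.
      + apply Rmult_le_compat_l; [assumption|]. assert (P := pos_INR n).
        apply Rinv_le_contravar; [apply pow_lt; lra|]. apply pow_incr. split; [lra|].
        rewrite plus_INR, S_INR. generalize (pos_INR N). lra.
    - exact (ex_series_scal_l K _ ex_series_inv_sq).
    - exists l. intros e He. destruct (Hl e He) as [M HM]. exists (S N + M)%nat. intros n Hn.
      specialize (HM (n - S N)%nat ltac:(lia)). replace (S N + (n - S N))%nat with n in HM by lia. exact HM. }
  destruct E as [l Hl]. unfold CGamma. fold (Gn) . 
  change (Ccv (fun n => Gn n s) (Clim_seq (fun n => Gn n s))).
  rewrite (Ccv_Clim_seq _ _ Hl). exact Hl.
Qed.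

Lemma Gn_Cmod n s : (0 < n)%nat -> 0 < Re s ->
  Cmod (Gn n s) = INR (fact n) * exp (Re s * ln (INR n)) / Cmod (Cprod (fun j => s + RtoC (INR j))%C (S n)).
Proof.
  intros Hn Hs. unfold Gn. rewrite Cmod_div by (apply Gn_denominator_neq_0; assumption).
  rewrite Cmod_mult, Cmod_R, (Rabs_pos_eq (INR _)) by apply pos_INR.
  rewrite Cpower_R_pos by (apply lt_0_INR; assumption).
  rewrite Cmod_Cexp, re_scal_r. reflexivity.
Qed.

Lemma Cprod_ge (s : C) (m : nat) (x0 : R) : 0 < x0 <= Re s ->
  0 < Cmod (Cprod (fun j => RtoC x0 + RtoC (INR j))%C m) <= Cmod (Cprod (fun j => s + RtoC (INR j))%C m).
Proof.
  intros Hx. induction m; [simpl; rewrite Cmod_1; lra|].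
  simpl. rewrite !Cmod_mult. assert (P := pos_INR m).
  assert (E : Cmod (RtoC x0 + RtoC (INR m)) = x0 + INR m).
  { rewrite <- RtoC_plus, Cmod_R. apply Rabs_pos_eq. lra. }
  assert (F : x0 + INR m <= Cmod (s + RtoC (INR m))).
  { eapply Rle_trans; [|apply re_le_Cmod]. rewrite re_plus, re_RtoC. eapply Rle_trans; [|apply Rle_abs]. lra. }
  rewrite E. split; [apply Rmult_lt_0_compat; lra|]. apply Rmult_le_compat; lra.
Qed.

(** An imaginary part only enlarges the denominator of [Gn], so the whole strip is bounded by its
    real points. There [product_cv], started at a common index [N], is uniform in [Re s]. *)
Lemma Gn_bounded (x0 x1 : R) : 0 < x0 -> exists N M, (0 < N)%nat /\ 0 <= M /\
  forall n s, (N <= n)%nat -> x0 <= Re s <= x1 ->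
    Cmod (Gn n (RtoC (Re s))) <= M /\ Cmod (Gn n s) <= M.
Proof.
  intros H0.
  assert (PR : 0 < Rabs x1 + 1) by apply Rbound_pos.
  destruct (Gn_ratio_near_1 _ PR) as [K [HK H]].
  destruct (INR_large (2 * (Rabs x1 + 1))) as [N0 HN]. set (N := S N0).
  assert (PN : 1 <= INR N) by (apply (le_INR 1); unfold N; lia).
  assert (Hser : ex_series (fun n => K * / (INR n + 1) ^ 2)) by exact (ex_series_scal_l K _ ex_series_inv_sq).
  set (M0 := INR (fact N) * exp (Rabs x1 * ln (INR N)) / Cmod (Cprod (fun j => RtoC x0 + RtoC (INR j))%C (S N))).
  assert (HM0 : 0 <= M0).
  { destruct (Cprod_ge (RtoC x0) (S N) x0) as [A _]; [simpl; lra|].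
    apply Rmult_le_pos; [apply Rmult_le_pos; [apply pos_INR|left; apply exp_pos]|].
    left; apply Rinv_0_lt_compat; assumption. }
  exists N, (M0 * exp (Series (fun n => K * / (INR n + 1) ^ 2))).
  split; [unfold N; lia|]. split; [apply Rmult_le_pos; [assumption|left; apply exp_pos]|].
  intros n s Hn Hs.
  assert (A : Cmod (Gn n (RtoC (Re s))) <= M0 * exp (Series (fun n => K * / (INR n + 1) ^ 2))).
  { set (x := Re s) in *. assert (Px : 0 < Re (RtoC x)) by (simpl; lra).
    destruct (product_cv (fun n => Gn (N + n) (RtoC x)) (fun n => Gn_ratio (N + n) (RtoC x))
      (fun n => K * / (INR n + 1) ^ 2)) as [B _].
    - intros m. rewrite Nat.add_succ_r. apply Gn_succ; [unfold N; lia|assumption].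
    - intros m. eapply Rle_trans; [apply H; [unfold N; lia| |]|].
      + apply Rlt_le, HN. unfold N. lia.
      + rewrite Cmod_R, Rabs_pos_eq by lra. generalize (Rle_abs x1). lra.
      + apply Rmult_le_compat_l; [assumption|]. assert (P := pos_INR m).
        apply Rinv_le_contravar; [apply pow_lt; lra|]. apply pow_incr. split; [lra|].
        rewrite plus_INR. lra.
    - assumption.
    - specialize (B (n - N)%nat). replace (N + (n - N))%nat with n in B by lia. rewrite Nat.add_0_r in B.
      eapply Rle_trans; [apply B|]. apply Rmult_le_compat_r; [left; apply exp_pos|].
      rewrite Gn_Cmod by (unfold N; lia || assumption). unfold M0, Rdiv.
      destruct (Cprod_ge (RtoC x) (S N) x0) as [A1 A2]; [simpl; lra|].
      apply Rmult_le_compat.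
      + apply Rmult_le_pos; [apply pos_INR|left; apply exp_pos].
      + left; apply Rinv_0_lt_compat. lra.
      + apply Rmult_le_compat_l; [apply pos_INR|]. apply exp_le_compat.
        apply Rmult_le_compat_r; [rewrite <- ln_1; apply ln_le_compat; lra|].
        simpl. generalize (Rle_abs x1). lra.
      + apply Rinv_le_contravar; assumption. }
  split; [exact A|].
  eapply Rle_trans; [|exact A].
  rewrite !Gn_Cmod by (try (unfold N in *; lia); simpl; lra). simpl (Re (RtoC _)).
  destruct (Cprod_ge s (S n) (Re s)) as [A1 A2]; [lra|].
  apply Rmult_le_compat_l; [apply Rmult_le_pos; [apply pos_INR|left; apply exp_pos]|].
  apply Rinv_le_contravar; assumption.
Qed.

Lemma holo_Gn n s : (0 < n)%nat -> 0 < Re s -> holo_at (Gn n) s.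
Proof.
  intros Hn Hs. unfold Gn. apply holo_div.
  - apply Gn_denominator_neq_0; assumption.
  - apply holo_mult; [apply holo_const|].
    apply (holo_at_ext (fun s => Cexp (s * RtoC (ln (INR n))))).
    { intros a. symmetry. apply Cpower_R_pos. apply lt_0_INR; assumption. }
    apply holo_Cexp_comp. apply holo_mult; [apply holo_id|apply holo_const].
  - apply (holo_Cprod (fun j s => s + RtoC (INR j))%C).
    intros j. apply holo_plus; [apply holo_id|apply holo_const].
Qed.

Lemma re_ball a s d : Cmod (a - s) < d -> Re s - d < Re a < Re s + d.
Proof.
  intros H. assert (A := re_le_Cmod (a - s)). rewrite re_minus in A.
  assert (B : Rabs (Re a - Re s) < d) by lra. apply Rabs_def2 in B. lra.
Qed.

Lemma holo_CGamma s : 0 < Re s -> holo_at CGamma s.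
Proof.
  intros Hs.
  destruct (Gn_bounded (Re s / 2) (Re s + Re s)) as (N & M & HN & HM & B); [lra|].
  apply (holo_lim (fun n => Gn (N + n)) CGamma s (Re s / 2) M); [lra| | |].
  - intros n b Hb. apply re_ball in Hb. apply holo_Gn; [lia|lra].
  - intros n b Hb. apply re_ball in Hb. apply B; [lia|lra].
  - intros b Hb. apply re_ball in Hb.
    intros e He. destruct (Gn_cv b ltac:(lra) e He) as [N1 H1]. exists N1. intros n Hn. apply H1. lia.
Qed.

Lemma Cprod_shift s n :
  (s * Cprod (fun j => (s + 1) + RtoC (INR j)) n = Cprod (fun j => s + RtoC (INR j)) n * (s + RtoC (INR n)))%C.
Proof.
  induction n; [simpl; ring|].
  cbn [Cprod]. rewrite Cmult_assoc, IHn, S_INR, RtoC_plus. ring.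
Qed.

(** Before the limit, [Gn n s] is [Gn n (s + 1) / s] times [1 + (s + 1) / n]. As [s + 1] lies in the
    right half plane, this also proves that Euler's limit exists for [-1 < Re s], where the final
    line of integration lies. *)
Lemma CGamma_shift s : - 1 < Re s -> s <> RtoC 0 -> CGamma s = (CGamma (s + 1) / s)%C.
Proof.
  intros Hs Ns. unfold CGamma at 1. change (Clim_seq (fun n => Gn n s) = (CGamma (s + 1) / s)%C).
  apply Ccv_Clim_seq.
  assert (Hs1 : 0 < Re (s + 1)%C) by (rewrite re_plus; simpl; lra).
  apply (Ccv_ext_loc (fun n => Gn n (s + 1) * (/ s * (1 + (s + 1) * RtoC (/ INR n))))%C _ _ 1).
  - intros n Hn. assert (Pn : 1 <= INR n) by (apply (le_INR 1); lia).
    unfold Gn. rewrite !Cpower_R_pos by lra.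
    assert (N1 := Gn_denominator_neq_0 (s + 1) (S n) Hs1).
    assert (E := Cprod_shift s (S n)).
    assert (Nn : (s + RtoC (INR (S n)))%C <> RtoC 0).
    { intros Q. apply (f_equal Re) in Q. rewrite re_plus, re_RtoC, S_INR in Q. simpl in Q. lra. }
    assert (N2 : Cprod (fun j => s + RtoC (INR j))%C (S n) <> RtoC 0).
    { intros Q. rewrite Q, Cmult_0_l in E. revert E. apply Cmult_neq_0; assumption. }
    set (P := Cprod (fun j => s + RtoC (INR j))%C (S n)) in *.
    set (P1 := Cprod (fun j => s + 1 + RtoC (INR j))%C (S n)) in *.
    replace ((s + 1) * RtoC (ln (INR n)))%C with (s * RtoC (ln (INR n)) + RtoC (ln (INR n)))%C by ring.
    rewrite Cexp_plus, Cexp_R, exp_ln by lra.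
    assert (Nr : RtoC (INR n) <> RtoC 0) by (intros Q; apply RtoC_inj in Q; lra).
    replace P with (s * P1 / (s + RtoC (INR (S n))))%C by (rewrite E; field; assumption).
    rewrite S_INR, RtoC_plus in *. rewrite RtoC_inv by lra. field. repeat split; assumption.
  - replace (CGamma (s + 1) / s)%C with (CGamma (s + 1) * (/ s * (1 + (s + 1) * RtoC 0)))%C
      by (field; assumption).
    apply Ccv_mult; [apply Gn_cv; assumption|]. apply Ccv_scal.
    apply Ccv_plus; [apply Ccv_const|]. apply Ccv_scal.
    apply (Ccv_le _ _ (fun n => 1 * / INR n) 1); [|apply is_lim_seq_inv_INR].
    intros n Hn. assert (Pn : 1 <= INR n) by (apply (le_INR 1); lia).
    rewrite <- RtoC_minus, Rminus_0_r, Cmod_R, Rabs_pos_eq; [lra|].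
    left; apply Rinv_0_lt_compat; lra.
Qed.

Lemma CGamma_1 : CGamma 1 = RtoC 1.
Proof.
  unfold CGamma. apply Ccv_Clim_seq. 
  apply (Ccv_le _ _ (fun n => 1 * / INR n) 1); [|apply is_lim_seq_inv_INR].
  intros n Hn. change (Cmod (Gn n 1 - 1) <= 1 * / INR n).
  assert (Pn : 1 <= INR n) by (apply (le_INR 1); lia).
  assert (F : forall m, Cprod (fun j => 1 + RtoC (INR j))%C m = RtoC (INR (fact m))).
  { induction m; [reflexivity|]. cbn [Cprod]. rewrite IHm, fact_simpl, mult_INR, RtoC_mult, S_INR, RtoC_plus. ring. }
  unfold Gn. rewrite Cpower_R_pos, F by lra.
  rewrite Cmult_1_l, Cexp_R, exp_ln, fact_simpl, mult_INR, RtoC_mult, S_INR by lra.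
  assert (N1 : RtoC (INR n + 1) <> RtoC 0) by (intros Q; apply RtoC_inj in Q; lra).
  assert (N2 : RtoC (INR (fact n)) <> RtoC 0).
  { intros Q. apply RtoC_inj in Q. assert (A := INR_fact_lt_0 n). lra. }
  replace (INR (fact n) * INR n / ((INR n + 1)%R * INR (fact n)) - 1)%C with (- RtoC (/ (INR n + 1)))%C.
  - rewrite Cmod_opp, Cmod_R, Rmult_1_l, Rabs_pos_eq.
    + apply Rinv_le_contravar; lra.
    + left; apply Rinv_0_lt_compat; lra.
  - rewrite RtoC_inv by lra. rewrite RtoC_plus in *. field. split; assumption.
Qed.

(** * Exponential decay of Gamma on vertical lines *)

Lemma exp_nat_mult (m : nat) (y : R) : exp (INR m * y) = exp y ^ m.
Proof.
  induction m; [simpl; rewrite Rmult_0_l; apply exp_0|].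
  rewrite S_INR, Rmult_plus_distr_r, Rmult_1_l, exp_plus, IHm. simpl; ring.
Qed.

(* [stirling t u] is an antiderivative of [u |-> ln (1 + t^2/u^2)]; comparing it
   with the sum [ln (1 + t^2/(x+j)^2)] yields the decay [exp (- PI |t| / 2)]. *)
Definition stirling (t u : R) : R := u * ln (1 + t ^ 2 / u ^ 2) + 2 * t * atan (u / t).

Lemma is_derive_stirling t u : 0 < t -> 0 < u ->
  is_derive (stirling t) u (ln (1 + t ^ 2 / u ^ 2)).
Proof.
  intros Ht Hu. unfold stirling. auto_derive.
  - repeat split; try lra; try (apply Rgt_not_eq; nra).
    assert (0 < t * (t * 1) / (u * (u * 1))) by (apply Rdiv_lt_0_compat; nra). lra.
  - unfold Rsqr, Rdiv. simpl. set (L := ln _). field. repeat split; try lra; nra.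
Qed.

(** The derivative of [stirling t] decreases in [u], so its increment over [[u, u + 1]] is at most
    the value at the left end. *)
Lemma stirling_step t u : 0 < t -> 0 < u ->
  stirling t (u + 1) - stirling t u <= ln (1 + t ^ 2 / u ^ 2).
Proof.
  intros Ht Hu.
  destruct (MVT_cor2 (stirling t) (fun u => ln (1 + t ^ 2 / u ^ 2)) u (u + 1)) as [c [Hc1 Hc2]]; [lra| |].
  { intros c Hc. apply is_derive_Reals, is_derive_stirling; lra. }
  rewrite Hc1. replace (u + 1 - u) with 1 by ring. rewrite Rmult_1_r.
  assert (0 < t ^ 2) by (apply pow_lt; assumption). assert (0 < c ^ 2) by (apply pow_lt; lra).
  assert (0 < u ^ 2) by (apply pow_lt; lra).
  apply ln_le_compat.
  - assert (0 < t ^ 2 / c ^ 2) by (apply Rdiv_lt_0_compat; assumption). lra.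
  - apply Rplus_le_compat_l. apply Rmult_le_compat_l; [lra|]. apply Rinv_le_contravar; [assumption|].
    apply pow_incr; lra.
Qed.

Lemma stirling_upper t x : 0 < t -> 0 < x -> stirling t x <= x * ln (1 + t ^ 2 / x ^ 2) + 2 * x.
Proof.
  intros Ht Hx. unfold stirling. apply Rplus_le_compat_l.
  assert (P : 0 < x / t) by (apply Rdiv_lt_0_compat; assumption).
  destruct (atan_le_id (x / t)) as [_ A]; [lra|].
  replace (2 * x) with (2 * t * (x / t)) by (field; lra). apply Rmult_le_compat_l; lra.
Qed.

(** The logarithmic term is nonnegative and [atan (u / t)] is within [t / u] of [PI / 2]. The limit
    [PI t] is the source of the exponent in the decay. *)
Lemma stirling_lower t u : 0 < t -> 0 < u -> PI * t - 2 * t ^ 2 * / u <= stirling t u.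
Proof.
  intros Ht Hu. unfold stirling.
  assert (P : 0 < u / t) by (apply Rdiv_lt_0_compat; assumption).
  destruct (atan_PI2 (u / t) P) as [A _].
  replace (/ (u / t)) with (t * / u) in A by (field; lra).
  assert (0 <= ln (1 + t ^ 2 / u ^ 2)).
  { rewrite <- ln_1. apply ln_le_compat; [lra|].
    assert (0 < t ^ 2 / u ^ 2) by (apply Rdiv_lt_0_compat; apply pow_lt; assumption). lra. }
  nra.
Qed.

(** Each factor satisfies [|x + j + i t| = (x + j) exp (q / 2)] with [q = ln (1 + t^2 / (x + j)^2)],
    and [stirling_step] makes the lower bounds for the [q] telescope. The second part reduces
    negative [t] to positive [t]. *)
Lemma Cprod_decay (x t : R) (m : nat) : 0 < x -> 0 < t ->
  Cmod (Cprod (fun j => RtoC x + RtoC (INR j))%C m) * exp ((stirling t (x + INR m) - stirling t x) / 2)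
  <= Cmod (Cprod (fun j => vline x t + RtoC (INR j))%C m)
  /\ Cmod (Cprod (fun j => vline x (- t) + RtoC (INR j))%C m) = Cmod (Cprod (fun j => vline x t + RtoC (INR j))%C m).
Proof.
  intros Hx Ht. induction m.
  - simpl. rewrite Rplus_0_r, Rminus_diag, !Cmod_1. replace (0 / 2) with 0 by field. rewrite exp_0. lra.
  - destruct IHm as [IH1 IH2]. cbn [Cprod]. rewrite !Cmod_mult, IH2. assert (P := pos_INR m).
    set (u := x + INR m) in *. assert (Hu : 0 < u) by (unfold u; lra).
    assert (E : Cmod (RtoC x + RtoC (INR m)) = u).
    { rewrite <- RtoC_plus, Cmod_R. apply Rabs_pos_eq. unfold u; lra. }
    set (q := ln (1 + t ^ 2 / u ^ 2)).
    assert (Q : 0 < t ^ 2 / u ^ 2) by (apply Rdiv_lt_0_compat; apply pow_lt; assumption).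
    assert (F : forall t', t' * t' = t * t -> Cmod (vline x t' + RtoC (INR m)) = u * exp (q / 2)).
    { intros t' Ht'. assert (D := Cmod_dec (vline x t' + RtoC (INR m))).
      rewrite re_plus, im_plus, Re_vline, Im_vline, re_RtoC, im_RtoC, Rplus_0_r, Ht' in D. fold u in D.
      assert (Eq : exp (q / 2) * exp (q / 2) = 1 + t ^ 2 / u ^ 2).
      { rewrite <- exp_plus. replace (q / 2 + q / 2) with q by field. apply exp_ln. lra. }
      assert (D2 : (u * exp (q / 2)) * (u * exp (q / 2)) = u * u + t * t).
      { transitivity (u * u * (exp (q / 2) * exp (q / 2))); [ring|]. rewrite Eq. field. lra. }
      assert (A1 := Cmod_ge_0 (vline x t' + RtoC (INR m))).
      assert (A2 : 0 < u * exp (q / 2)) by (apply Rmult_lt_0_compat; [lra|apply exp_pos]).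
      nra. }
    rewrite E, !F by ring. split; [|reflexivity].
    rewrite S_INR. replace (x + (INR m + 1)) with (u + 1) by (unfold u; ring).
    assert (St := stirling_step t u Ht Hu). fold q in St.
    replace ((stirling t (u + 1) - stirling t x) / 2) with
      ((stirling t u - stirling t x) / 2 + (stirling t (u + 1) - stirling t u) / 2) by field.
    rewrite exp_plus.
    match goal with |- ?A * ?u * (?e1 * ?e2) <= _ => replace (A * u * (e1 * e2)) with ((A * e1) * (u * e2)) by ring end.
    apply Rmult_le_compat; [|apply Rmult_le_pos; [lra|left; apply exp_pos]|assumption|].
    + apply Rmult_le_pos; [apply Cmod_ge_0|left; apply exp_pos].
    + apply Rmult_le_compat_l; [lra|]. apply exp_le_compat. lra.
Qed.

(** In the limit [Cprod_decay] gives the factor [exp ((stirling |t| x - PI |t|) / 2)] against the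
    real point [x]. Its part [(1 + t^2 / x^2)^(x / 2)] is polynomial in [t], of degree controlled by
    [x <= 2 m]. *)
Lemma CGamma_decay (x0 x1 : R) (m : nat) : 0 < x0 -> x1 <= 2 * INR m -> exists K, 0 <= K /\
  forall x t, x0 <= x <= x1 -> Cmod (CGamma (vline x t)) <= K * (1 + t ^ 2) ^ m * exp (- (PI / 2) * Rabs t).
Proof.
  intros H0 H1.
  destruct (Gn_bounded x0 x1 H0) as (N & M & HN & HM & B).
  (* This makes [1 + t^2 / x^2 <= c (1 + t^2)] for all [x >= x0]. *)
  set (c := 1 + / x0 ^ 2).
  assert (Hx02 : 0 < / x0 ^ 2) by (apply Rinv_0_lt_compat, pow_lt; assumption).
  exists (M * (exp x1 * c ^ m)). split.
  { apply Rmult_le_pos; [assumption|]. apply Rmult_le_pos; [left; apply exp_pos|]. apply pow_le. unfold c; lra. }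
  intros x t Hx.
  assert (Hre : forall t, 0 < Re (vline x t)) by (intros; rewrite Re_vline; lra).
  (* The real point is set apart because [stirling] divides by [t]. *)
  assert (G : Cmod (CGamma (vline x t)) <= M * exp ((stirling (Rabs t) x - PI * Rabs t) / 2) \/ t = 0).
  { destruct (Req_dec t 0) as [E|E]; [right; assumption|left].
    assert (Pt : 0 < Rabs t) by (apply Rabs_pos_lt; assumption).
    set (r := Rabs t) in *.
    apply (is_lim_seq_le_loc (fun n => Cmod (Gn n (vline x t)))
      (fun n => M * exp ((stirling r x - PI * r) / 2) * exp (r ^ 2 * / INR n))
      (Cmod (CGamma (vline x t))) (M * exp ((stirling r x - PI * r) / 2))).
    - exists N. intros n Hn. assert (Pn : 0 < INR n) by (apply lt_0_INR; lia).
      assert (Cp : Cmod (Cprod (fun j => RtoC x + RtoC (INR j))%C (S n)) * exp ((stirling r (x + INR (S n)) - stirling r x) / 2)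
        <= Cmod (Cprod (fun j => vline x t + RtoC (INR j))%C (S n))).
      { destruct (Cprod_decay x r (S n)) as [A1 A2]; [lra|assumption|].
        unfold r, Rabs in A1, A2 |- *. destruct (Rcase_abs t).
        - rewrite Ropp_involutive in A2. rewrite A2. exact A1.
        - exact A1. }
      destruct (B n (vline x t) Hn) as [B1 _]; [rewrite Re_vline; assumption|].
      rewrite Re_vline in B1.
      rewrite Gn_Cmod in B1 |- * by (try lia; simpl; rewrite ?Re_vline; try lra; apply Hre).
      rewrite Re_vline. rewrite re_RtoC in B1.
      destruct (Cprod_ge (RtoC x) (S n) x) as [D1 _]; [simpl; lra|].
      set (D := Cmod (Cprod (fun j => RtoC x + RtoC (INR j))%C (S n))) in *.
      set (e := (stirling r (x + INR (S n)) - stirling r x) / 2) in *.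
      assert (Pe := exp_pos e).
      apply Rle_trans with (INR (fact n) * exp (x * ln (INR n)) / (D * exp e)).
      + apply Rmult_le_compat_l; [apply Rmult_le_pos; [apply pos_INR|left; apply exp_pos]|].
        apply Rinv_le_contravar; [apply Rmult_lt_0_compat; assumption|assumption].
      + replace (INR (fact n) * exp (x * ln (INR n)) / (D * exp e)) with
          (INR (fact n) * exp (x * ln (INR n)) / D * exp (- e)) by (rewrite exp_Ropp; field; split; lra).
        rewrite Rmult_assoc. apply Rmult_le_compat; [|left; apply exp_pos|assumption|].
        * apply Rmult_le_pos; [apply Rmult_le_pos; [apply pos_INR|left; apply exp_pos]|].
          left; apply Rinv_0_lt_compat; assumption.
        * rewrite <- exp_plus. apply exp_le_compat. unfold e.
          assert (L := stirling_lower r (x + INR (S n)) Pt ltac:(rewrite S_INR; lra)).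
          assert (Iv : / (x + INR (S n)) <= / INR n) by (apply Rinv_le_contravar; [lra|rewrite S_INR; lra]).
          assert (0 < r ^ 2) by (apply pow_lt; assumption).
          assert (r ^ 2 * / (x + INR (S n)) <= r ^ 2 * / INR n) by (apply Rmult_le_compat_l; lra). lra.
    - apply Ccv_Cmod, Gn_cv, Hre.
    - rewrite <- (Rmult_1_r (M * exp _)) at 1. 
      replace (Finite (M * exp ((stirling r x - PI * r) / 2) * 1)) with
        (Rbar_mult (M * exp ((stirling r x - PI * r) / 2)) 1) by reflexivity.
      apply is_lim_seq_scal_l. rewrite <- exp_0.
      apply (is_lim_seq_continuous exp (fun n => r ^ 2 * / INR n) 0).
      + apply derivable_continuous_pt, derivable_pt_exp.
      + apply is_lim_seq_inv_INR. }
  assert (Pc : 1 <= c) by (unfold c; lra).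
  assert (Pt2 : 1 <= 1 + t ^ 2) by (generalize (pow2_ge_0 t); lra).
  assert (Pp : 1 <= c ^ m * (1 + t ^ 2) ^ m).
  { rewrite <- Rpow_mult_distr. apply pow_R1_Rle. nra. }
  destruct G as [G|E].
  - destruct (Req_dec t 0) as [E|E].
    + subst. rewrite Rabs_R0 in G. eapply Rle_trans; [apply G|]. rewrite Rabs_R0, !Rmult_0_r, exp_0.
      unfold stirling. 
      replace ((x * ln (1 + 0 ^ 2 / x ^ 2) + 2 * 0 * atan (x / 0) - 0) / 2) with (x / 2 * ln 1).
      2:{ replace (0 ^ 2 / x ^ 2) with 0 by (field; lra). rewrite Rplus_0_r. field. }
      rewrite ln_1, Rmult_0_r, exp_0. rewrite !Rmult_1_r, !Rmult_assoc.
      rewrite <- (Rmult_1_r M) at 1. apply Rmult_le_compat_l; [assumption|].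
      assert (1 <= exp x1) by (rewrite <- exp_0; apply exp_le_compat; lra). nra.
    + assert (Pt : 0 < Rabs t) by (apply Rabs_pos_lt; assumption).
      eapply Rle_trans; [apply G|].
      rewrite !Rmult_assoc. apply Rmult_le_compat_l; [assumption|].
      replace ((stirling (Rabs t) x - PI * Rabs t) / 2) with
        (stirling (Rabs t) x / 2 + - (PI / 2) * Rabs t) by field.
      rewrite exp_plus, <- !Rmult_assoc. apply Rmult_le_compat_r; [left; apply exp_pos|].
      apply Rle_trans with (exp (x1 + INR m * ln (c * (1 + t ^ 2)))).
      * apply exp_le_compat.
        assert (S1 := stirling_upper (Rabs t) x Pt ltac:(lra)).
        rewrite pow2_abs in S1.
        assert (Pr : 0 <= t ^ 2 / x ^ 2).
        { apply Rmult_le_pos; [apply pow2_ge_0|]. left; apply Rinv_0_lt_compat, pow_lt; lra. }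
        assert (L1 : ln (1 + t ^ 2 / x ^ 2) <= ln (c * (1 + t ^ 2))).
        { apply ln_le_compat; [lra|].
          assert (t ^ 2 / x ^ 2 <= t ^ 2 * / x0 ^ 2).
          { apply Rmult_le_compat_l; [apply pow2_ge_0|]. apply Rinv_le_contravar; [apply pow_lt; lra|].
            apply pow_incr; lra. }
          unfold c. generalize (pow2_ge_0 t). nra. }
        assert (L0 : 0 <= ln (1 + t ^ 2 / x ^ 2)).
        { rewrite <- ln_1. apply ln_le_compat; lra. }
        assert (x * ln (1 + t ^ 2 / x ^ 2) <= 2 * INR m * ln (c * (1 + t ^ 2))) by (apply Rmult_le_compat; lra).
        lra.
      * right. rewrite exp_plus, Rmult_assoc. f_equal.
        rewrite <- Rpow_mult_distr.
        assert (Pz : 0 < c * (1 + t ^ 2)) by nra.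
        rewrite exp_nat_mult, exp_ln by assumption. reflexivity.
  - subst. rewrite Rabs_R0, Rmult_0_r, exp_0.
    assert (A : Cmod (CGamma (vline x 0)) <= M).
    { apply (is_lim_seq_le_loc (fun n => Cmod (Gn n (vline x 0))) (fun _ => M) (Cmod (CGamma (vline x 0))) M).
      - exists N. intros n Hn. apply B; [assumption|rewrite Re_vline; assumption].
      - apply Ccv_Cmod, Gn_cv, Hre.
      - apply is_lim_seq_const. }
    eapply Rle_trans; [apply A|]. rewrite !Rmult_1_r, !Rmult_assoc.
    rewrite <- (Rmult_1_r M) at 1. apply Rmult_le_compat_l; [assumption|].
    assert (1 <= exp x1) by (rewrite <- exp_0; apply exp_le_compat; lra). nra.
Qed.

Lemma poly_exp_bounded (m : nat) (d : R) : 0 < d -> exists K, 0 <= K /\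
  forall t, (1 + t ^ 2) ^ m * exp (- d * Rabs t) <= K.
Proof.
  intros Hd. 
  (* The exponential is shared among the [m] polynomial factors, each absorbed by
     [exp (eta |t|) >= (1 + eta |t| / 2)^2]; [m + 1] avoids a division by zero when [m = 0]. *)
  set (eta := d / (INR m + 1)). assert (Pm := pos_INR m).
  assert (He : 0 < eta) by (apply Rdiv_lt_0_compat; lra).
  set (k := 1 + 4 / eta ^ 2).
  assert (Pq : 0 < 4 / eta ^ 2) by (apply Rdiv_lt_0_compat; [lra|apply pow_lt; assumption]).
  exists (k ^ m). split; [apply pow_le; unfold k; lra|].
  intros t. assert (Pt := Rabs_pos t).
  assert (A : 1 + t ^ 2 <= k * exp (eta * Rabs t)).
  { assert (E : (1 + eta * Rabs t / 2) * (1 + eta * Rabs t / 2) <= exp (eta * Rabs t)).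
    { replace (eta * Rabs t) with (eta * Rabs t / 2 + eta * Rabs t / 2) at 3 by field. rewrite exp_plus.
      assert (B := exp_ineq1_le (eta * Rabs t / 2)). 
      assert (0 <= eta * Rabs t / 2) by nra. apply Rmult_le_compat; lra. }
    rewrite <- (pow2_abs t). apply Rle_trans with (k * ((1 + eta * Rabs t / 2) * (1 + eta * Rabs t / 2))).
    - unfold k. set (r := Rabs t) in *.
      assert (F : 4 / eta ^ 2 * ((eta * r / 2) * (eta * r / 2)) = r ^ 2) by (field; lra).
      assert (0 <= eta * r / 2) by nra.
      assert (0 <= 4 / eta ^ 2 * (eta * r / 2)) by (apply Rmult_le_pos; lra). nra.
    - apply Rmult_le_compat_l; [unfold k; lra|assumption]. }
  apply Rle_trans with ((k * exp (eta * Rabs t)) ^ m * exp (- d * Rabs t)).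
  - apply Rmult_le_compat_r; [left; apply exp_pos|]. apply pow_incr. generalize (pow2_ge_0 t). lra.
  - rewrite Rpow_mult_distr, Rmult_assoc. rewrite <- (Rmult_1_r (k ^ m)) at 2.
    apply Rmult_le_compat_l; [apply pow_le; unfold k; lra|].
    rewrite <- exp_nat_mult, <- exp_plus, <- exp_0. apply exp_le_compat.
    assert (INR m * eta <= d).
    { unfold eta. apply Rmult_le_reg_r with (INR m + 1); [lra|].
      replace (INR m * (d / (INR m + 1)) * (INR m + 1)) with (INR m * d) by (field; lra). nra. }
    nra.
Qed.

(** * The Cahen-Mellin integral *)

Lemma exp_series_remainder (x : R) : is_lim_seq (fun n => x ^ n / INR (fact n)) 0.
Proof. apply is_lim_seq_Reals, cv_speed_pow_fact. Qed.

Lemma Cmod_Cpow (z : C) (n : nat) : Cmod (z ^ n) = Cmod z ^ n.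
Proof. induction n; simpl; [apply Cmod_1|]. rewrite Cmod_mult, IHn. reflexivity. Qed.

(** Along the ray [t w], the product of [exp (- t w)] with the partial sum has as derivative a
    single term, of modulus at most [|w| exp |w| * |w|^M / M!]. Hence the product stays close to its
    value [1] at [t = 0]. *)
Lemma Cexp_series (w : C) : Ccv (Csum (fun n => RtoC (/ INR (fact n)) * w ^ n)%C) (Cexp w).
Proof.
  pose (e := fun t n => (RtoC (t ^ n / INR (fact n)) * w ^ n)%C).
  assert (De : forall M t, cder (fun t => Csum (e t) (S M)) t (w * Csum (e t) M)%C).
  { intros M t. induction M.
    - simpl. eapply cder_eq; [apply (cder_ext (fun _ => RtoC 1)); [|apply cder_const]|ring].
      intros u. unfold e. simpl. replace (1 / 1) with 1 by field. ring.
    - apply (cder_ext (fun t => Csum (e t) (S M) + e t (S M))%C); [reflexivity|].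
      eapply cder_eq; [apply cder_plus; [exact IHM|]|].
      { unfold e. apply (cder_mult (fun t => RtoC (t ^ S M / INR (fact (S M)))) (fun _ => w ^ S M)%C); [|apply cder_const].
        instantiate (1 := RtoC (t ^ M / INR (fact M))). 
        assert (F := INR_fact_neq_0 M). assert (P := pos_INR M).
        apply cder_RtoC. apply (is_derive_ext (fun u => / INR (fact (S M)) * u ^ S M)).
        { intros u. simpl. unfold Rdiv. ring. }
        evar_last; [apply is_derive_scal, is_derive_Reals, derivable_pt_lim_pow|].
        rewrite fact_simpl, mult_INR. simpl Nat.pred. field. split; [assumption|]. rewrite S_INR; lra. }
      simpl Csum. unfold e. rewrite Cpow_S. ring. }
  assert (W := Cmod_ge_0 w).
  assert (K : Ccv (fun M => Cexp (- w) * Csum (e 1) (S M))%C 1).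
  { apply (Ccv_le _ _ (fun M => (Cmod w * exp (Cmod w)) * (Cmod w ^ M / INR (fact M))) 0).
    - intros M _. assert (F := INR_fact_lt_0 M).
      assert (H := mean_value_le (fun t => Cexp (RtoC t * (- w)) * Csum (e t) (S M))%C
        (fun t => - w * (Cexp (RtoC t * (- w)) * e t M))%C 0 1
        (Cmod w * exp (Cmod w) * (Cmod w ^ M / INR (fact M))) ltac:(lra)).
      cbv beta in H. rewrite Cmult_0_l, Cmult_1_l, Cexp_0 in H.
      assert (E0 : Csum (e 0) (S M) = RtoC 1).
      { clear - e. induction M.
        - simpl. unfold e. simpl. replace (1 / 1) with 1 by field. ring.
        - change (Csum (e 0) (S (S M))) with (Csum (e 0) (S M) + e 0 (S M))%C. rewrite IHM. unfold e.
          rewrite pow_ne_zero by lia. unfold Rdiv. rewrite Rmult_0_l. ring. }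
      rewrite E0, Cmult_1_l in H. eapply Rle_trans; [apply H|right; ring].
      + intros t Ht. eapply cder_eq; [apply cder_mult; [apply cder_Cexp_line|apply De]|].
        cbv beta. change (Csum (e t) (S M)) with (Csum (e t) M + e t M)%C. ring.
      + intros t Ht. rewrite !Cmod_mult, Cmod_opp, Cmod_Cexp. unfold e.
        rewrite Cmod_mult, Cmod_Cpow, Cmod_R.
        rewrite Rmult_assoc. apply Rmult_le_compat_l; [assumption|].
        apply Rmult_le_compat; [left; apply exp_pos|apply Rmult_le_pos; [apply Rabs_pos|apply pow_le; assumption]| |].
        * apply exp_le_compat. rewrite re_scal_l, re_opp.
          assert (A := re_le_Cmod w). assert (B := Rle_abs (- Re w)). rewrite Rabs_Ropp in B. nra.
        * unfold Rdiv. rewrite (Rmult_comm (Cmod w ^ M)). apply Rmult_le_compat_r; [apply pow_le; assumption|].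
          rewrite Rabs_mult, Rabs_inv, (Rabs_pos_eq (INR _)) by lra.
          rewrite <- (Rmult_1_l (/ _)) at 2. apply Rmult_le_compat_r; [left; apply Rinv_0_lt_compat; assumption|].
          rewrite Rabs_pos_eq by (apply pow_le; lra). rewrite <- (pow1 M). apply pow_incr; lra.
    - replace (Finite 0) with (Rbar_mult (Cmod w * exp (Cmod w)) 0) by (simpl; f_equal; ring).
      apply is_lim_seq_scal_l, exp_series_remainder. }
  apply Ccv_incr_1. apply (Ccv_ext (fun M => Cexp w * (Cexp (- w) * Csum (e 1) (S M)))%C).
  - intros M. rewrite Cexp_opp. replace (Csum (e 1) (S M)) with (Csum (fun n => (/ INR (fact n))%R * w ^ n)%C (S M)).
    + field. apply Cexp_neq_0.
    + apply Csum_ext. intros k _. unfold e. rewrite pow1. unfold Rdiv. rewrite Rmult_1_l. reflexivity.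
  - eapply Ccv_eq; [apply Ccv_scal, K|ring].
Qed.

Lemma Cmod_Cexp_vline (L : C) (y t X : R) : Rabs y <= X ->
  Cmod (Cexp (- (vline y t * L))) <= exp (X * Rabs (Re L)) * exp (Rabs (Im L) * Rabs t).
Proof.
  intros Hy. rewrite Cmod_Cexp, <- exp_plus. apply exp_le_compat.
  rewrite re_opp, re_mult, Re_vline, Im_vline.
  assert (A := Rle_abs (- (y * Re L))). rewrite Rabs_Ropp, Rabs_mult in A.
  assert (B := Rle_abs (t * Im L)). rewrite Rabs_mult in B.
  assert (Rabs y * Rabs (Re L) <= X * Rabs (Re L)) by (apply Rmult_le_compat_r; [apply Rabs_pos|assumption]).
  lra.
Qed.

(** The surplus [exp (- (PI / 2 - |Im L|) |t|)] absorbs [N + m + 1] powers of [1 + t^2]: [N] from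
    the bound on Gamma, [m] on demand, one for integrability. The abscissas [x] and [y] are separate
    because Gamma is often taken at [s + 1] while the exponential stays at [s]. *)
Lemma CGamma_Cexp_decay (x0 x1 X : R) (L : C) (m : nat) : 0 < x0 -> Rabs (Im L) < PI / 2 ->
  exists K, 0 <= K /\ forall x y t, x0 <= x <= x1 -> Rabs y <= X ->
    (1 + t ^ 2) ^ m * (Cmod (CGamma (vline x t)) * Cmod (Cexp (- (vline y t * L)))) <= K * / (1 + t ^ 2).
Proof.
  intros H0 HL.
  destruct (INR_large x1) as [N HN].
  destruct (CGamma_decay x0 x1 N H0) as [K1 [HK1 G]].
  { specialize (HN N (le_n N)). generalize (pos_INR N). lra. }
  destruct (poly_exp_bounded (N + m + 1) (PI / 2 - Rabs (Im L))) as [K2 [HK2 D]]; [lra|].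
  exists (K1 * exp (X * Rabs (Re L)) * K2). split.
  { repeat apply Rmult_le_pos; try assumption. left; apply exp_pos. }
  intros x y t Hx Hy.
  assert (Pt : 1 <= 1 + t ^ 2) by (generalize (pow2_ge_0 t); lra).
  apply Rmult_le_reg_r with (1 + t ^ 2); [lra|].
  rewrite (Rmult_assoc _ (/ _)), Rinv_l, Rmult_1_r by lra.
  specialize (G x t Hx). assert (E := Cmod_Cexp_vline L y t X Hy). specialize (D t).
  set (q := 1 + t ^ 2) in *.
  assert (Pq : forall k, 0 <= q ^ k) by (intros; apply pow_le; lra).
  apply Rle_trans with (q ^ m * ((K1 * q ^ N * exp (- (PI / 2) * Rabs t)) *
    (exp (X * Rabs (Re L)) * exp (Rabs (Im L) * Rabs t))) * q).
  - apply Rmult_le_compat_r; [lra|]. apply Rmult_le_compat_l; [apply Pq|].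
    apply Rmult_le_compat; try apply Cmod_ge_0; assumption.
  - replace (- (PI / 2 - Rabs (Im L)) * Rabs t) with (- (PI / 2) * Rabs t + Rabs (Im L) * Rabs t) in D by ring.
    rewrite exp_plus in D.
    replace (q ^ (N + m + 1)) with (q ^ N * q ^ m * q) in D by (rewrite !pow_add; simpl; ring).
    apply Rmult_le_compat_l with (r := K1 * exp (X * Rabs (Re L))) in D.
    2:{ apply Rmult_le_pos; [assumption|left; apply exp_pos]. }
    eapply Rle_trans; [|apply D]. right. ring.
Qed.

(** The product [(s - 1)(s - 2)...(s - n)], that is, the quotient [Gamma(s) / Gamma(s - n)]. *)
Definition falling (n : nat) (s : C) : C := Cprod (fun j => s - RtoC (INR (S j)))%C n.

(** Each factor satisfies [|s - (j + 1)| >= j + 1/2 >= (j + 1) / 2]. The factorial is what sends the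
    remainder of the Cahen-Mellin expansion to zero. *)
Lemma falling_ge n s : Re s <= 1 / 2 -> INR (fact n) / 2 ^ n <= Cmod (falling n s).
Proof.
  intros Hs. unfold falling. induction n; [simpl; rewrite Cmod_1; lra|].
  cbn [Cprod]. rewrite Cmod_mult, fact_simpl, mult_INR.
  assert (P := pos_INR n). assert (F := INR_fact_lt_0 n). assert (P2 : 0 < 2 ^ n) by (apply pow_lt; lra).
  replace (INR (S n) * INR (fact n) / 2 ^ S n) with (INR (fact n) / 2 ^ n * (INR (S n) / 2)) by (simpl pow; field; lra).
  apply Rmult_le_compat.
  - left; apply Rdiv_lt_0_compat; assumption.
  - rewrite S_INR; lra.
  - assumption.
  - eapply Rle_trans; [|apply re_le_Cmod]. rewrite re_minus, re_RtoC, S_INR.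
    rewrite Rabs_left1; lra.
Qed.

Lemma falling_neq_0 n s : Re s < 1 -> falling n s <> RtoC 0.
Proof.
  intros Hs. apply Cprod_neq_0. intros j _ Q. apply (f_equal Re) in Q.
  rewrite re_minus, re_RtoC, S_INR in Q. simpl in Q. generalize (pos_INR j). lra.
Qed.

Lemma falling_shift n s : (falling n (s - 1) * (s - 1))%C = falling (S n) s.
Proof.
  unfold falling. induction n; [simpl; ring|].
  change (Cprod (fun j => s - RtoC (INR (S j))) (S (S n)))%C with
    (Cprod (fun j => s - RtoC (INR (S j))) (S n) * (s - RtoC (INR (S (S n)))))%C.
  rewrite <- IHn. cbn [Cprod]. rewrite (S_INR (S n)), RtoC_plus. ring.
Qed.

(** This encodes the residue [(-1)^n / n!] of Gamma at [- n]. *)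
Lemma falling_0 n : (falling n 0 * RtoC (/ INR (fact n)))%C = ((- (1)) ^ n)%C.
Proof.
  unfold falling. induction n.
  - simpl. rewrite Rinv_1. ring.
  - cbn [Cprod]. rewrite Cpow_S, <- IHn, fact_simpl, mult_INR.
    assert (F := INR_fact_neq_0 n). assert (P : INR (S n) <> 0) by (apply not_0_INR; lia).
    rewrite Rinv_mult, RtoC_mult, (RtoC_inv (INR (S n))) by assumption.
    assert (Q : RtoC (INR (S n)) <> RtoC 0) by (intros Q; apply RtoC_inj in Q; contradiction).
    field. exact Q.
Qed.

Lemma holo_falling n s : holo_at (falling n) s.
Proof.
  apply (holo_Cprod (fun j s => s - RtoC (INR (S j)))%C).
  intros j. apply holo_minus; [apply holo_id|apply holo_const].
Qed.

(* The integrand [CGamma s * exp (- s L)] translated by [n], with [CGamma] moved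
   back to the right half plane: the pole at [s = 0] is the only one near the strip. *)
Definition mellin_kernel (L : C) (n : nat) (s : C) : C :=
  (CGamma (s + 1) * Cexp (- (s * L)) * Cexp L ^ n / falling n s)%C.

Lemma holo_mellin_kernel L n s : -1 < Re s < 1 -> holo_at (mellin_kernel L n) s.
Proof.
  intros Hs. unfold mellin_kernel. apply holo_div; [apply falling_neq_0; lra| |apply holo_falling].
  apply holo_mult; [|apply holo_const]. apply holo_mult.
  - apply (holo_comp CGamma (fun s => s + 1)%C).
    + apply holo_plus; [apply holo_id|apply holo_const].
    + apply holo_CGamma. rewrite re_plus, re_RtoC. lra.
  - apply holo_Cexp_comp. apply holo_opp, holo_mult; [apply holo_id|apply holo_const].
Qed.

Lemma vline_plus_R x t y : (vline x t + RtoC y)%C = vline (x + y) t.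
Proof. unfold vline. rewrite RtoC_plus. ring. Qed.

Lemma vline_neq_0 x t : x <> 0 -> vline x t <> RtoC 0.
Proof. intros H Q. apply (f_equal Re) in Q. rewrite Re_vline in Q. contradiction. Qed.

Lemma mellin_kernel_bound (L : C) : Rabs (Im L) < PI / 2 -> exists K, 0 <= K /\
  forall n x t, -1 / 2 <= x <= 1 / 2 ->
   Cmod (mellin_kernel L n (vline x t)) <= K * (2 * Cmod (Cexp L)) ^ n / INR (fact n) * / (1 + t ^ 2).
Proof.
  intros HL. destruct (CGamma_Cexp_decay (1 / 2) (3 / 2) (1 / 2) L 0) as [K [HK B]]; [lra|assumption|].
  exists K. split; [assumption|]. intros n x t Hx. unfold mellin_kernel.
  rewrite Cmod_div by (apply falling_neq_0; rewrite Re_vline; lra).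
  rewrite !Cmod_mult, Cmod_Cpow, vline_plus_R.
  specialize (B (x + 1) x t ltac:(lra) ltac:(apply Rabs_le; lra)).
  simpl pow in B at 1. rewrite Rmult_1_l in B.
  assert (Fg := falling_ge n (vline x t) ltac:(rewrite Re_vline; lra)).
  assert (F := INR_fact_lt_0 n). assert (P2 : 0 < 2 ^ n) by (apply pow_lt; lra).
  assert (Pd : 0 < INR (fact n) / 2 ^ n) by (apply Rdiv_lt_0_compat; assumption).
  apply Rle_trans with (K * / (1 + t ^ 2) * Cmod (Cexp L) ^ n * / (INR (fact n) / 2 ^ n)).
  - apply Rmult_le_compat.
    + repeat apply Rmult_le_pos; try apply Cmod_ge_0. apply pow_le, Cmod_ge_0.
    + left; apply Rinv_0_lt_compat; lra.
    + apply Rmult_le_compat_r; [apply pow_le, Cmod_ge_0|assumption].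
    + apply Rinv_le_contravar; assumption.
  - right. rewrite Rpow_mult_distr. field. generalize (pow2_ge_0 t). repeat split; lra.
Qed.

(** The line is not pushed to the left through ever more poles: the integrand is translated back, so
    that every step crosses the pole [0] of the fixed strip from [-1/2] to [1/2]. Step [n]
    contributes the [n]-th term of the series of [exp (- Cexp L)], and the integral left over is
    bounded by [(2 |Cexp L|)^n / n!] up to a constant. *)
Lemma mellin_kernel_integral (L : C) : Rabs (Im L) < PI / 2 ->
  pvint (fun t => mellin_kernel L 0 (vline (1 / 2) t) / vline (1 / 2) t)%C (RtoC (2 * PI) * Cexp (- Cexp L))%C.
Proof.
  intros HL. destruct (mellin_kernel_bound L HL) as [K [HK B]].
  set (a := fun n => K * (2 * Cmod (Cexp L)) ^ n / INR (fact n)).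
  assert (Pc := Cmod_ge_0 (Cexp L)).
  assert (Pa : forall n, 0 <= a n).
  { intros n. unfold a. apply Rmult_le_pos; [apply Rmult_le_pos; [assumption|apply pow_le; lra]|].
    left; apply Rinv_0_lt_compat, INR_fact_lt_0. }
  set (F := fun n t => (mellin_kernel L n (vline (1 / 2) t) / vline (1 / 2) t)%C).
  assert (Dom : forall n, dominated (F n) (2 * a n)).
  { intros n. split.
    - intros t. unfold F. apply (rcont_holo_vline (fun s => mellin_kernel L n s / s)%C).
      apply holo_div; [apply vline_neq_0; lra| |apply holo_id].
      apply holo_mellin_kernel. rewrite Re_vline. lra.
    - intros t. unfold F. rewrite Cmod_div by (apply vline_neq_0; lra).
      specialize (B n (1 / 2) t ltac:(lra)). fold (a n) in B.
      rewrite (Rmult_comm 2), (Rmult_assoc (a n)), (Rmult_comm 2), <- Rmult_assoc.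
      apply Rmult_le_compat; [apply Cmod_ge_0| |exact B|].
      + left; apply Rinv_0_lt_compat, Cmod_gt_0, vline_neq_0. lra.
      + apply Rle_trans with (/ (1 / 2)); [|right; field]. apply Rinv_le_contravar; [lra|].
        eapply Rle_trans; [|apply re_le_Cmod]. rewrite Re_vline. apply Rle_abs. }
  assert (Hl : forall n, exists l, pvint (F n) l) by (intros n; apply (dominated_pvint _ _ (Dom n))).
  assert (Step : forall n l l', pvint (F n) l -> pvint (F (S n)) l' ->
    (l - l')%C = (RtoC (2 * PI) * (RtoC (/ INR (fact n)) * (- Cexp L) ^ n))%C).
  { intros n l l' H H'.
    apply (Ccv_unique (fun m => CInt (F n) (- INR m) (INR m) - CInt (F (S n)) (- INR m) (INR m))%C).
    { apply Ccv_minus; assumption. }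
    assert (R := residue_shift (mellin_kernel L n) (-1 / 2) (1 / 2) (1 / 4) 0 (a n) ltac:(lra) ltac:(lra)).
    replace (RtoC (2 * PI) * (RtoC (/ INR (fact n)) * (- Cexp L) ^ n))%C with
      (RtoC (2 * PI) * mellin_kernel L n 0)%C.
    2:{ f_equal. unfold mellin_kernel. rewrite Cplus_0_l, CGamma_1, Cmult_0_l.
        replace (- (RtoC 0))%C with (RtoC 0) by ring. rewrite Cexp_0.
        assert (E := falling_0 n). assert (N := falling_neq_0 n 0 ltac:(simpl; lra)).
        replace (- Cexp L)%C with (- (1) * Cexp L)%C by ring. rewrite Cpow_mult_l, <- E.
        assert (E2 : ((- (1)) ^ n * (- (1)) ^ n)%C = RtoC 1).
        { rewrite <- Cpow_mult_l. replace (- (1) * - (1))%C with (RtoC 1) by ring. apply Cpow_1_l. }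
        rewrite <- E in E2.
        transitivity (Cexp L ^ n * (falling n 0 * (/ INR (fact n))%R * (falling n 0 * (/ INR (fact n))%R)) / falling n 0)%C.
        - rewrite E2. field. exact N.
        - field. exact N. }
    apply (Ccv_ext (fun m => CInt (fun t => mellin_kernel L n (vline (1 / 2) t) / (vline (1 / 2) t - RtoC 0))
       (- INR m) (INR m) - CInt (fun t => mellin_kernel L n (vline (-1 / 2) t) / (vline (-1 / 2) t - RtoC 0))
       (- INR m) (INR m))%C).
    - intros m. f_equal.
      + apply CInt_ext. intros t _. unfold F. f_equal. f_equal. ring.
      (* The integrand of index [n] on the line [-1/2] is that of index [n + 1] on the line [1/2],
         through [Gamma(s + 1) = s Gamma(s)] and [falling_shift]. *)
      + apply CInt_ext. intros t _. unfold F.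
        set (s := vline (1 / 2) t).
        replace (vline (-1 / 2) t) with (s - 1)%C by (unfold s, vline; 
          replace (-1 / 2) with (1 / 2 - 1) by field; rewrite RtoC_minus; ring).
        assert (N0 : s <> RtoC 0) by (apply vline_neq_0; lra).
        assert (N1 : (s - 1)%C <> RtoC 0).
        { intros Q. apply (f_equal Re) in Q. unfold s in Q. rewrite re_minus, Re_vline in Q. simpl in Q. lra. }
        unfold mellin_kernel.
        replace (s - 1 + 1)%C with s by ring.
        rewrite (CGamma_shift s) by (try assumption; unfold s; rewrite Re_vline; lra).
        assert (Nf : falling n (s - 1) <> RtoC 0).
        { apply falling_neq_0. unfold s. rewrite re_minus, Re_vline. simpl. lra. }
        rewrite <- falling_shift, Cpow_S.
        replace (- ((s - 1) * L))%C with (- (s * L) + L)%C by ring. rewrite Cexp_plus.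
        field. repeat split; try assumption.
    - apply R.
      + intros s Hs. apply holo_mellin_kernel. lra.
      + intros x t Hx. eapply Rle_trans; [apply (B n x t Hx)|]. fold (a n).
        rewrite <- (Rmult_1_r (a n)) at 2. apply Rmult_le_compat_l; [apply Pa|].
        rewrite <- Rinv_1. apply Rinv_le_contravar; [lra|]. generalize (pow2_ge_0 t). lra. }
  destruct (Hl O) as [l0 Hl0].
  assert (Tel : forall n, exists l, pvint (F n) l /\
    l0 = (RtoC (2 * PI) * Csum (fun n => RtoC (/ INR (fact n)) * (- Cexp L) ^ n) n + l)%C).
  { intros n. induction n.
    - exists l0. split; [assumption|]. simpl. ring.
    - destruct IHn as [l [H1 H2]]. destruct (Hl (S n)) as [l' H3]. exists l'. split; [assumption|].
      assert (E := Step n l l' H1 H3). rewrite H2. simpl Csum.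
      replace l with ((l - l') + l')%C by ring. rewrite E. ring. }
  replace (RtoC (2 * PI) * Cexp (- Cexp L))%C with l0; [exact Hl0|].
  apply (Ccv_unique (fun n => RtoC (2 * PI) * Csum (fun n => RtoC (/ INR (fact n)) * (- Cexp L) ^ n) n)%C).
  - apply (Ccv_le _ _ (fun n => (2 * PI * K) * ((2 * Cmod (Cexp L)) ^ n / INR (fact n))) 0).
    + intros n _. destruct (Tel n) as [l [H1 H2]]. rewrite H2.
      match goal with |- Cmod (?A - (?A + ?l)) <= _ => replace (A - (A + l))%C with (- l)%C by ring end.
      rewrite Cmod_opp. eapply Rle_trans; [apply (dominated_pvint_le _ _ _ (Dom n) H1)|].
      right. unfold a. unfold Rdiv. ring.
    + replace (Finite 0) with (Rbar_mult (2 * PI * K) 0) by (simpl; f_equal; ring).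
      apply is_lim_seq_scal_l, exp_series_remainder.
  - apply Ccv_scal, Cexp_series.
Qed.

(** Going from [Re s = 1/2] to [3/2], where the double series converges absolutely, crosses no pole.
    The integrand is written [N(s) / (s - 1)] with [N(1) = 0], so that [residue_shift] applies with
    residue zero. *)
Lemma cahen_mellin (L : C) : Rabs (Im L) < PI / 2 ->
  pvint (fun t => CGamma (vline (3 / 2) t) * Cexp (- (vline (3 / 2) t * L)))%C (RtoC (2 * PI) * Cexp (- Cexp L))%C.
Proof.
  intros HL.
  set (N := fun s => ((s - 1) * (CGamma s * Cexp (- (s * L))))%C).
  destruct (CGamma_Cexp_decay (1 / 2) (3 / 2) (3 / 2) L 1) as [K [HK B]]; [lra|assumption|].
  assert (R := residue_shift N (1 / 2) (3 / 2) (1 / 4) 1 K ltac:(lra) ltac:(lra)).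
  assert (H := mellin_kernel_integral L HL).
  unfold pvint in *.
  assert (E : (RtoC (2 * PI) * N 1)%C = RtoC 0) by (unfold N; ring).
  rewrite E in R.
  apply (Ccv_ext (fun n => (CInt (fun t => N (vline (3 / 2) t) / (vline (3 / 2) t - RtoC 1)) (- INR n) (INR n)
    - CInt (fun t => N (vline (1 / 2) t) / (vline (1 / 2) t - RtoC 1)) (- INR n) (INR n))
    + CInt (fun t => mellin_kernel L 0 (vline (1 / 2) t) / vline (1 / 2) t) (- INR n) (INR n))%C).
  - assert (Nz : forall x t, x <> 1 -> (vline x t - 1)%C <> RtoC 0).
    { intros x t Hx Q. apply (f_equal Re) in Q. rewrite re_minus, Re_vline in Q. simpl in Q. lra. }
    intros n.
    rewrite (CInt_ext (fun t => N (vline (3 / 2) t) / (vline (3 / 2) t - 1))%C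
      (fun t => CGamma (vline (3 / 2) t) * Cexp (- (vline (3 / 2) t * L)))%C).
    2:{ intros t _. unfold N. field. apply Nz. lra. }
    rewrite (CInt_ext (fun t => N (vline (1 / 2) t) / (vline (1 / 2) t - 1))%C
      (fun t => mellin_kernel L 0 (vline (1 / 2) t) / vline (1 / 2) t)%C).
    2:{ intros t _. unfold N, mellin_kernel.
        rewrite (CGamma_shift (vline (1 / 2) t)) by (rewrite ?Re_vline; try lra; apply vline_neq_0; lra).
        change (falling 0 (vline (1 / 2) t)) with (RtoC 1). simpl Cpow.
        field. repeat split; try apply C1_nz; [apply vline_neq_0; lra|apply Nz; lra]. }
    ring.
  - eapply Ccv_eq; [apply Ccv_plus; [|exact H]; apply R|ring].
    + intros s Hs. unfold N. apply holo_mult; [apply holo_minus; [apply holo_id|apply holo_const]|].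
      apply holo_mult; [apply holo_CGamma; lra|].
      apply holo_Cexp_comp, holo_opp, holo_mult; [apply holo_id|apply holo_const].
    + intros x t Hx. unfold N. rewrite !Cmod_mult.
      specialize (B x x t Hx ltac:(apply Rabs_le; lra)). rewrite pow_1 in B.
      assert (Pt : 1 <= 1 + t ^ 2) by (generalize (pow2_ge_0 t); lra).
      apply Rle_trans with ((1 + t ^ 2) * (Cmod (CGamma (vline x t)) * Cmod (Cexp (- (vline x t * L))))).
      * apply Rmult_le_compat_r; [apply Rmult_le_pos; apply Cmod_ge_0|].
        replace (vline x t - 1)%C with (vline (x - 1) t) by (unfold vline; rewrite RtoC_minus; ring).
        eapply Rle_trans; [apply Cmod_le_parts|]. rewrite Re_vline, Im_vline.
        assert (Rabs (x - 1) <= 1 / 2) by (apply Rabs_le; lra).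
        rewrite <- (pow2_abs t). nra.
      * eapply Rle_trans; [apply B|]. rewrite <- (Rmult_1_r K) at 2. apply Rmult_le_compat_l; [assumption|].
        rewrite <- Rinv_1. apply Rinv_le_contravar; lra.
Qed.

(** * The Hurwitz zeta function *)

Definition rpow (u : R) (s : C) : C := Cexp (s * RtoC (ln u)).

Lemma Cmod_rpow u s : Cmod (rpow u s) = exp (Re s * ln u).
Proof. unfold rpow. rewrite Cmod_Cexp, re_scal_r. reflexivity. Qed.

Lemma holo_rpow u (f : C -> C) s : holo_at f s -> holo_at (fun s => rpow u (f s)) s.
Proof. intros H. apply holo_Cexp_comp, holo_mult; [assumption|apply holo_const]. Qed.

Lemma rpow_0 u : rpow u 0 = RtoC 1.
Proof. unfold rpow. rewrite Cmult_0_l. apply Cexp_0. Qed.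

Lemma rpow_1 u : 0 < u -> rpow u 1 = RtoC u.
Proof. intros H. unfold rpow. rewrite Cmult_1_l, Cexp_R, exp_ln by assumption. reflexivity. Qed.

Lemma cder_rpow (a : R) (s : C) (t : R) : 0 < a + t ->
  cder (fun t => rpow (a + t) s) t (s * rpow (a + t) (s - 1))%C.
Proof.
  intros H. unfold rpow.
  assert (Nz : RtoC (a + t) <> RtoC 0) by (intros Q; apply RtoC_inj in Q; lra).
  eapply cder_eq.
  - apply (cder_holo Cexp (fun t => s * RtoC (ln (a + t)))%C); [apply holo_Cexp|].
    apply (cder_mult (fun _ => s)); [apply cder_const|]. apply cder_RtoC.
    instantiate (1 := / (a + t)). auto_derive; [assumption|]. field. lra.
  - rewrite C_derive_Cexp.
    replace ((s - 1) * ln (a + t))%C with (s * ln (a + t) + RtoC (- ln (a + t)))%C by (rewrite RtoC_opp; ring).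
    rewrite Cexp_plus, Cexp_R, exp_Ropp, exp_ln by assumption. ring.
Qed.

Lemma rpow_bound a0 a1 u s X : 0 < a0 -> a0 <= u <= a1 -> Rabs (Re s) <= X ->
  Cmod (rpow u s) <= exp (X * (Rabs (ln a0) + Rabs (ln a1))).
Proof.
  intros H0 Hu HX. rewrite Cmod_rpow. apply exp_le_compat.
  eapply Rle_trans; [apply Rle_abs|]. rewrite Rabs_mult.
  apply Rmult_le_compat; try apply Rabs_pos; [assumption|].
  assert (A := ln_le_compat a0 u H0 ltac:(lra)). assert (B := ln_le_compat u a1 ltac:(lra) ltac:(lra)).
  assert (C1 := Rle_abs (ln a1)). assert (C2 := Rle_abs (- ln a0)). rewrite Rabs_Ropp in C2.
  assert (P1 := Rabs_pos (ln a1)). assert (P2 := Rabs_pos (ln a0)).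
  apply Rabs_le. lra.
Qed.

Lemma rpow_lipschitz a0 a1 s : 0 < a0 -> exists L, 0 <= L /\
  forall u v, a0 <= u <= a1 -> a0 <= v <= a1 -> Cmod (rpow u s - rpow v s) <= L * Rabs (u - v).
Proof.
  intros H0. set (L := Cmod s * exp (Rabs (Re (s - 1)) * (Rabs (ln a0) + Rabs (ln a1)))).
  exists L. split; [apply Rmult_le_pos; [apply Cmod_ge_0|left; apply exp_pos]|].
  assert (W : forall u v, a0 <= u <= a1 -> a0 <= v <= a1 -> u <= v -> Cmod (rpow v s - rpow u s) <= L * (v - u)).
  { intros u v Hu Hv Huv.
    assert (H := mean_value_le (fun t => rpow (0 + t) s) (fun t => s * rpow (0 + t) (s - 1))%C u v L Huv).
    cbv beta in H. rewrite !Rplus_0_l in H. apply H.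
    - intros t Ht. apply cder_rpow. lra.
    - intros t Ht. rewrite Rplus_0_l, Cmod_mult. apply Rmult_le_compat_l; [apply Cmod_ge_0|].
      apply rpow_bound; lra. }
  intros u v Hu Hv. destruct (Rle_dec u v).
  - rewrite Cmod_minus_sym, Rabs_left1 by lra. replace (- (u - v)) with (v - u) by ring. apply W; assumption.
  - rewrite Rabs_pos_eq by lra. apply W; lra.
Qed.

Definition hurwitz_series (al : R) (s : C) : C := CSeries (fun n => rpow (INR n + al) (- s)).

(** The exponent is split as [c] plus an excess. The base may be below 1, so the excess can enlarge
    a term; it is charged to [a0] as a constant factor. *)
Lemma hurwitz_term_bound (a0 al c c1 : R) (s : C) (n : nat) : 0 < a0 <= al -> 0 < c -> c <= Re s <= c1 ->
  Cmod (rpow (INR n + al) (- s)) <= exp ((c1 - c) * Rabs (ln a0)) * exp (- c * ln (INR n + a0)).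
Proof.
  intros Ha Hc Hs. assert (P := pos_INR n).
  rewrite Cmod_rpow, <- exp_plus. apply exp_le_compat. rewrite re_opp.
  assert (L1 := ln_le_compat (INR n + a0) (INR n + al) ltac:(lra) ltac:(lra)).
  assert (L2 := ln_le_compat a0 (INR n + al) ltac:(lra) ltac:(lra)).
  assert (A := Rle_abs (- ln a0)). rewrite Rabs_Ropp in A. assert (B := Rabs_pos (ln a0)).
  replace (- Re s * ln (INR n + al)) with ((Re s - c) * (- ln (INR n + al)) + - c * ln (INR n + al)) by ring.
  apply Rplus_le_compat; [|nra].
  apply Rle_trans with ((Re s - c) * Rabs (ln a0)); [apply Rmult_le_compat_l; lra|].
  apply Rmult_le_compat_r; lra.
Qed.

Lemma hurwitz_bound_series (a0 c B : R) : 0 < a0 -> 1 < c -> ex_series (fun n => B * exp (- c * ln (INR n + a0))).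
Proof. intros H0 Hc. exact (ex_series_scal_l B _ (ex_series_power c a0 Hc H0)). Qed.

Lemma hurwitz_series_cv al s : 0 < al -> 1 < Re s ->
  Ccv (Csum (fun n => rpow (INR n + al) (- s))) (hurwitz_series al s).
Proof.
  intros Ha Hs.
  destruct (Csum_cv (fun n => rpow (INR n + al) (- s)) _
    (fun n => hurwitz_term_bound al al (Re s) (Re s) s n ltac:(lra) ltac:(lra) ltac:(lra))
    (hurwitz_bound_series al (Re s) _ Ha Hs)) as [l Hl].
  unfold hurwitz_series. rewrite (Ccv_CSeries _ _ Hl). exact Hl.
Qed.

(* [Z al s] stands for [(s - 1) zeta (s, al)]; the three clauses are preserved by
   the recursion below, which moves the domain [c < Re s] one unit to the left. *)
Definition hurwitz_like (c : R) (Z : R -> C -> C) : Prop :=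
  (forall al s, 0 < al -> c < Re s -> holo_at (Z al) s) /\
  (forall s a0 a1, c < Re s -> 0 < a0 -> exists L, 0 <= L /\ forall al be,
     a0 <= al <= a1 -> a0 <= be <= a1 -> Cmod (Z al s - Z be s) <= L * Rabs (al - be)) /\
  (forall c0 c1 a0 a1, c < c0 -> 0 < a0 -> exists K m, 0 <= K /\ forall al s,
     a0 <= al <= a1 -> c0 <= Re s <= c1 -> Cmod (Z al s) <= K * (1 + Cmod s) ^ m).

(** If [Z] stands for [(s - 1)] times zeta, its value at [s + 1] already contains the factor [s] of
    the recursion, so the step involves no division. *)
Definition hurwitz_step (Z : R -> C -> C) (al : R) (s : C) : C :=
  (rpow al (1 - s) + (s - 1) * CInt (fun g => RtoC (1 - g) * Z (al + g)%R (s + 1)) 0 1)%C.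

Fixpoint hurwitz_iter (N : nat) : R -> C -> C :=
  match N with
  | O => fun al s => ((s - 1) * hurwitz_series al s)%C
  | S M => hurwitz_step (hurwitz_iter M)
  end.

Lemma rcont_lipschitz (f : R -> C) (t r L : R) : 0 < r -> 0 <= L ->
  (forall u, Rabs (u - t) < r -> Cmod (f u - f t) <= L * Rabs (u - t)) -> rcont f t.
Proof.
  intros Hr HL H e He. exists (Rmin r (e / (L + 1))). split.
  { apply Rmin_pos; [assumption|]. apply Rdiv_lt_0_compat; lra. }
  intros u Hu. assert (M1 := Rmin_l r (e / (L + 1))). assert (M2 := Rmin_r r (e / (L + 1))).
  eapply Rle_lt_trans; [apply H; lra|].
  assert (A : Rabs (u - t) < e / (L + 1)) by lra.
  apply Rmult_lt_compat_r with (r := L + 1) in A; [|lra].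
  replace (e / (L + 1) * (L + 1)) with e in A by (field; lra). generalize (Rabs_pos (u - t)). nra.
Qed.

Lemma hurwitz_like_rcont c Z al s t : hurwitz_like c Z -> 0 < al -> c < Re s -> 0 <= t ->
  rcont (fun g => RtoC (1 - g) * Z (al + g)%R s)%C t.
Proof.
  intros (_ & H & _) Ha Hs Ht.
  destruct (H s (al / 2) (al + t + al) Hs ltac:(lra)) as [L [HL HH]].
  apply rcont_mult.
  - apply (rcont_ext (fun g => 1 - RtoC g)%C); [intros; rewrite RtoC_minus; reflexivity|].
    apply (rcont_minus (fun _ => RtoC 1)); [apply rcont_const|apply rcont_RtoC].
  - apply (rcont_lipschitz _ t (al / 2) L); [lra|assumption|].
    intros u Hu. apply Rabs_def2 in Hu. replace (u - t) with ((al + u) - (al + t)) by ring. apply HH; lra.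
Qed.

Lemma hurwitz_like_cint c Z al s : hurwitz_like c Z -> 0 < al -> c < Re s ->
  cint (fun g => RtoC (1 - g) * Z (al + g)%R s)%C 0 1.
Proof.
  intros H Ha Hs. apply cint_rcont. rewrite Rmin_left, Rmax_right by lra.
  intros t Ht. apply (hurwitz_like_rcont c); lra || assumption.
Qed.

Lemma Cmod_CInt_weight (f : R -> C) M : cint (fun g => RtoC (1 - g) * f g)%C 0 1 ->
  (forall g, 0 < g < 1 -> Cmod (f g) <= M) -> Cmod (CInt (fun g => RtoC (1 - g) * f g)%C 0 1) <= M.
Proof.
  intros Hc H. replace M with (M * (1 - 0)) by ring. apply CInt_Cmod_le_const; [lra|assumption|].
  intros g Hg. specialize (H g Hg). rewrite Cmod_mult, Cmod_R, Rabs_pos_eq by lra.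
  generalize (Cmod_ge_0 (f g)). nra.
Qed.

Lemma Cmod_plus_1 s : 1 + Cmod (s + 1) <= 2 * (1 + Cmod s).
Proof.
  assert (A := Cmod_triangle s 1). rewrite Cmod_1 in A. generalize (Cmod_ge_0 s). lra.
Qed.

(** The clauses support one another: the Lipschitz bound in [al] makes the integrand continuous in
    [g], and the growth bound supplies the uniform bound that [holo_CInt] demands. Each step raises
    the degree of growth by one, through the factor [s - 1]. *)
Lemma hurwitz_like_step c Z : hurwitz_like c Z -> hurwitz_like (c - 1) (hurwitz_step Z).
Proof.
  intros HZ. assert (HZ' := HZ). destruct HZ' as (H1 & H2 & H3).
  assert (Re1 : forall s, Re (s + 1)%C = Re s + 1) by (intros; rewrite re_plus, re_RtoC; reflexivity).
  split; [|split].
  - intros al s Ha Hs. unfold hurwitz_step.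
    apply holo_plus.
    { apply holo_rpow, holo_minus; [apply holo_const|apply holo_id]. }
    apply holo_mult; [apply holo_minus; [apply holo_id|apply holo_const]|].
    set (r := (Re s - (c - 1)) / 2). assert (Hr : 0 < r) by (unfold r; lra).
    destruct (H3 (c + r) (Re s + 1 + r) al (al + 1)) as (K & m & HK & B); [lra|lra|].
    apply (holo_CInt (fun w g => RtoC (1 - g) * Z (al + g)%R (w + 1))%C s r (K * (1 + (Cmod s + r + 1)) ^ m)); [lra|lra| | |].
    + intros t w Ht Hw. apply re_ball in Hw. apply holo_mult; [apply holo_const|].
      apply (holo_comp (Z (al + t)) (fun x => x + 1)%C).
      * apply holo_plus; [apply holo_id|apply holo_const].
      * apply H1; [lra|]. rewrite Re1. unfold r in Hw. lra.
    + intros t w Ht Hw. assert (Hw' := re_ball _ _ _ Hw).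
      rewrite Cmod_mult, Cmod_R, Rabs_pos_eq by lra.
      apply Rle_trans with (1 * Cmod (Z (al + t) (w + 1)%C)).
      { apply Rmult_le_compat_r; [apply Cmod_ge_0|lra]. }
      rewrite Rmult_1_l. eapply Rle_trans; [apply B; [lra|rewrite Re1; unfold r in *; lra]|].
      apply Rmult_le_compat_l; [assumption|]. apply pow_incr. split.
      { generalize (Cmod_ge_0 (w + 1)). lra. }
      apply Rplus_le_compat_l. eapply Rle_trans; [apply Cmod_triangle|]. rewrite Cmod_1.
      assert (A := Cmod_sub_lower w s). lra.
    + intros w Hw. apply re_ball in Hw. apply (hurwitz_like_cint c); [assumption..|].
      rewrite Re1. unfold r in Hw. lra.
  - intros s a0 a1 Hs H0.
    destruct (rpow_lipschitz a0 a1 (1 - s) H0) as [L1 [HL1 A1]].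
    destruct (H2 (s + 1)%C a0 (a1 + 1) ltac:(rewrite Re1; lra) H0) as [L2 [HL2 A2]].
    exists (L1 + Cmod (s - 1) * L2). split.
    { apply Rplus_le_le_0_compat; [assumption|]. apply Rmult_le_pos; [apply Cmod_ge_0|assumption]. }
    intros al be Hal Hbe. unfold hurwitz_step.
    assert (I : forall x, a0 <= x -> cint (fun g => RtoC (1 - g) * Z (x + g)%R (s + 1))%C 0 1).
    { intros x Hx. apply (hurwitz_like_cint c); [assumption|lra|rewrite Re1; lra]. }
    match goal with |- Cmod (?p + ?k * ?x - (?q + ?k * ?y)) <= _ =>
      replace (p + k * x - (q + k * y))%C with ((p - q) + k * (x - y))%C by ring end.
    eapply Rle_trans; [apply Cmod_triangle|]. rewrite Rmult_plus_distr_r.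
    apply Rplus_le_compat; [apply A1; assumption|].
    rewrite Cmod_mult, Rmult_assoc. apply Rmult_le_compat_l; [apply Cmod_ge_0|].
    rewrite <- CInt_minus by (apply I; lra).
    rewrite (CInt_ext _ (fun g => RtoC (1 - g) * (Z (al + g)%R (s + 1) - Z (be + g)%R (s + 1)))%C) by (intros; ring).
    apply Cmod_CInt_weight.
    + apply (cint_ext (fun g => RtoC (1 - g) * Z (al + g)%R (s + 1) - RtoC (1 - g) * Z (be + g)%R (s + 1))%C).
      { intros; ring. }
      apply cint_minus; apply I; lra.
    + intros g Hg. replace (al - be) with ((al + g) - (be + g)) by ring. apply A2; lra.
  - intros c0 c1 a0 a1 Hc H0.
    destruct (H3 (c0 + 1) (c1 + 1) a0 (a1 + 1) ltac:(lra) H0) as (K & m & HK & B).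
    set (K1 := exp ((1 + Rabs c0 + Rabs c1) * (Rabs (ln a0) + Rabs (ln a1)))).
    assert (PK1 : 0 < K1) by apply exp_pos.
    exists (K1 + K * 2 ^ m), (S m). split.
    { apply Rplus_le_le_0_compat; [lra|]. apply Rmult_le_pos; [assumption|apply pow_le; lra]. }
    intros al s Hal Hs. unfold hurwitz_step.
    assert (Ps := Cmod_ge_0 s).
    assert (P1 : 1 <= (1 + Cmod s) ^ S m) by (apply pow_R1_Rle; lra).
    eapply Rle_trans; [apply Cmod_triangle|]. rewrite Rmult_plus_distr_r.
    apply Rplus_le_compat.
    + apply Rle_trans with K1; [|nra]. apply rpow_bound; [assumption..|].
      rewrite re_minus, re_RtoC. assert (A1 := Rle_abs c1). assert (A2 := Rle_abs (- c0)). rewrite Rabs_Ropp in A2.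
      assert (A3 := Rabs_pos c1). assert (A4 := Rabs_pos c0). apply Rabs_le. lra.
    + rewrite Cmod_mult.
      replace (K * 2 ^ m * (1 + Cmod s) ^ S m) with ((1 + Cmod s) * (K * (2 * (1 + Cmod s)) ^ m))
        by (rewrite Rpow_mult_distr; simpl; ring).
      apply Rmult_le_compat; try apply Cmod_ge_0.
      { eapply Rle_trans; [apply Cmod_triangle_minus|]. rewrite Cmod_1. lra. }
      apply Cmod_CInt_weight.
      { apply (hurwitz_like_cint c); [assumption|lra|rewrite Re1; lra]. }
      intros g Hg. eapply Rle_trans; [apply B; [lra|rewrite Re1; lra]|].
      apply Rmult_le_compat_l; [assumption|]. apply pow_incr. split; [|apply Cmod_plus_1].
      generalize (Cmod_ge_0 (s + 1)). lra.
Qed.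

Lemma hurwitz_like_series : hurwitz_like 1 (hurwitz_iter 0).
Proof.
  split; [|split]; simpl.
  - intros al s Ha Hs. apply holo_mult; [apply holo_minus; [apply holo_id|apply holo_const]|].
    set (r := (Re s - 1) / 2). assert (Hr : 0 < r) by (unfold r; lra).
    set (B := exp (((Re s + r) - (1 + r)) * Rabs (ln al))).
    assert (TB : forall b n, Cmod (b - s) < r -> Cmod (rpow (INR n + al) (- b)) <= B * exp (- (1 + r) * ln (INR n + al))).
    { intros b n Hb. apply re_ball in Hb. apply hurwitz_term_bound; unfold r in *; lra. }
    apply (holo_lim (fun n b => Csum (fun n => rpow (INR n + al) (- b)) n) _ s r
      (Series (fun n => B * exp (- (1 + r) * ln (INR n + al))))); [assumption| | |].
    + intros n b _. induction n; simpl; [apply holo_const|].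
      apply holo_plus; [assumption|]. apply holo_rpow, holo_opp, holo_id.
    + intros n b Hb. apply Csum_Cmod_le; [intros k; apply TB; assumption|].
      apply hurwitz_bound_series; lra.
    + intros b Hb. apply re_ball in Hb. apply hurwitz_series_cv; unfold r in *; lra.
  - intros s a0 a1 Hs H0.
    set (S0 := Series (fun n => exp (- (Re s + 1) * ln (INR n + a0)))).
    assert (HS : ex_series (fun n => exp (- (Re s + 1) * ln (INR n + a0)))) by (apply ex_series_power; lra).
    assert (PS : 0 <= S0).
    { eapply Rle_trans; [|apply (rsum_le_Series _ O); [intros; left; apply exp_pos|exact HS]]. simpl. lra. }
    exists (Cmod (s - 1) * (Cmod s * S0)). split.
    { repeat apply Rmult_le_pos; try apply Cmod_ge_0. exact PS. }
    intros al be Hal Hbe.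
    replace ((s - 1) * hurwitz_series al s - (s - 1) * hurwitz_series be s)%C with
      ((s - 1) * (hurwitz_series al s - hurwitz_series be s))%C by ring.
    rewrite Cmod_mult, !Rmult_assoc. apply Rmult_le_compat_l; [apply Cmod_ge_0|].
    assert (TL : forall n u v, a0 <= u -> u <= v ->
      Cmod (rpow (INR n + v) (- s) - rpow (INR n + u) (- s)) <=
      Cmod s * exp (- (Re s + 1) * ln (INR n + a0)) * (v - u)).
    { intros n u v Hu Huv. assert (Pn := pos_INR n).
      apply (mean_value_le (fun t => rpow (INR n + t) (- s)) (fun t => - s * rpow (INR n + t) (- s - 1))%C); [assumption| |].
      - intros t Ht. apply cder_rpow. lra.
      - intros t Ht. rewrite Cmod_mult, Cmod_opp. apply Rmult_le_compat_l; [apply Cmod_ge_0|].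
        rewrite Cmod_rpow. apply exp_le_compat. rewrite re_minus, re_opp, re_RtoC.
        assert (A := ln_le_compat (INR n + a0) (INR n + t) ltac:(lra) ltac:(lra)). nra. }
    replace (Cmod s * (S0 * Rabs (al - be))) with (Series (fun n => exp (- (Re s + 1) * ln (INR n + a0)) * (Cmod s * Rabs (al - be)))).
    2:{ rewrite Series_scal_r. fold S0. ring. }
    apply (Csum_lim_Cmod_le (fun n => rpow (INR n + al) (- s) - rpow (INR n + be) (- s))%C).
    + intros n.
      replace (exp (- (Re s + 1) * ln (INR n + a0)) * (Cmod s * Rabs (al - be))) with
        (Cmod s * exp (- (Re s + 1) * ln (INR n + a0)) * Rabs (al - be)) by ring.
      destruct (Rle_dec al be).
      * rewrite Cmod_minus_sym, Rabs_left1 by lra. replace (- (al - be)) with (be - al) by ring. apply TL; lra.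
      * rewrite Rabs_pos_eq by lra. apply TL; lra.
    + exact (ex_series_scal_r _ _ HS).
    + apply (Ccv_ext (fun n => Csum (fun n => rpow (INR n + al) (- s)) n - Csum (fun n => rpow (INR n + be) (- s)) n)%C).
      * intros n. induction n; simpl; [ring|]. rewrite <- IHn. ring.
      * apply Ccv_minus; apply hurwitz_series_cv; lra.
  - intros c0 c1 a0 a1 Hc H0.
    set (B := exp ((c1 - c0) * Rabs (ln a0))).
    assert (HS := hurwitz_bound_series a0 c0 B H0 Hc).
    set (S0 := Series (fun n => B * exp (- c0 * ln (INR n + a0)))).
    assert (PS : 0 <= S0).
    { eapply Rle_trans; [|apply (rsum_le_Series _ O); [|exact HS]]; [simpl; lra|].
      intros k. apply Rmult_le_pos; left; apply exp_pos. }
    exists S0, 1%nat. split; [assumption|]. intros al s Hal Hs.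
    rewrite Cmod_mult, pow_1, Rmult_comm. apply Rmult_le_compat; try apply Cmod_ge_0.
    + apply (Csum_lim_Cmod_le (fun n => rpow (INR n + al) (- s))); [|exact HS|apply hurwitz_series_cv; lra].
      intros n. apply hurwitz_term_bound; lra.
    + eapply Rle_trans; [apply Cmod_triangle_minus|]. rewrite Cmod_1. lra.
Qed.

Lemma hurwitz_like_iter N : hurwitz_like (1 - INR N) (hurwitz_iter N).
Proof.
  induction N.
  - simpl INR. rewrite Rminus_0_r. apply hurwitz_like_series.
  - rewrite S_INR. replace (1 - (INR N + 1)) with (1 - INR N - 1) by ring. apply hurwitz_like_step. exact IHN.
Qed.

Lemma rcont_weighted_rpow a s t : 0 < a -> 0 <= t -> rcont (fun g => RtoC (1 - g) * rpow (a + g) s)%C t.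
Proof.
  intros Ha Ht. apply rcont_mult.
  - apply (rcont_ext (fun g => 1 - RtoC g)%C); [intros; rewrite RtoC_minus; reflexivity|].
    apply (rcont_minus (fun _ => RtoC 1)); [apply rcont_const|apply rcont_RtoC].
  - apply (cder_rcont _ _ (s * rpow (a + t) (s - 1))%C). apply cder_rpow. lra.
Qed.

Lemma cint_weighted_rpow a s : 0 < a -> cint (fun g => RtoC (1 - g) * rpow (a + g) s)%C 0 1.
Proof.
  intros Ha. apply cint_rcont. rewrite Rmin_left, Rmax_right by lra. intros; apply rcont_weighted_rpow; lra.
Qed.

(** Integration by parts against the weight [1 - g]. The last two terms telescope when [u] runs
    through [al, al + 1, ...], which leaves the series of zeta. *)
Lemma CInt_weighted_rpow u s : 0 < u ->
  (s * (s - 1) * CInt (fun g => RtoC (1 - g) * rpow (u + g) (- s - 1)) 0 1 =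
   (s - 1) * rpow u (- s) - rpow u (1 - s) + rpow (u + 1) (1 - s))%C.
Proof.
  intros Hu. rewrite <- CInt_scal by (apply cint_weighted_rpow; assumption).
  rewrite (CInt_cder (fun g => (- (s - 1)) * (RtoC (1 - g) * rpow (u + g) (- s)) + rpow (u + g) (1 - s))%C).
  - rewrite Rminus_diag, Rminus_0_r, Rplus_0_r. ring.
  - rewrite Rmin_left, Rmax_right by lra. intros t Ht.
    eapply cder_eq.
    { apply cder_plus.
      - apply (cder_mult (fun _ => - (s - 1))%C); [apply cder_const|].
        apply cder_mult; [|apply cder_rpow; lra]. apply cder_RtoC.
        instantiate (1 := -1). auto_derive; [trivial|ring].
      - apply cder_rpow; lra. }
    cbv beta. replace (1 - s - 1)%C with (- s)%C by ring. ring.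
  - rewrite Rmin_left, Rmax_right by lra. intros t Ht.
    apply (rcont_mult (fun _ => s * (s - 1))%C); [apply rcont_const|apply rcont_weighted_rpow; lra].
Qed.

(** [CInt_weighted_rpow] is summed over [u = n + al]. The boundary terms leave [- al^(1-s)], as the
    one at infinity vanishes for [Re s > 1], while the sum of integrals is the integral of the
    series at [s + 1]. *)
Lemma hurwitz_step_series al s : 0 < al -> 1 < Re s -> hurwitz_iter 1 al s = hurwitz_iter 0 al s.
Proof.
  intros Ha Hs. simpl. unfold hurwitz_step.
  assert (Re1 : Re (s + 1)%C = Re s + 1) by (rewrite re_plus, re_RtoC; reflexivity).
  set (I := fun n => CInt (fun g => RtoC (1 - g) * rpow (INR n + al + g) (- s - 1))%C 0 1).
  assert (Pu : forall n, 0 < INR n + al) by (intros n; generalize (pos_INR n); lra).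
  assert (Tel : forall N, Csum (fun n => s * (s - 1) * I n)%C N =
    ((s - 1) * Csum (fun n => rpow (INR n + al) (- s)) N - rpow al (1 - s) + rpow (INR N + al) (1 - s))%C).
  { induction N.
    - simpl. rewrite Rplus_0_l. ring.
    - simpl Csum. rewrite IHN. unfold I. rewrite CInt_weighted_rpow by apply Pu.
      rewrite S_INR. replace (INR N + 1 + al) with (INR N + al + 1) by ring. ring. }
  assert (Lim1 : Ccv (Csum (fun n => s * (s - 1) * I n)%C) ((s - 1) * hurwitz_series al s - rpow al (1 - s) + 0)).
  { apply (Ccv_ext (fun N => (s - 1) * Csum (fun n => rpow (INR n + al) (- s)) N - rpow al (1 - s) + rpow (INR N + al) (1 - s))%C).
    { intros; symmetry; apply Tel. }
    apply Ccv_plus; [apply Ccv_minus; [|apply Ccv_const]; apply Ccv_scal, hurwitz_series_cv; assumption|].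
    intros e He.
    (* The threshold solves [u^(1 - Re s) = e] for [u]. *)
    destruct (INR_large (exp (- ln e / (Re s - 1)))) as [N HN]. exists N. intros n Hn. specialize (HN n Hn).
    replace (rpow (INR n + al) (1 - s) - 0)%C with (rpow (INR n + al) (1 - s)) by ring.
    rewrite Cmod_rpow, re_minus, re_RtoC.
    rewrite <- (exp_ln e) by assumption. apply exp_increasing.
    assert (A : - ln e / (Re s - 1) < ln (INR n + al)).
    { rewrite <- (ln_exp (- ln e / (Re s - 1))). apply ln_increasing; [apply exp_pos|lra]. }
    apply Rmult_lt_compat_r with (r := Re s - 1) in A; [|lra].
    replace (- ln e / (Re s - 1) * (Re s - 1)) with (- ln e) in A by (field; lra). lra. }
  set (J := CInt (fun g => RtoC (1 - g) * hurwitz_series (al + g) (s + 1))%C 0 1).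
  assert (Cj : cint (fun g => RtoC (1 - g) * hurwitz_series (al + g) (s + 1))%C 0 1).
  { assert (Ns : s <> RtoC 0) by (intros Q; subst; simpl in Hs; lra).
    apply (cint_ext (fun g => / s * (RtoC (1 - g) * hurwitz_iter 0 (al + g)%R (s + 1)))%C).
    { intros g. simpl. field. assumption. }
    apply cint_scal. apply (hurwitz_like_cint 1 (hurwitz_iter 0)); [apply hurwitz_like_series|assumption|lra]. }
  assert (Lim2 : Ccv (Csum (fun n => s * (s - 1) * I n)%C) (s * (s - 1) * J)).
  { apply (Ccv_ext (fun N => s * (s - 1) * Csum I N)%C).
    { intros N. symmetry. apply Csum_scal. }
    apply Ccv_scal.
    assert (CS : forall N, cint (fun g => RtoC (1 - g) * Csum (fun n => rpow (INR n + al + g) (- s - 1)) N)%C 0 1 /\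
      CInt (fun g => RtoC (1 - g) * Csum (fun n => rpow (INR n + al + g) (- s - 1)) N)%C 0 1 = Csum I N).
    { induction N.
      - split; [apply (cint_ext (fun _ => RtoC 0)); [intros; simpl; ring|apply cint_const]|].
        simpl. rewrite (CInt_ext _ (fun _ => RtoC 0)) by (intros; ring). rewrite CInt_const. ring.
      - destruct IHN as [IH1 IH2].
        assert (C1 := cint_weighted_rpow (INR N + al) (- s - 1) (Pu N)).
        split.
        + apply (cint_ext (fun g => RtoC (1 - g) * Csum (fun n => rpow (INR n + al + g) (- s - 1)) N
            + RtoC (1 - g) * rpow (INR N + al + g) (- s - 1))%C); [intros; simpl; ring|].
          apply cint_plus; assumption.
        + rewrite (CInt_ext _ (fun g => RtoC (1 - g) * Csum (fun n => rpow (INR n + al + g) (- s - 1)) N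
            + RtoC (1 - g) * rpow (INR N + al + g) (- s - 1))%C) by (intros; simpl; ring).
          rewrite CInt_plus by assumption. rewrite IH2. reflexivity. }
    set (c := Re s + 1). set (B := exp ((c - c) * Rabs (ln al))).
    assert (HS := hurwitz_bound_series al c B Ha ltac:(unfold c; lra)).
    apply (Ccv_le _ _ (rtail (fun n => B * exp (- c * ln (INR n + al)))) 0); [|apply rtail_lim; exact HS].
    intros N _. destruct (CS N) as [C1 E1]. rewrite <- E1, Cmod_minus_sym. unfold J.
    rewrite <- CInt_minus by assumption.
    rewrite (CInt_ext _ (fun g => RtoC (1 - g) * (hurwitz_series (al + g) (s + 1)
      - Csum (fun n => rpow (INR n + al + g) (- s - 1)) N))%C) by (intros; ring).
    apply Cmod_CInt_weight.
    - apply (cint_ext (fun g => RtoC (1 - g) * hurwitz_series (al + g) (s + 1)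
        - RtoC (1 - g) * Csum (fun n => rpow (INR n + al + g) (- s - 1)) N)%C); [intros; ring|].
      apply cint_minus; assumption.
    - intros g Hg.
      rewrite (Csum_ext _ (fun n => rpow (INR n + (al + g)) (- (s + 1)))).
      2:{ intros k _. f_equal; ring. }
      apply Csum_tail; [|exact HS|apply hurwitz_series_cv; lra].
      intros k. apply hurwitz_term_bound; unfold c; lra. }
  assert (E := Ccv_unique _ _ _ Lim1 Lim2).
  rewrite (CInt_ext _ (fun g => s * (RtoC (1 - g) * hurwitz_series (al + g) (s + 1)))%C) by (intros; ring).
  rewrite CInt_scal by assumption. fold J.
  replace ((s - 1) * (s * J))%C with (s * (s - 1) * J)%C by ring. rewrite <- E. ring.
Qed.

(** Agreement spreads to the left with the recursion itself: a step at [s] reads the previous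
    iterates at [s + 1], where they agree by induction. *)
Lemma hurwitz_iter_succ N : forall al s, 0 < al -> 1 - INR N < Re s ->
  hurwitz_iter (S N) al s = hurwitz_iter N al s.
Proof.
  induction N; intros al s Ha Hs.
  - apply hurwitz_step_series; [assumption|]. simpl in Hs. lra.
  - change (hurwitz_step (hurwitz_iter (S N)) al s = hurwitz_step (hurwitz_iter N) al s).
    unfold hurwitz_step. f_equal. f_equal. apply CInt_ext. rewrite Rmin_left, Rmax_right by lra.
    intros t Ht. f_equal. apply IHN; [lra|]. rewrite re_plus, re_RtoC. rewrite S_INR in Hs. lra.
Qed.

Lemma hurwitz_iter_le N M al s : (N <= M)%nat -> 0 < al -> 1 - INR N < Re s ->
  hurwitz_iter M al s = hurwitz_iter N al s.
Proof.
  intros H Ha Hs. induction H as [|M H IH]; [reflexivity|].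
  rewrite hurwitz_iter_succ; [assumption..|]. apply le_INR in H. lra.
Qed.

(** Some [N] with [1 - N < Re s], so that the iterate of that level is valid at [s];
    [hurwitz_iter_eq] shows that any other valid level gives the same value. *)
Definition hurwitz_level (s : C) : nat := Z.to_nat (up (2 - Re s)).

Lemma hurwitz_level_spec s : 1 - INR (hurwitz_level s) < Re s.
Proof.
  unfold hurwitz_level. destruct (archimed (2 - Re s)) as [A _].
  destruct (Z.lt_ge_cases (up (2 - Re s)) 0) as [H|H].
  - apply IZR_lt in H. assert (P := pos_INR (Z.to_nat (up (2 - Re s)))). lra.
  - rewrite INR_IZR_INZ, Z2Nat.id by assumption. lra.
Qed.

(* [hurwitz al s] is [(s - 1) zeta (s, al)], which is entire in [s]. *)
Definition hurwitz (al : R) (s : C) : C := hurwitz_iter (hurwitz_level s) al s.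

Lemma hurwitz_iter_eq N al s : 0 < al -> 1 - INR N < Re s -> hurwitz al s = hurwitz_iter N al s.
Proof.
  intros Ha Hs. unfold hurwitz. assert (L := hurwitz_level_spec s).
  destruct (Nat.le_ge_cases (hurwitz_level s) N).
  - symmetry. apply hurwitz_iter_le; assumption.
  - apply hurwitz_iter_le; assumption.
Qed.

Lemma holo_hurwitz al s : 0 < al -> holo_at (hurwitz al) s.
Proof.
  intros Ha. assert (L := hurwitz_level_spec s). set (N := hurwitz_level s) in *.
  apply (holo_at_ext_loc (hurwitz_iter N al) _ s (Re s - (1 - INR N))); [lra| |].
  - intros a H. apply re_ball in H. symmetry. apply hurwitz_iter_eq; [assumption|lra].
  - apply (hurwitz_like_iter N); assumption.
Qed.

Lemma hurwitz_eq_series al s : 0 < al -> 1 < Re s -> hurwitz al s = ((s - 1) * hurwitz_series al s)%C.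
Proof. intros Ha Hs. apply (hurwitz_iter_eq O); [assumption|simpl; lra]. Qed.

Lemma hurwitz_poly_bound (c0 c1 al : R) : 0 < al -> exists K m, 0 <= K /\ forall s,
  c0 <= Re s <= c1 -> Cmod (hurwitz al s) <= K * (1 + Cmod s) ^ m.
Proof.
  intros Ha. destruct (INR_large (1 - c0)) as [N HN]. specialize (HN N (le_n N)).
  destruct (hurwitz_like_iter N) as (_ & _ & H).
  destruct (H c0 c1 al al ltac:(lra) Ha) as (K & m & HK & B).
  exists K, m. split; [assumption|]. intros s Hs.
  rewrite (hurwitz_iter_eq N) by lra. apply B; lra.
Qed.

Lemma hurwitz_1 al : 0 < al -> hurwitz al 1 = RtoC 1.
Proof.
  intros Ha. rewrite (hurwitz_iter_eq 1) by (simpl; lra). simpl. unfold hurwitz_step.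
  replace (RtoC 1 - RtoC 1)%C with (RtoC 0) by ring. rewrite rpow_0. ring.
Qed.

(** The recursion at [0] reads the value [1] at [s = 1], and the weight [1 - g] has integral
    [1 / 2]. This is the classical [zeta(0, al) = 1/2 - al]. *)
Lemma hurwitz_0 al : 0 < al -> hurwitz al 0 = RtoC (al - 1 / 2).
Proof.
  intros Ha. rewrite (hurwitz_iter_eq 2) by (simpl; lra). 
  change (hurwitz_step (hurwitz_iter 1) al 0 = RtoC (al - 1 / 2)). unfold hurwitz_step.
  replace (RtoC 1 - RtoC 0)%C with (RtoC 1) by ring. rewrite rpow_1 by assumption.
  rewrite Cplus_0_l.
  rewrite (CInt_ext _ (fun g => RtoC (1 - g))).
  2:{ rewrite Rmin_left, Rmax_right by lra. intros t Ht.
      rewrite <- (hurwitz_iter_eq 1 (al + t) 1) by (simpl; lra). rewrite hurwitz_1 by lra. ring. }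
  rewrite (CInt_cder (fun g => RtoC (g - g ^ 2 / 2))).
  - apply Ceq_parts; simpl; field.
  - intros t _. apply cder_RtoC. auto_derive; [trivial|]. field.
  - intros t _. apply (rcont_ext (fun g => 1 - RtoC g)%C); [intros; rewrite RtoC_minus; reflexivity|].
    apply (rcont_minus (fun _ => RtoC 1)); [apply rcont_const|apply rcont_RtoC].
Qed.

(** * Roots of unity and the logarithmic series *)

Lemma e2pi_R (r : R) : e2pi (RtoC r) = Cexp (RtoC (2 * PI * r) * Ci).
Proof. unfold e2pi. f_equal. rewrite (RtoC_mult (2 * PI)). ring. Qed.

Lemma Cmod_e2pi_R (r : R) : Cmod (e2pi (RtoC r)) = 1.
Proof.
  rewrite e2pi_R, Cmod_Cexp. rewrite <- exp_0. f_equal. simpl. ring.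
Qed.

Lemma e2pi_plus a b : e2pi (a + b) = (e2pi a * e2pi b)%C.
Proof. unfold e2pi. rewrite <- Cexp_plus. f_equal. ring. Qed.

Lemma e2pi_nat_mult (n : nat) a : e2pi (RtoC (INR n) * a) = (e2pi a ^ n)%C.
Proof. unfold e2pi. rewrite <- Cexp_nat. f_equal. ring. Qed.

Lemma e2pi_nat (n : nat) : e2pi (RtoC (INR n)) = RtoC 1.
Proof. rewrite e2pi_R. apply Cexp_2PI_int. Qed.

Lemma e2pi_opp a : e2pi (- a) = (/ e2pi a)%C.
Proof. unfold e2pi. rewrite <- Cexp_opp. f_equal. ring. Qed.

Definition root (h k l : nat) : C := e2pi (RtoC (INR l) * hk h k).

Lemma root_R h k l : root h k l = e2pi (RtoC (INR l * INR h / INR k)).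
Proof. unfold root, hk. f_equal. rewrite <- RtoC_mult. f_equal. unfold Rdiv. ring. Qed.

Lemma root_pow_k h k l : (0 < k)%nat -> (root h k l ^ k)%C = RtoC 1.
Proof.
  intros Hk. assert (P : 0 < INR k) by (apply lt_0_INR; assumption).
  rewrite root_R, <- e2pi_nat_mult, <- RtoC_mult.
  replace (INR k * (INR l * INR h / INR k)) with (INR (l * h)) by (rewrite mult_INR; field; lra).
  apply e2pi_nat.
Qed.

Lemma e2pi_neq_1 (r : R) : 0 < r < 1 -> e2pi (RtoC r) <> RtoC 1.
Proof.
  intros Hr Q. rewrite e2pi_R in Q. apply (f_equal Re) in Q.
  unfold Cexp, Re in Q. simpl in Q.
  replace (2 * PI * r * 0 - 0 * 1) with 0 in Q by ring.
  replace (2 * PI * r * 1 + 0 * 0) with (2 * (PI * r)) in Q by ring.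
  rewrite exp_0, cos_2a_sin in Q.
  assert (P := PI_RGT_0). assert (S := sin_gt_0 (PI * r) ltac:(nra) ltac:(nra)). nra.
Qed.

(** Coprimality enters here: by Gauss, [k] divides [l h] only if it divides [l]. Otherwise the angle
    reduces to a fraction strictly between [0] and [1]. *)
Lemma root_eq_1 h k l : (0 < k)%nat -> Nat.gcd h k = 1%nat ->
  if (l mod k =? 0)%nat then root h k l = RtoC 1 else root h k l <> RtoC 1.
Proof.
  intros Hk Hg. assert (P : 0 < INR k) by (apply lt_0_INR; assumption).
  destruct (Nat.eqb_spec (l mod k) 0) as [E|E].
  - apply Nat.Div0.mod_divides in E. destruct E as [a E]. rewrite root_R.
    replace (INR l * INR h / INR k) with (INR (a * h)); [apply e2pi_nat|].
    subst l. rewrite !mult_INR. field. lra.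
  - assert (Er : ((l * h) mod k <> 0)%nat).
    { intros Q. apply E. apply Nat.Div0.mod_divides in Q. destruct Q as [a Q].
      apply Nat.Lcm0.mod_divide. apply (Nat.gauss k h l).
      - exists a. lia.
      - rewrite Nat.gcd_comm. exact Hg. }
    assert (D := Nat.div_mod_eq (l * h) k).
    assert (B := Nat.mod_upper_bound (l * h) k ltac:(lia)).
    set (r := ((l * h) mod k)%nat) in *. set (q := ((l * h) / k)%nat) in *.
    rewrite root_R.
    replace (INR l * INR h / INR k) with (INR q + INR r / INR k).
    2:{ rewrite <- mult_INR, D, plus_INR, mult_INR. field. lra. }
    rewrite RtoC_plus, e2pi_plus, e2pi_nat, Cmult_1_l. apply e2pi_neq_1.
    assert (B1 : INR r < INR k) by (apply lt_INR; assumption).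
    assert (B2 : 0 < INR r) by (apply lt_0_INR; lia).
    split; [apply Rdiv_lt_0_compat; assumption|].
    apply Rmult_lt_reg_r with (INR k); [assumption|]. unfold Rdiv. rewrite Rmult_assoc, Rinv_l by lra. lra.
Qed.

Lemma geometric_sum q n : ((1 - q) * Csum (fun i => q ^ S i) n = q * (1 - q ^ n))%C.
Proof.
  induction n; [simpl; ring|]. cbn [Csum].
  replace ((1 - q) * (Csum (fun i => q ^ S i) n + q ^ S n))%C with
    ((1 - q) * Csum (fun i => q ^ S i) n + (1 - q) * q ^ S n)%C by ring.
  rewrite IHn, !Cpow_S. ring.
Qed.

Lemma weighted_geometric_sum q n :
  ((1 - q) * Csum (fun i => RtoC (INR (S i)) * q ^ S i) n = Csum (fun i => q ^ S i) n - RtoC (INR n) * q ^ S n)%C.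
Proof.
  induction n; [simpl; ring|].
  cbn [Csum].
  replace ((1 - q) * (Csum (fun i => RtoC (INR (S i)) * q ^ S i) n + RtoC (INR (S n)) * q ^ S n))%C with
    ((1 - q) * Csum (fun i => RtoC (INR (S i)) * q ^ S i) n + (1 - q) * (RtoC (INR (S n)) * q ^ S n))%C by ring.
  rewrite IHn, S_INR, RtoC_plus, (Cpow_S q (S n)). ring.
Qed.

Lemma root_sum q k : (q ^ k = 1)%C -> q <> RtoC 1 -> Csum (fun i => q ^ S i)%C k = RtoC 0.
Proof.
  intros Hq Nq. assert (G := geometric_sum q k). rewrite Hq in G.
  assert (N : (1 - q)%C <> RtoC 0) by (apply Cminus_eq_contra; auto).
  rewrite <- (Cmult_1_l (Csum _ _)), <- (Cinv_l _ N), <- Cmult_assoc, G. ring.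
Qed.

(** The weights are the values of [hurwitz] at [s = 0] for the classes [1 / k, ..., k / k]; with
    [q = e(l h / k)] the sum is, up to sign, the coefficient [1 / (e(- l h / k) - 1)] of the
    constant [w]. *)
Lemma root_sum_weighted q k : (0 < k)%nat -> (q ^ k = 1)%C -> q <> RtoC 1 ->
  Csum (fun i => RtoC (INR (S i) / INR k - 1 / 2) * q ^ S i)%C k = (- (1 / (/ q - 1)))%C.
Proof.
  intros Hk Hq Nq. assert (P : 0 < INR k) by (apply lt_0_INR; assumption).
  assert (G := weighted_geometric_sum q k). rewrite (root_sum q k Hq Nq), Cpow_S, Hq in G.
  assert (N : (1 - q)%C <> RtoC 0) by (apply Cminus_eq_contra; auto).
  assert (Nk : RtoC (INR k) <> RtoC 0) by (intros Q; apply RtoC_inj in Q; lra).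
  assert (N0 : q <> RtoC 0).
  { intros Q. subst. destruct k; [lia|]. rewrite Cpow_S, Cmult_0_l in Hq. apply RtoC_inj in Hq. lra. }
  rewrite (Csum_ext _ (fun i => / RtoC (INR k) * (RtoC (INR (S i)) * q ^ S i) + (- RtoC (1 / 2)) * q ^ S i)%C).
  2:{ intros i _. rewrite RtoC_minus, RtoC_div by lra. field. assumption. }
  rewrite Csum_plus, !Csum_scal, (root_sum q k Hq Nq).
  set (W := Csum (fun i => RtoC (INR (S i)) * q ^ S i)%C k) in *.
  replace W with ((0 - INR k * (q * 1)) / (1 - q))%C by (rewrite <- G; field; assumption).
  field. repeat split; try assumption. 
Qed.

Lemma one_minus_re_pos v : Cmod v < 1 -> 0 < Re (1 - v)%C.
Proof.
  intros H. rewrite re_minus, re_RtoC. assert (A := re_le_Cmod v). assert (B := Rle_abs (Re v)). lra.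
Qed.

(** [Clog] is replaced near [t] by its form with [ln] and [atan], valid in the open half plane, and
    the components are differentiated there. *)
Lemma cder_Clog_line v t : 0 < Re (1 - RtoC t * v)%C ->
  cder (fun t => Clog (1 - RtoC t * v)) t (- v / (1 - RtoC t * v))%C.
Proof.
  intros H.
  set (A := fun u => Re (1 - RtoC u * v)%C). set (B := fun u => Im (1 - RtoC u * v)%C).
  assert (EA : forall u, A u = 1 - u * Re v) by (intros u; unfold A; rewrite re_minus, re_scal_l, re_RtoC; ring).
  assert (EB : forall u, B u = - (u * Im v)) by (intros u; unfold B; rewrite im_minus, im_scal_l, im_RtoC; ring).
  assert (Loc : locally t (fun u => 0 < 1 - u * Re v)).
  { assert (Ht : 0 < 1 - t * Re v) by (rewrite <- EA; exact H).
    assert (Cn : continuous (fun u => 1 - u * Re v) t).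
    { apply (@ex_derive_continuous R_AbsRing R_NormedModule). auto_derive. trivial. }
    apply (Cn (fun y => 0 < y)). apply (open_gt 0). exact Ht. }
  assert (H' : 0 < 1 - t * Re v) by (rewrite <- EA; exact H).
  assert (Sq : 0 < (1 - t * Re v) * (1 - t * Re v) + t * Im v * (t * Im v)) by nra.
  assert (Nz : (1 - RtoC t * v)%C <> RtoC 0).
  { intros Q. rewrite Q in H. simpl in H. lra. }
  assert (E : (- v / (1 - t * v))%C =
    (- v * Cconj (1 - t * v) * RtoC (/ ((1 - t * Re v) * (1 - t * Re v) + t * Im v * (t * Im v))))%C).
  { unfold Cdiv. rewrite <- Cmult_assoc. f_equal.
    assert (M : ((1 - t * v) * Cconj (1 - t * v))%C = RtoC ((1 - t * Re v) * (1 - t * Re v) + t * Im v * (t * Im v))).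
    { apply Ceq_parts; simpl; unfold Re, Im; ring. }
    assert (Nr : RtoC ((1 - t * Re v) * (1 - t * Re v) + t * Im v * (t * Im v)) <> RtoC 0).
    { intros Q. apply RtoC_inj in Q. lra. }
    rewrite RtoC_inv by lra. rewrite <- M in *. field. split; [|assumption].
    intros Q. rewrite Q in Nr. apply Nr. ring. }
  rewrite E. clear E.
  split.
  - apply (is_derive_ext_loc (fun u => / 2 * ln ((1 - u * Re v) * (1 - u * Re v) + u * Im v * (u * Im v)))).
    + eapply filter_imp; [|exact Loc]. intros u Hu. cbv beta in Hu. 
      assert (Pu : 0 < Re (1 - RtoC u * v)%C) by (fold (A u); rewrite EA; exact Hu).
      rewrite Clog_right_half by exact Pu.
      assert (Pm : 0 < Cmod (1 - u * v)).
      { apply Cmod_gt_0. intros Q. rewrite Q in Pu. simpl in Pu. lra. }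
      replace ((1 - u * Re v) * (1 - u * Re v) + u * Im v * (u * Im v)) with (Cmod (1 - u * v) * Cmod (1 - u * v)).
      * rewrite ln_mult by assumption. change (Re (ln (Cmod (1 - u * v)), atan (Im (1 - u * v) / Re (1 - u * v)))) with (ln (Cmod (1 - u * v))).
        match goal with |- ?a = ?b => change (@eq R a b) end. field.
      * rewrite Cmod_dec. fold (A u) (B u). rewrite EA, EB. ring.
    + auto_derive; [lra|]. unfold Re, Im. simpl. unfold Re, Im in Sq. field. unfold Re, Im. lra.
  - apply (is_derive_ext_loc (fun u => atan (- (u * Im v) / (1 - u * Re v)))).
    + eapply filter_imp; [|exact Loc]. intros u Hu. cbv beta in Hu.
      assert (Pu : 0 < Re (1 - RtoC u * v)%C) by (fold (A u); rewrite EA; exact Hu).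
      rewrite Clog_right_half by exact Pu. fold (A u) (B u). rewrite EA, EB. reflexivity.
    + auto_derive; [lra|]. unfold Rsqr, Re, Im. simpl. unfold Re, Im in *. field. split; [lra|]. nra.
Qed.

(** Along the segment from [0] to [v] the difference of the two sides has derivative
    [- t^N v^(N+1) / (1 - t v)], by the finite geometric sum, and this is at most
    [|v|^(N+1) / (1 - |v|)]. *)
Lemma Clog_series v : Cmod v < 1 -> Ccv (Csum (fun n => v ^ S n / RtoC (INR (S n)))%C) (- Clog (1 - v)).
Proof.
  intros Hv. assert (Pv := Cmod_ge_0 v).
  pose (e := fun t n => (RtoC (t ^ S n / INR (S n)) * v ^ S n)%C).
  assert (De : forall N t, cder (fun t => Csum (e t) N) t (Csum (fun n => RtoC (t ^ n) * v ^ S n)%C N)).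
  { intros N t. induction N; simpl; [apply cder_const|].
    apply cder_plus; [exact IHN|]. unfold e.
    eapply cder_eq; [apply (cder_mult (fun t => RtoC (t ^ S N / INR (S N))) (fun _ => v ^ S N)%C); [|apply cder_const]|].
    - apply cder_RtoC. instantiate (1 := t ^ N). assert (P : 0 < INR (S N)) by (apply lt_0_INR; lia).
      apply (is_derive_ext (fun u => / INR (S N) * u ^ S N)); [intros u; apply Rmult_comm|].
      evar_last; [apply is_derive_scal, is_derive_Reals, derivable_pt_lim_pow|].
      simpl Nat.pred. field. lra.
    - simpl. ring. }
  assert (Geo : forall t N, (1 - RtoC t * v)%C <> RtoC 0 ->
    Csum (fun n => RtoC (t ^ n) * v ^ S n)%C N = (v / (1 - RtoC t * v) - v * (RtoC (t ^ N) * v ^ N) / (1 - RtoC t * v))%C).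
  { intros t N Nz. induction N.
    - simpl. field. assumption.
    - cbn [Csum]. rewrite IHN. rewrite <- tech_pow_Rmult, RtoC_mult, Cpow_S. field. assumption. }
  assert (Small : forall t, 0 <= t <= 1 -> Cmod (RtoC t * v) <= Cmod v).
  { intros t Ht. rewrite Cmod_mult, Cmod_R, Rabs_pos_eq by lra. nra. }
  apply (Ccv_le _ _ (fun N => (/ (1 - Cmod v)) * Cmod v ^ S N) 0).
  - intros N _.
    assert (H := mean_value_le (fun t => Csum (e t) N - (- (1)) * Clog (1 - RtoC t * v))%C
      (fun t => Csum (fun n => RtoC (t ^ n) * v ^ S n)%C N - (- (1)) * (- v / (1 - RtoC t * v)))%C 0 1
      (/ (1 - Cmod v) * Cmod v ^ S N) ltac:(lra)).
    cbv beta in H. rewrite Cmult_0_l, Cmult_1_l in H.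
    replace (Csum (e 0) N) with (RtoC 0) in H.
    2:{ symmetry. rewrite (Csum_ext _ (fun _ => RtoC 0)); [apply Csum_zero|].
        intros n _. unfold e. rewrite pow_ne_zero by lia. unfold Rdiv. rewrite Rmult_0_l. ring. }
    replace (Csum (e 1) N) with (Csum (fun n => v ^ S n / RtoC (INR (S n)))%C N) in H.
    2:{ apply Csum_ext. intros n _. unfold e. rewrite pow1.
        assert (P : 0 < INR (S n)) by (apply lt_0_INR; lia).
        rewrite RtoC_div by lra. field. intros Q. apply RtoC_inj in Q. lra. }
    replace (Clog (1 - 0)) with (RtoC 0) in H.
    2:{ replace (1 - 0)%C with (Cexp 0) by (rewrite Cexp_0; ring). rewrite Clog_Cexp; [reflexivity|].
        simpl. generalize PI_RGT_0. lra. }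
    replace (Csum (fun n => v ^ S n / RtoC (INR (S n))) N - - Clog (1 - v))%C with
      (Csum (fun n => v ^ S n / RtoC (INR (S n))) N - - (1) * Clog (1 - v) - (0 - - (1) * 0))%C by ring.
    eapply Rle_trans; [apply H|right; ring].
    + intros t Ht. apply cder_minus; [apply De|].
      eapply cder_eq; [apply (cder_mult (fun _ => (- (1))%C)); [apply cder_const|apply cder_Clog_line]|].
      * apply one_minus_re_pos. specialize (Small t Ht). lra.
      * cbv beta. ring.
    + intros t Ht. specialize (Small t Ht).
      assert (Dn : 1 - Cmod v <= Cmod (1 - RtoC t * v)).
      { assert (A := Cmod_sub_lower 1 (RtoC t * v)). rewrite Cmod_1 in A. lra. }
      assert (Nz : (1 - RtoC t * v)%C <> RtoC 0) by (apply Cmod_gt_0; lra).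
      rewrite Geo by assumption.
      replace (v / (1 - t * v) - v * ((t ^ N)%R * v ^ N) / (1 - t * v) - - (1) * (- v / (1 - t * v)))%C with
        (- (RtoC (t ^ N) * v ^ S N) / (1 - t * v))%C by (rewrite Cpow_S; field; assumption).
      rewrite Cmod_div, Cmod_opp, Cmod_mult, Cmod_Cpow, Cmod_R by assumption.
      unfold Rdiv. rewrite (Rmult_comm (/ (1 - Cmod v))). apply Rmult_le_compat.
      * apply Rmult_le_pos; [apply Rabs_pos|apply pow_le; assumption].
      * left. apply Rinv_0_lt_compat, Cmod_gt_0. assumption.
      * rewrite <- (Rmult_1_l (Cmod v ^ S N)) at 2. apply Rmult_le_compat_r; [apply pow_le; assumption|].
        rewrite Rabs_pos_eq by (apply pow_le; lra). rewrite <- (pow1 N). apply pow_incr; lra.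
      * apply Rinv_le_contravar; lra.
  - replace (Finite 0) with (Rbar_mult (/ (1 - Cmod v)) 0) by (simpl; f_equal; ring).
    apply is_lim_seq_scal_l. apply (is_lim_seq_incr_1 (fun n => Cmod v ^ n)).
    apply is_lim_seq_geom. rewrite Rabs_pos_eq; assumption.
Qed.

Lemma Cprod_inv_one_minus (v : nat -> C) n : (forall j, Cmod (v j) < 1) ->
  Cprod (fun j => 1 / (1 - v j))%C n = Cexp (Csum (fun j => - Clog (1 - v j))%C n).
Proof.
  intros H. induction n; simpl; [symmetry; apply Cexp_0|].
  rewrite Cexp_plus, <- IHn, Cexp_opp, Cexp_Clog_right_half by apply one_minus_re_pos, H.
  f_equal. field. intros Q. assert (A := one_minus_re_pos _ (H n)). rewrite Q in A. simpl in A. lra.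
Qed.

(** * Sums over residue classes *)

Lemma Csum_blocks u k M : Csum u (M * k) = Csum (fun i => Csum (fun n => u (n * k + i)%nat) M) k.
Proof.
  induction M.
  - simpl. symmetry. apply Csum_zero.
  - replace (S M * k)%nat with (M * k + k)%nat by lia. rewrite Csum_add, IHM, <- Csum_plus. reflexivity.
Qed.

Lemma Ccv_Csum (F : nat -> nat -> C) (l : nat -> C) k :
  (forall i, (i < k)%nat -> Ccv (F i) (l i)) -> Ccv (fun M => Csum (fun i => F i M) k) (Csum l k).
Proof.
  intros H. induction k; simpl; [apply Ccv_const|].
  apply Ccv_plus; [apply IHk; intros; apply H; lia|apply H; lia].
Qed.

Lemma Ccv_multiples u l k : (0 < k)%nat -> Ccv u l -> Ccv (fun M => u (M * k)%nat) l.
Proof.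
  intros Hk H e He. destruct (H e He) as [N HN]. exists N. intros n Hn. apply HN. nia.
Qed.

Lemma Csum_last u k : (0 < k)%nat -> (forall i, (S i < k)%nat -> u i = RtoC 0) -> Csum u k = u (Nat.pred k).
Proof.
  intros Hk H. destruct k; [lia|]. simpl. rewrite (Csum_ext u (fun _ => RtoC 0)), Csum_zero; [ring|].
  intros i Hi. apply H. lia.
Qed.

Lemma mod_succ_block k n i : (0 < k)%nat -> (i < k)%nat -> ((S (n * k + i)) mod k =? 0)%nat = (S i =? k)%nat.
Proof.
  intros Hk Hi. replace (S (n * k + i)) with (S i + n * k)%nat by lia. rewrite Nat.Div0.mod_add.
  destruct (Nat.eqb_spec (S i) k) as [E|E].
  - rewrite E, Nat.Div0.mod_same. reflexivity.
  - rewrite Nat.mod_small by lia. reflexivity.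
Qed.

(** The partial sums of [u] are read at multiples of [k]. The index [n] stands for [l = n + 1], so
    the only nonzero term of each block of length [k] is its last one. *)
Lemma Ccv_multiples_only (u v : nat -> C) l m k : (0 < k)%nat ->
  (forall n, u n = if (S n mod k =? 0)%nat then v (S n) else RtoC 0) ->
  Ccv (Csum u) l -> Ccv (Csum (fun n => v (S n * k)%nat)) m -> l = m.
Proof.
  intros Hk E Hl Hm. apply (Ccv_unique (fun M => Csum u (M * k)%nat)).
  - apply Ccv_multiples; assumption.
  - apply (Ccv_ext (Csum (fun n => v (S n * k)%nat))); [|exact Hm].
    intros M. induction M; [reflexivity|].
    replace (S M * k)%nat with (M * k + k)%nat by lia. rewrite Csum_add, <- IHM. simpl Csum at 1. f_equal.
    rewrite Csum_last by (assumption || (intros i Hi; rewrite E, mod_succ_block by lia;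
      destruct (Nat.eqb_spec (S i) k); [lia|reflexivity])).
    rewrite E, mod_succ_block by lia. destruct (Nat.eqb_spec (S (Nat.pred k)) k); [|lia].
    f_equal. lia.
Qed.

(** * The continuation of the double series *)

Lemma ex_series_geom_poly (rho : R) (m : nat) : 0 <= rho < 1 -> ex_series (fun n => rho ^ S n * INR (S n) ^ m).
Proof.
  intros Hr. set (r := (1 + rho) / 2). assert (Hr1 : 0 < r < 1) by (unfold r; lra).
  assert (Hr2 : rho <= r) by (unfold r; lra).
  (* Half of the decay of [r^n] absorbs the polynomial factor, and the other half leaves a geometric
     series. The intermediate [r] replaces [rho], which may be zero and have no logarithm. *)
  set (d := - ln r / 2).
  assert (Hd : 0 < d) by (unfold d; assert (A := ln_increasing r 1 ltac:(lra) ltac:(lra)); rewrite ln_1 in A; lra).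
  destruct (poly_exp_bounded m d Hd) as [K [HK B]].
  assert (Pq : 0 < exp (- d) < 1).
  { split; [apply exp_pos|]. rewrite <- exp_0. apply exp_increasing. lra. }
  apply (ex_series_le_pos _ (fun n => K * exp (- d) ^ n)).
  2:{ exact (ex_series_scal_l K _ (ex_series_geom (exp (- d)) ltac:(rewrite Rabs_pos_eq; lra))). }
  intros n. assert (Pn := pos_INR (S n)). split.
  { apply Rmult_le_pos; apply pow_le; lra. }
  assert (E1 : rho ^ S n <= exp (- d * INR (S n)) * exp (- d) ^ S n).
  { apply Rle_trans with (r ^ S n); [apply pow_incr; lra|]. right.
    rewrite <- exp_nat_mult, <- exp_plus.
    replace (- d * INR (S n) + INR (S n) * - d) with (INR (S n) * ln r) by (unfold d; field).
    rewrite exp_nat_mult, exp_ln by lra. reflexivity. }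
  assert (E2 : INR (S n) ^ m <= (1 + INR (S n) ^ 2) ^ m) by (apply pow_incr; split; nra).
  specialize (B (INR (S n))). rewrite Rabs_pos_eq in B by assumption.
  apply Rle_trans with ((exp (- d * INR (S n)) * exp (- d) ^ S n) * (1 + INR (S n) ^ 2) ^ m).
  - apply Rmult_le_compat; try (apply pow_le; lra); assumption.
  - replace (exp (- d * INR (S n)) * exp (- d) ^ S n * (1 + INR (S n) ^ 2) ^ m) with
      ((1 + INR (S n) ^ 2) ^ m * exp (- d * INR (S n)) * exp (- d) ^ S n) by ring.
    apply Rmult_le_compat; [|apply pow_le; lra|exact B|].
    + apply Rmult_le_pos; [apply pow_le; nra|left; apply exp_pos].
    + simpl. rewrite <- (Rmult_1_l (exp (- d) ^ n)) at 2. apply Rmult_le_compat_r; [apply pow_le|]; lra.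
Qed.

(* The inner sum over [l] of the double series is [m^(-s)] times [lseries x h k m s],
   which depends on [m] only modulo [k]. *)
Definition lterm (x : C) (h k m l' : nat) (s : C) : C :=
  (x ^ S l' * root h k (S l') ^ m / RtoC (INR (S l')) * rpow (INR (S l')) (- s))%C.

Definition lseries (x : C) (h k m : nat) (s : C) : C := CSeries (fun l' => lterm x h k m l' s).

Lemma Cmod_root h k l : Cmod (root h k l) = 1.
Proof. rewrite root_R. apply Cmod_e2pi_R. Qed.

Lemma INR_S_pos n : 0 < INR (S n).
Proof. apply lt_0_INR; lia. Qed.

Lemma INR_S_ge_1 n : 1 <= INR (S n).
Proof. rewrite S_INR. generalize (pos_INR n). lra. Qed.

Lemma RtoC_INR_S_neq_0 n : RtoC (INR (S n)) <> RtoC 0.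
Proof. intros Q. apply RtoC_inj in Q. generalize (INR_S_pos n). lra. Qed.

Lemma Cmod_lterm_le x h k m l' s (X : nat) : - INR X <= Re s ->
  Cmod (lterm x h k m l' s) <= Cmod x ^ S l' * INR (S l') ^ X.
Proof.
  intros Hs. unfold lterm. assert (P := INR_S_ge_1 l').
  rewrite Cmod_mult, Cmod_div, Cmod_mult, !Cmod_Cpow, Cmod_root, pow1, Rmult_1_r by apply RtoC_INR_S_neq_0.
  rewrite Cmod_R, (Rabs_pos_eq (INR _)) by lra. rewrite Cmod_rpow, re_opp.
  assert (Px : 0 <= Cmod x ^ S l') by (apply pow_le, Cmod_ge_0).
  assert (Iv : 0 < / INR (S l') <= 1).
  { split; [apply Rinv_0_lt_compat; lra|]. rewrite <- Rinv_1. apply Rinv_le_contravar; lra. }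
  apply Rmult_le_compat.
  - apply Rmult_le_pos; [assumption|lra].
  - left; apply exp_pos.
  - unfold Rdiv. nra.
  - replace (INR (S l') ^ X) with (exp (INR X * ln (INR (S l')))) by (rewrite exp_nat_mult, exp_ln by lra; reflexivity).
    apply exp_le_compat. assert (L := ln_le_compat 1 _ ltac:(lra) P). rewrite ln_1 in L. nra.
Qed.

Lemma lseries_cv x h k m s : Cmod x < 1 -> Ccv (Csum (fun l' => lterm x h k m l' s)) (lseries x h k m s).
Proof.
  intros Hx. destruct (INR_large (- Re s)) as [X HX]. specialize (HX X (le_n X)).
  destruct (Csum_cv _ _ (fun l' => Cmod_lterm_le x h k m l' s X ltac:(lra))
    (ex_series_geom_poly (Cmod x) X (conj (Cmod_ge_0 x) Hx))) as [l Hl].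
  unfold lseries. rewrite (Ccv_CSeries _ _ Hl). exact Hl.
Qed.

Lemma lseries_bound x (X : nat) : Cmod x < 1 -> exists K, 0 <= K /\
  forall h k m s, - INR X <= Re s -> Cmod (lseries x h k m s) <= K.
Proof.
  intros Hx. assert (HS := ex_series_geom_poly (Cmod x) X (conj (Cmod_ge_0 x) Hx)).
  assert (B : forall h k m s, - INR X <= Re s -> Cmod (lseries x h k m s) <= Series (fun n => Cmod x ^ S n * INR (S n) ^ X)).
  { intros h k m s Hs. apply (Csum_lim_Cmod_le (fun l' => lterm x h k m l' s)); [|exact HS|apply lseries_cv; assumption].
    intros l'. apply Cmod_lterm_le; assumption. }
  eexists. split; [|exact B].
  eapply Rle_trans; [apply Cmod_ge_0|apply (B O O O 0)]. simpl. generalize (pos_INR X). lra.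
Qed.

Lemma holo_lterm x h k m l' s : holo_at (lterm x h k m l') s.
Proof. unfold lterm. apply holo_mult; [apply holo_const|]. apply holo_rpow, holo_opp, holo_id. Qed.

Lemma holo_lseries x h k m s : Cmod x < 1 -> holo_at (lseries x h k m) s.
Proof.
  intros Hx. destruct (INR_large (1 - Re s)) as [X HX]. specialize (HX X (le_n X)).
  assert (HS := ex_series_geom_poly (Cmod x) X (conj (Cmod_ge_0 x) Hx)).
  apply (holo_lim (fun n b => Csum (fun l' => lterm x h k m l' b) n) _ s 1
    (Series (fun n => Cmod x ^ S n * INR (S n) ^ X))); [lra| | |].
  - intros n b _. induction n; simpl; [apply holo_const|]. apply holo_plus; [assumption|apply holo_lterm].
  - intros n b Hb. apply re_ball in Hb. apply Csum_Cmod_le; [|exact HS].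
    intros l'. apply Cmod_lterm_le. lra.
  - intros b _. apply lseries_cv. assumption.
Qed.

Lemma lseries_periodic x h k m n s : (0 < k)%nat -> lseries x h k (n * k + m) s = lseries x h k m s.
Proof.
  intros Hk. unfold lseries.
  assert (E : forall l', lterm x h k (n * k + m) l' s = lterm x h k m l' s).
  { intros l'. unfold lterm. rewrite Cpow_add_r, Nat.mul_comm, Cpow_mult_r, root_pow_k, Cpow_1_l by assumption.
    f_equal. f_equal. ring. }
  unfold CSeries. f_equal; apply Series_ext; intros l'; rewrite E; reflexivity.
Qed.

(** This is [(s - 1) Q(s)], an entire function. The classes are represented by [1, ..., k], so that
    the Hurwitz parameters [(i + 1) / k] are positive. *)
Definition Qnumerator (x : C) (h k : nat) (s : C) : C :=
  (rpow (INR k) (- s) * Csum (fun i => hurwitz (INR (S i) / INR k) s * lseries x h k (S i) s) k)%C.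

Definition Qcont (x : C) (h k : nat) (s : C) : C := (Qnumerator x h k s / (s - 1))%C.

Lemma class_pos k i : (0 < k)%nat -> 0 < INR (S i) / INR k.
Proof. intros Hk. apply Rdiv_lt_0_compat; [apply INR_S_pos|apply lt_0_INR; assumption]. Qed.

Lemma holo_Csum (f : nat -> C -> C) n s : (forall i, holo_at (f i) s) -> holo_at (fun s => Csum (fun i => f i s) n) s.
Proof. intros H. induction n; simpl; [apply holo_const|apply holo_plus; auto]. Qed.

Lemma holo_Qnumerator x h k s : Cmod x < 1 -> (0 < k)%nat -> holo_at (Qnumerator x h k) s.
Proof.
  intros Hx Hk. unfold Qnumerator. apply holo_mult; [apply holo_rpow, holo_opp, holo_id|].
  apply (holo_Csum (fun i s => hurwitz (INR (S i) / INR k) s * lseries x h k (S i) s)%C).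
  intros i. apply holo_mult; [apply holo_hurwitz, class_pos; assumption|apply holo_lseries; assumption].
Qed.

Lemma holo_Qcont x h k s : Cmod x < 1 -> (0 < k)%nat -> s <> RtoC 1 -> holo_at (Qcont x h k) s.
Proof.
  intros Hx Hk Hs. unfold Qcont. apply holo_div; [apply Cminus_eq_contra; assumption|apply holo_Qnumerator; assumption|].
  apply holo_minus; [apply holo_id|apply holo_const].
Qed.

Definition mterm (x : C) (h k m' : nat) (s : C) : C :=
  (rpow (INR (S m')) (- s) * lseries x h k (S m') s)%C.

Lemma mterm_bound x h k (c : R) : Cmod x < 1 -> 0 <= c -> exists K, 0 <= K /\ forall m' s, c <= Re s ->
  Cmod (mterm x h k m' s) <= K * exp (- c * ln (INR m' + 1)).
Proof.
  intros Hx Hc. destruct (lseries_bound x 0 Hx) as [K [HK B]]. exists K. split; [assumption|].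
  intros m' s Hs. unfold mterm. rewrite Cmod_mult, Cmod_rpow, re_opp, Rmult_comm.
  apply Rmult_le_compat; [apply Cmod_ge_0|left; apply exp_pos| |].
  - apply B. simpl. lra.
  - apply exp_le_compat. rewrite S_INR. assert (P := pos_INR m').
    assert (L := ln_le_compat 1 (INR m' + 1) ltac:(lra) ltac:(lra)). rewrite ln_1 in L. nra.
Qed.

(** Convergence comes first, from the majorant; the limit is then identified along partial sums of
    length [M k]. There [m = k (n + (i + 1) / k)] splits off [k^(-s)] and leaves a Hurwitz series
    for each class [i]. *)
Lemma Qcont_series x h k s : Cmod x < 1 -> (0 < k)%nat -> 1 < Re s ->
  Ccv (Csum (fun m' => mterm x h k m' s)) (Qcont x h k s).
Proof.
  intros Hx Hk Hs. assert (Pk : 0 < INR k) by (apply lt_0_INR; assumption).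
  destruct (mterm_bound x h k (Re s) Hx ltac:(lra)) as [K [HK B]].
  destruct (Csum_cv _ _ (fun m' => B m' s ltac:(lra)) (hurwitz_bound_series 1 (Re s) K ltac:(lra) Hs)) as [L HL].
  replace (Qcont x h k s) with L; [exact HL|].
  apply (Ccv_unique (fun M => Csum (fun m' => mterm x h k m' s) (M * k))); [apply Ccv_multiples; assumption|].
  apply (Ccv_ext (fun M => Csum (fun i => Csum (fun n => mterm x h k (n * k + i) s) M) k)).
  { intros M. symmetry. apply Csum_blocks. }
  assert (N1 : (s - 1)%C <> RtoC 0).
  { intros Q. apply (f_equal Re) in Q. rewrite re_minus in Q. simpl in Q. lra. }
  replace (Qcont x h k s) with (Csum (fun i => rpow (INR k) (- s) * lseries x h k (S i) s
     * hurwitz_series (INR (S i) / INR k) s)%C k).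
  2:{ unfold Qcont, Qnumerator.
      replace (rpow (INR k) (- s) * Csum (fun i => hurwitz (INR (S i) / INR k) s * lseries x h k (S i) s) k / (s - 1))%C
        with (rpow (INR k) (- s) / (s - 1) * Csum (fun i => hurwitz (INR (S i) / INR k) s * lseries x h k (S i) s) k)%C
        by (field; assumption).
      rewrite <- Csum_scal. apply Csum_ext. intros i _.
      rewrite hurwitz_eq_series by (try apply class_pos; assumption). field. assumption. }
  apply (Ccv_Csum (fun i M => Csum (fun n => mterm x h k (n * k + i) s) M)).
  intros i _.
  apply (Ccv_ext (fun M => rpow (INR k) (- s) * lseries x h k (S i) s
     * Csum (fun n => rpow (INR n + INR (S i) / INR k) (- s)) M)%C).
  - intros M. rewrite <- Csum_scal. apply Csum_ext. intros n _. unfold mterm.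
    replace (S (n * k + i)) with (n * k + S i)%nat by lia. rewrite lseries_periodic by assumption.
    replace (INR (n * k + S i)) with (INR k * (INR n + INR (S i) / INR k)).
    2:{ rewrite plus_INR, mult_INR. field. lra. }
    unfold rpow. rewrite ln_mult, RtoC_plus, Cmult_plus_distr_l, Cexp_plus.
    + ring.
    + assumption.
    + assert (A := class_pos k i Hk). generalize (pos_INR n). lra.
  - apply Ccv_scal. apply hurwitz_series_cv; [apply class_pos; assumption|assumption].
Qed.

Lemma root_pow h k l m : (root h k l ^ m)%C = e2pi (RtoC (INR l * INR m) * hk h k).
Proof. unfold root. rewrite <- e2pi_nat_mult. f_equal. rewrite RtoC_mult. ring. Qed.

Lemma CSeries_ext (u v : nat -> C) : (forall n, u n = v n) -> CSeries u = CSeries v.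
Proof. intros E. unfold CSeries. f_equal; apply Series_ext; intros n; rewrite E; reflexivity. Qed.

Lemma Qseries_inner x h k m' s : Cmod x < 1 ->
  CSeries (fun l' => x ^ S l' * e2pi (RtoC (INR (S l') * INR (S m')) * hk h k) / RtoC (INR (S l'))
     * Cpower (RtoC (INR (S l') * INR (S m'))) (- s))%C = mterm x h k m' s.
Proof.
  intros Hx. apply Ccv_CSeries.
  apply (Ccv_ext (fun n => rpow (INR (S m')) (- s) * Csum (fun l' => lterm x h k (S m') l' s) n)%C).
  - intros n. rewrite <- Csum_scal. apply Csum_ext. intros l' _. unfold lterm.
    assert (P1 := INR_S_pos l'). assert (P2 := INR_S_pos m').
    rewrite root_pow, Cpower_R_pos by (apply Rmult_lt_0_compat; assumption).
    rewrite ln_mult, RtoC_plus, Cmult_plus_distr_l, Cexp_plus by assumption. unfold rpow. ring.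
  - apply Ccv_scal, lseries_cv. assumption.
Qed.

Lemma Qcont_is_continuation x h k : Cmod x < 1 -> (0 < k)%nat -> is_continuation x h k (Qcont x h k).
Proof.
  intros Hx Hk. split.
  - intros s Hs. eexists. apply holo_at_is_derive, holo_Qcont; assumption.
  - intros s Hs. symmetry. unfold Qseries.
    rewrite (CSeries_ext _ (fun m' => mterm x h k m' s)).
    + apply Ccv_CSeries, Qcont_series; assumption.
    + intros m'. apply Qseries_inner. assumption.
Qed.

(** * The residues at 0 and 1 *)

Lemma Cpow_mult_nat (x : C) (k n : nat) : ((x ^ k) ^ n)%C = (x ^ (n * k))%C.
Proof. rewrite Nat.mul_comm. symmetry. apply Cpow_mult_r. Qed.

(** The finite sum over the classes is moved inside the series over [l], where it becomes a sum over
    powers of one root of unity that can be evaluated in closed form. *)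
Lemma lseries_combination x h k (c : nat -> C) s : Cmod x < 1 ->
  Ccv (Csum (fun l' => x ^ S l' / RtoC (INR (S l')) * rpow (INR (S l')) (- s)
     * Csum (fun i => c i * root h k (S l') ^ S i) k)%C)
   (Csum (fun i => c i * lseries x h k (S i) s)%C k).
Proof.
  intros Hx.
  apply (Ccv_ext (fun n => Csum (fun i => c i * Csum (fun l' => lterm x h k (S i) l' s) n)%C k)).
  - intros n. 
    rewrite (Csum_ext _ (fun i => Csum (fun l' => c i * lterm x h k (S i) l' s)%C n)).
    2:{ intros; symmetry; apply Csum_scal. }
    rewrite <- Csum_swap. apply Csum_ext. intros l' _. rewrite <- Csum_scal. apply Csum_ext. intros i _.
    unfold lterm. unfold Cdiv. ring.
  - apply (Ccv_Csum (fun i n => c i * Csum (fun l' => lterm x h k (S i) l' s) n)%C).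
    intros i _. apply Ccv_scal, lseries_cv. assumption.
Qed.

Lemma Csum_const (c : C) n : Csum (fun _ => c) n = (RtoC (INR n) * c)%C.
Proof. induction n; [simpl; ring|]. cbn [Csum]. rewrite IHn, S_INR, RtoC_plus. ring. Qed.

Lemma Cpow_Cmod_lt_1 (x : C) k : Cmod x < 1 -> (0 < k)%nat -> Cmod (x ^ k)%C < 1.
Proof.
  intros Hx Hk. rewrite Cmod_Cpow. destruct k; [lia|]. simpl.
  assert (P := Cmod_ge_0 x). assert (A : Cmod x ^ k <= 1) by (rewrite <- (pow1 k); apply pow_incr; lra).
  assert (B : 0 <= Cmod x ^ k) by (apply pow_le; assumption). nra.
Qed.

Lemma Li2_cv y : Cmod y < 1 -> Ccv (Csum (fun n => y ^ S n / RtoC (INR (S n) ^ 2))%C) (Li2 y).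
Proof.
  intros Hy.
  destruct (Csum_cv (fun n => y ^ S n / RtoC (INR (S n) ^ 2))%C (fun n => Cmod y ^ S n * INR (S n) ^ 0)) as [l Hl].
  - intros n. assert (P := INR_S_ge_1 n).
    rewrite Cmod_div, Cmod_Cpow, Cmod_R, Rabs_pos_eq.
    + apply Rmult_le_compat_l; [apply pow_le, Cmod_ge_0|]. apply Rle_trans with (/ 1); [apply Rinv_le_contravar; nra|].
      rewrite Rinv_1. simpl. lra.
    + nra.
    + intros Q. apply RtoC_inj in Q. nra.
  - apply ex_series_geom_poly. split; [apply Cmod_ge_0|assumption].
  - unfold Li2. rewrite (Ccv_CSeries _ _ Hl). exact Hl.
Qed.

(** At [s = 1] all the Hurwitz factors are [1], so the inner sum is [k] if [k] divides [l] and [0]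
    otherwise. With [l = k n] the terms become [x^(k n) / (k n)^2 * k], and the prefactor [k^(-s)]
    supplies the second power of [1 / k]. *)
Lemma Qnumerator_1 x h k : Cmod x < 1 -> (0 < k)%nat -> Nat.gcd h k = 1%nat ->
  Qnumerator x h k 1 = (Li2 (x ^ k) / RtoC (INR k ^ 2))%C.
Proof.
  intros Hx Hk Hg. assert (Pk : 0 < INR k) by (apply lt_0_INR; assumption).
  assert (Nk : RtoC (INR k) <> RtoC 0) by (intros Q; apply RtoC_inj in Q; lra).
  unfold Qnumerator.
  assert (E : Csum (fun i => hurwitz (INR (S i) / INR k) 1 * lseries x h k (S i) 1)%C k = (Li2 (x ^ k) / RtoC (INR k))%C).
  { rewrite (Csum_ext _ (fun i => 1 * lseries x h k (S i) 1)%C).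
    2:{ intros i _. rewrite hurwitz_1 by (apply class_pos; assumption). reflexivity. }
    assert (L := lseries_combination x h k (fun _ => RtoC 1) 1 Hx).
    eapply (Ccv_multiples_only _ (fun l => x ^ l / RtoC (INR l ^ 2) * RtoC (INR k))%C _ _ k Hk); [|exact L|].
    - intros n. cbv beta. assert (R := root_eq_1 h k (S n) Hk Hg).
      assert (Nn := RtoC_INR_S_neq_0 n). assert (Pn := INR_S_pos n).
      destruct (S n mod k =? 0)%nat.
      + rewrite R. rewrite (Csum_ext _ (fun _ => RtoC 1)) by (intros; rewrite Cpow_1_l; ring).
        rewrite Csum_const. unfold rpow. replace (- (1) * ln (INR (S n)))%C with (- RtoC (ln (INR (S n))))%C by ring.
        rewrite Cexp_opp, Cexp_R, exp_ln by assumption. rewrite RtoC_pow. field. assumption.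
      + rewrite (Csum_ext _ (fun i => root h k (S n) ^ S i)%C) by (intros; ring).
        rewrite (root_sum _ k (root_pow_k h k (S n) Hk) R). ring.
    - apply (Ccv_ext (fun n => / RtoC (INR k) * Csum (fun n => (x ^ k) ^ S n / RtoC (INR (S n) ^ 2)) n)%C).
      + intros n. rewrite <- Csum_scal. apply Csum_ext. intros i _.
        assert (Nn := RtoC_INR_S_neq_0 i).
        rewrite Cpow_mult_nat, mult_INR, !RtoC_pow, RtoC_mult. field. split; assumption.
      + eapply Ccv_eq; [apply Ccv_scal, Li2_cv, Cpow_Cmod_lt_1; assumption|]. field. assumption. }
  rewrite E. unfold rpow. replace (- (1) * ln (INR k))%C with (- RtoC (ln (INR k)))%C by ring.
  rewrite Cexp_opp, Cexp_R, exp_ln by assumption. rewrite RtoC_pow. field. assumption.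
Qed.

(** This is [Q(0) = w], with the sign of the factor [s - 1] at [s = 0]. *)
Lemma Qnumerator_0 x h k : Cmod x < 1 -> (0 < k)%nat -> Nat.gcd h k = 1%nat ->
  Qnumerator x h k 0 = (- w x h k)%C.
Proof.
  intros Hx Hk Hg. assert (Pk : 0 < INR k) by (apply lt_0_INR; assumption).
  assert (Nk : RtoC (INR k) <> RtoC 0) by (intros Q; apply RtoC_inj in Q; lra).
  unfold Qnumerator. replace (- (RtoC 0))%C with (RtoC 0) by ring. rewrite rpow_0, Cmult_1_l.
  rewrite (Csum_ext _ (fun i => RtoC (INR (S i) / INR k - 1 / 2) * lseries x h k (S i) 0)%C).
  2:{ intros i _. rewrite hurwitz_0 by (apply class_pos; assumption). reflexivity. }
  set (T := Csum (fun i => RtoC (INR (S i) / INR k - 1 / 2) * lseries x h k (S i) 0)%C k).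
  assert (L := lseries_combination x h k (fun i => RtoC (INR (S i) / INR k - 1 / 2)) 0 Hx). cbv beta in L. fold T in L.
  (* the terms with [k] dividing [l] give the logarithm, the others the series in [w] *)
  set (v := fun l => (x ^ l / RtoC (INR l) * RtoC (1 / 2))%C).
  set (A := fun n => if (S n mod k =? 0)%nat then v (S n) else RtoC 0).
  set (B := fun l' => if (S l' mod k =? 0)%nat then RtoC 0
     else (x ^ S l' / RtoC (INR (S l')) * (RtoC 1 / (e2pi (- (RtoC (INR (S l')) * hk h k)) - RtoC 1)))%C).
  assert (LA : exists a, Ccv (Csum A) a).
  { apply (Csum_cv A (fun n => Cmod x ^ S n * INR (S n) ^ 0)).
    - intros n. assert (P := INR_S_ge_1 n). assert (Px : 0 <= Cmod x ^ S n) by (apply pow_le, Cmod_ge_0).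
      unfold A. destruct (S n mod k =? 0)%nat.
      + unfold v. rewrite Cmod_mult, Cmod_div, Cmod_Cpow, !Cmod_R by apply RtoC_INR_S_neq_0.
        rewrite !Rabs_pos_eq by lra. replace (INR (S n) ^ 0) with 1 by reflexivity.
        unfold Rdiv. assert (/ INR (S n) <= 1) by (rewrite <- Rinv_1; apply Rinv_le_contravar; lra).
        assert (0 < / INR (S n)) by (apply Rinv_0_lt_compat; lra). nra.
      + rewrite Cmod_0. simpl. rewrite Rmult_1_r. exact Px.
    - apply ex_series_geom_poly. split; [apply Cmod_ge_0|assumption]. }
  destruct LA as [a LA].
  assert (Ea : a = (RtoC (/ (2 * INR k)) * - Clog (1 - x ^ k))%C).
  { eapply (Ccv_multiples_only A v _ _ k Hk); [reflexivity|exact LA|].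
    apply (Ccv_ext (fun n => RtoC (/ (2 * INR k)) * Csum (fun n => (x ^ k) ^ S n / RtoC (INR (S n))) n)%C).
    - intros n. rewrite <- Csum_scal. apply Csum_ext. intros i _. unfold v.
      assert (Nn := RtoC_INR_S_neq_0 i).
      rewrite Cpow_mult_nat, mult_INR, RtoC_mult.
      replace (/ (2 * INR k)) with (1 / 2 * / INR k) by (field; lra).
      rewrite RtoC_mult, (RtoC_inv (INR k)) by lra. field. split; assumption.
    - apply Ccv_scal, Clog_series, Cpow_Cmod_lt_1; assumption. }
  assert (LB : Ccv (Csum B) (- (T - a))).
  { apply (Ccv_ext (fun n => - (1) * (Csum (fun l' => x ^ S l' / RtoC (INR (S l')) * rpow (INR (S l')) (- 0)
      * Csum (fun i => RtoC (INR (S i) / INR k - 1 / 2) * root h k (S l') ^ S i) k) n - Csum A n))%C).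
    - intros n. replace (Csum A n) with (- (1) * Csum (fun n => - (1) * A n) n)%C by (rewrite Csum_scal; ring).
      match goal with |- (?m * (?X - ?m * ?Y))%C = _ => replace (m * (X - m * Y))%C with (- (1) * (X + Y))%C by ring end.
      rewrite <- Csum_plus, <- Csum_scal. apply Csum_ext. intros l' _. unfold A, B, v.
      replace (- (RtoC 0))%C with (RtoC 0) by ring. rewrite rpow_0.
      assert (R := root_eq_1 h k (S l') Hk Hg). assert (Nn := RtoC_INR_S_neq_0 l').
      destruct (S l' mod k =? 0)%nat.
      + rewrite R. replace (Csum (fun i => RtoC (INR (S i) / INR k - 1 / 2) * 1 ^ S i)%C k) with (RtoC (1 / 2)).
        * field. assumption.
        (* The weights add up to [1 / 2] over a full set of classes. The upper limit is freed from
           [k] for the induction. *)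
        * assert (G : forall n, Csum (fun i => RtoC (INR (S i) / INR k - 1 / 2) * 1 ^ S i)%C n =
             RtoC (INR n * (INR n + 1) / 2 / INR k - INR n / 2)).
          { induction n0; [simpl; f_equal; field; lra|].
            cbn [Csum]. rewrite IHn0, Cpow_1_l, Cmult_1_r, <- RtoC_plus, !S_INR. f_equal. field. lra. }
          rewrite G. f_equal. field. lra.
      + rewrite (root_sum_weighted _ k Hk (root_pow_k h k (S l') Hk) R).
        rewrite e2pi_opp. fold (root h k (S l')).
        assert (N0 : root h k (S l') <> RtoC 0) by (apply Cmod_gt_0; rewrite Cmod_root; lra).
        assert (N1 : (/ root h k (S l') - 1)%C <> RtoC 0).
        { intros Q. apply R. apply Ceq_minus in Q.
          transitivity (/ root h k (S l') * root h k (S l'))%C; [rewrite Q; ring|apply Cinv_l; assumption]. }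
        unfold Cdiv. ring.
    - eapply Ccv_eq; [apply Ccv_scal, Ccv_minus; [exact L|exact LA]|]. ring. }
  unfold w. fold B. 
  change (CSeries _) with (CSeries B). rewrite (Ccv_CSeries _ _ LB), Ea. ring.
Qed.

(** * The Mellin-Barnes integral of [log P] *)

Definition poly_growth (c0 c1 : R) (f : C -> C) : Prop :=
  exists K m, 0 <= K /\ forall s, c0 <= Re s <= c1 -> Cmod (f s) <= K * (1 + Cmod s) ^ m.

Lemma poly_growth_bounded c0 c1 f K :
  (forall s, c0 <= Re s <= c1 -> Cmod (f s) <= K) -> poly_growth c0 c1 f.
Proof.
  intros H. exists (Rabs K), O. split; [apply Rabs_pos|]. intros s Hs. simpl. rewrite Rmult_1_r.
  eapply Rle_trans; [apply H; assumption|apply Rle_abs].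
Qed.

Lemma poly_growth_mult c0 c1 f g : poly_growth c0 c1 f -> poly_growth c0 c1 g ->
  poly_growth c0 c1 (fun s => f s * g s)%C.
Proof.
  intros (K1 & m1 & H1 & F) (K2 & m2 & H2 & G). exists (K1 * K2), (m1 + m2)%nat.
  split; [apply Rmult_le_pos; assumption|]. intros s Hs. rewrite Cmod_mult, pow_add.
  replace (K1 * K2 * ((1 + Cmod s) ^ m1 * (1 + Cmod s) ^ m2)) with
    ((K1 * (1 + Cmod s) ^ m1) * (K2 * (1 + Cmod s) ^ m2)) by ring.
  apply Rmult_le_compat; try apply Cmod_ge_0; auto.
Qed.

Lemma poly_growth_plus c0 c1 f g : poly_growth c0 c1 f -> poly_growth c0 c1 g ->
  poly_growth c0 c1 (fun s => f s + g s)%C.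
Proof.
  intros (K1 & m1 & H1 & F) (K2 & m2 & H2 & G). exists (K1 + K2), (m1 + m2)%nat.
  split; [lra|]. intros s Hs. assert (P := Cmod_ge_0 s).
  eapply Rle_trans; [apply Cmod_triangle|]. rewrite Rmult_plus_distr_r. apply Rplus_le_compat.
  - eapply Rle_trans; [apply F; assumption|]. apply Rmult_le_compat_l; [assumption|]. apply Rle_pow; [lra|lia].
  - eapply Rle_trans; [apply G; assumption|]. apply Rmult_le_compat_l; [assumption|]. apply Rle_pow; [lra|lia].
Qed.

Lemma poly_growth_Csum c0 c1 (f : nat -> C -> C) n : (forall i, poly_growth c0 c1 (f i)) ->
  poly_growth c0 c1 (fun s => Csum (fun i => f i s) n).
Proof.
  intros H. induction n; simpl.
  - apply poly_growth_bounded with 0. intros. rewrite Cmod_0. lra.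
  - apply poly_growth_plus; auto.
Qed.

Lemma Qnumerator_growth x h k (X : nat) (c1 : R) : Cmod x < 1 -> (0 < k)%nat ->
  poly_growth (- INR X) c1 (Qnumerator x h k).
Proof.
  intros Hx Hk. assert (Pk : 0 < INR k) by (apply lt_0_INR; assumption).
  apply poly_growth_mult.
  - apply poly_growth_bounded with (exp ((INR X + Rabs c1) * (Rabs (ln (INR k)) + Rabs (ln (INR k))))).
    intros s Hs. apply rpow_bound; [assumption|lra|]. rewrite re_opp, Rabs_Ropp.
    assert (A := Rle_abs c1). assert (B := Rabs_pos c1). assert (P := pos_INR X). apply Rabs_le. lra.
  - apply (poly_growth_Csum _ _ (fun i s => hurwitz (INR (S i) / INR k) s * lseries x h k (S i) s)%C).
    intros i. apply poly_growth_mult.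
    + destruct (hurwitz_poly_bound (- INR X) c1 (INR (S i) / INR k) (class_pos k i Hk)) as (K & m & HK & B).
      exists K, m. split; assumption.
    + destruct (lseries_bound x X Hx) as [K [HK B]]. apply poly_growth_bounded with K.
      intros s Hs. apply B. lra.
Qed.

(** The Mellin integrand times [s (s - 1)]: the factor [s] turns [Gamma(s)] into [Gamma(s + 1)], and
    [s - 1] turns [Q] into its numerator. *)
Definition mellin_numerator (x : C) (h k : nat) (L s : C) : C :=
  (Qnumerator x h k s * (CGamma (s + 1) * Cexp (- (s * L))))%C.

Lemma holo_Gamma_exp L s : 0 < Re s -> holo_at (fun s => CGamma s * Cexp (- (s * L)))%C s.
Proof.
  intros Hs. apply holo_mult; [apply holo_CGamma; assumption|].
  apply holo_Cexp_comp, holo_opp, holo_mult; [apply holo_id|apply holo_const].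
Qed.

Lemma holo_mellin_numerator x h k L s : Cmod x < 1 -> (0 < k)%nat -> -1 < Re s ->
  holo_at (mellin_numerator x h k L) s.
Proof.
  intros Hx Hk Hs. unfold mellin_numerator. apply holo_mult; [apply holo_Qnumerator; assumption|].
  apply holo_mult.
  - apply (holo_comp CGamma (fun s => s + 1)%C).
    + apply holo_plus; [apply holo_id|apply holo_const].
    + apply holo_CGamma. rewrite re_plus, re_RtoC. lra.
  - apply holo_Cexp_comp, holo_opp, holo_mult; [apply holo_id|apply holo_const].
Qed.

Lemma mellin_numerator_bound x h k L : Cmod x < 1 -> (0 < k)%nat -> Rabs (Im L) < PI / 2 ->
  exists K, 0 <= K /\ forall y t, - (3 / 4) <= y <= 3 / 2 ->
    Cmod (mellin_numerator x h k L (vline y t)) <= K * / (1 + t ^ 2).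
Proof.
  intros Hx Hk HL.
  destruct (Qnumerator_growth x h k 1 (3 / 2) Hx Hk) as (K1 & m & HK1 & B1).
  (* The ends [1/4] and [5/2] are those of the strip moved by one, as Gamma is taken at [s + 1];
     [3/2] bounds the modulus of the abscissa itself. *)
  destruct (CGamma_Cexp_decay (1 / 4) (5 / 2) (3 / 2) L m) as [K2 [HK2 B2]]; [lra|assumption|].
  exists (K1 * 4 ^ m * K2). split.
  { repeat apply Rmult_le_pos; try assumption. apply pow_le; lra. }
  intros y t Hy. unfold mellin_numerator. rewrite !Cmod_mult, vline_plus_R.
  specialize (B1 (vline y t) ltac:(rewrite Re_vline; simpl; lra)).
  specialize (B2 (y + 1) y t ltac:(lra) ltac:(apply Rabs_le; lra)).
  assert (Bs : 1 + Cmod (vline y t) <= 4 * (1 + t ^ 2)).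
  { assert (A := Cmod_le_parts (vline y t)). rewrite Re_vline, Im_vline in A.
    assert (Rabs y <= 3 / 2) by (apply Rabs_le; lra). rewrite <- (pow2_abs t). assert (P := Rabs_pos t). nra. }
  set (E := Cmod (CGamma (vline (y + 1) t)) * Cmod (Cexp (- (vline y t * L)))) in *.
  assert (PE : 0 <= E) by (apply Rmult_le_pos; apply Cmod_ge_0).
  apply Rle_trans with (K1 * (4 * (1 + t ^ 2)) ^ m * E).
  - apply Rmult_le_compat_r; [assumption|]. eapply Rle_trans; [apply B1|].
    apply Rmult_le_compat_l; [assumption|]. apply pow_incr. generalize (Cmod_ge_0 (vline y t)). lra.
  - rewrite Rpow_mult_distr.
    replace (K1 * (4 ^ m * (1 + t ^ 2) ^ m) * E) with (K1 * 4 ^ m * ((1 + t ^ 2) ^ m * E)) by ring.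
    rewrite (Rmult_assoc (K1 * 4 ^ m)). apply Rmult_le_compat_l; [|exact B2].
    apply Rmult_le_pos; [assumption|apply pow_le; lra].
Qed.

Definition mellin_integrand (x : C) (h k : nat) (L s : C) : C :=
  (Qcont x h k s * (CGamma s * Cexp (- (s * L))))%C.

(** By [1 / (s (s - 1)) = 1 / (s - 1) - 1 / s], each piece has a single pole and fits
    [residue_shift]. *)
Lemma mellin_integrand_eq x h k L s : -1 < Re s -> s <> RtoC 0 -> s <> RtoC 1 ->
  mellin_integrand x h k L s =
  (mellin_numerator x h k L s / (s - RtoC 1) - mellin_numerator x h k L s / (s - RtoC 0))%C.
Proof.
  intros Hs N0 N1. assert (N1' := Cminus_eq_contra _ _ N1).
  unfold mellin_integrand, mellin_numerator, Qcont. rewrite CGamma_shift by assumption.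
  field. split; assumption || (intros Q; apply N0; rewrite <- Q; ring).
Qed.

Lemma mellin_integrand_dominated x h k L y : Cmod x < 1 -> (0 < k)%nat -> Rabs (Im L) < PI / 2 ->
  - (3 / 4) <= y <= 3 / 2 -> y <> 0 -> y <> 1 ->
  exists K, dominated (fun t => mellin_integrand x h k L (vline y t)) K.
Proof.
  intros Hx Hk HL Hy N0 N1.
  destruct (mellin_numerator_bound x h k L Hx Hk HL) as [K [HK B]].
  assert (P0 : 0 < Rabs y) by (apply Rabs_pos_lt; assumption).
  assert (P1 : 0 < Rabs (y - 1)) by (apply Rabs_pos_lt; lra).
  assert (Z0 : forall t, vline y t <> RtoC 0) by (intros; apply vline_neq_0; assumption).
  assert (Z1 : forall t, vline y t <> RtoC 1).
  { intros t Q. apply (f_equal Re) in Q. rewrite Re_vline in Q. simpl in Q. contradiction. }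
  assert (Lb : forall t p, y <> p -> Rabs (y - p) <= Cmod (vline y t - RtoC p)).
  { intros t p _. eapply Rle_trans; [|apply re_le_Cmod]. rewrite re_minus, Re_vline, re_RtoC. lra. }
  exists (K * / Rabs (y - 1) + K * / Rabs y). split.
  - intros t. 
    apply (rcont_ext (fun t => mellin_numerator x h k L (vline y t) / (vline y t - RtoC 1)
      - mellin_numerator x h k L (vline y t) / (vline y t - RtoC 0))%C).
    { intros u. symmetry. apply mellin_integrand_eq; auto. rewrite Re_vline. lra. }
    apply (rcont_holo_vline (fun s => mellin_numerator x h k L s / (s - RtoC 1)
      - mellin_numerator x h k L s / (s - RtoC 0))%C).
    assert (HN : holo_at (mellin_numerator x h k L) (vline y t)).
    { apply holo_mellin_numerator; try assumption. rewrite Re_vline. lra. }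
    apply holo_minus; apply holo_div; try assumption; try (apply Cminus_eq_contra; auto);
    (apply holo_minus; [apply holo_id|apply holo_const]).
  - intros t. rewrite mellin_integrand_eq by (try rewrite Re_vline; auto; lra).
    eapply Rle_trans; [apply Cmod_triangle_minus|]. rewrite Rmult_plus_distr_r.
    assert (W : forall p, y <> p -> Cmod (mellin_numerator x h k L (vline y t) / (vline y t - RtoC p))
      <= K * / Rabs (y - p) * / (1 + t ^ 2)).
    { intros p Hp. assert (Pp : 0 < Rabs (y - p)) by (apply Rabs_pos_lt; lra).
      assert (Lp := Lb t p Hp). rewrite Cmod_div by (apply Cmod_gt_0; lra).
      rewrite Rmult_assoc, (Rmult_comm (/ Rabs _)), <- Rmult_assoc.
      apply Rmult_le_compat; [apply Cmod_ge_0|left; apply Rinv_0_lt_compat; lra|apply B; assumption|].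
      apply Rinv_le_contravar; assumption. }
    apply Rplus_le_compat; [apply W; assumption|].
    replace (Rabs y) with (Rabs (y - 0)) by (f_equal; ring). apply W. assumption.
Qed.

Lemma mellin_shift x h k L v3 v4 : Cmod x < 1 -> (0 < k)%nat -> Rabs (Im L) < PI / 2 ->
  pvint (fun t => mellin_integrand x h k L (vline (3 / 2) t)) v3 ->
  pvint (fun t => mellin_integrand x h k L (vline (- (3 / 4)) t)) v4 ->
  (v3 - v4 = RtoC (2 * PI) * (mellin_numerator x h k L 1 - mellin_numerator x h k L 0))%C.
Proof.
  intros Hx Hk HL H3 H4.
  destruct (mellin_numerator_bound x h k L Hx Hk HL) as [K [HK B]].
  set (N := mellin_numerator x h k L) in *.
  assert (HN : forall s, - (3 / 4) - 1 / 8 < Re s < 3 / 2 + 1 / 8 -> holo_at N s).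
  { intros s Hs. apply holo_mellin_numerator; try assumption. lra. }
  assert (HB : forall y t, - (3 / 4) <= y <= 3 / 2 -> Cmod (N (vline y t)) <= K).
  { intros y t Hy. eapply Rle_trans; [apply B; assumption|]. rewrite <- (Rmult_1_r K) at 2.
    apply Rmult_le_compat_l; [assumption|]. rewrite <- Rinv_1. apply Rinv_le_contravar; [lra|].
    generalize (pow2_ge_0 t). lra. }
  assert (R1 := residue_shift N (- (3 / 4)) (3 / 2) (1 / 8) 1 K ltac:(lra) ltac:(lra) HN HB).
  assert (R0 := residue_shift N (- (3 / 4)) (3 / 2) (1 / 8) 0 K ltac:(lra) ltac:(lra) HN HB).
  assert (I : forall y p n, - (3 / 4) <= y <= 3 / 2 -> y <> p ->
    cint (fun t => N (vline y t) / (vline y t - RtoC p))%C (- INR n) (INR n)).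
  { intros y p n Hy Hp. apply cint_rcont_all. intros t. apply (rcont_holo_vline (fun s => N s / (s - RtoC p))%C).
    apply holo_div; [|apply HN; rewrite Re_vline; lra|apply holo_minus; [apply holo_id|apply holo_const]].
    apply Cminus_eq_contra. intros Q. apply (f_equal Re) in Q. rewrite Re_vline, re_RtoC in Q. contradiction. }
  assert (D : forall y n, - (3 / 4) <= y <= 3 / 2 -> y <> 0 -> y <> 1 ->
    CInt (fun t => mellin_integrand x h k L (vline y t)) (- INR n) (INR n) =
    (CInt (fun t => N (vline y t) / (vline y t - RtoC 1)) (- INR n) (INR n)
     - CInt (fun t => N (vline y t) / (vline y t - RtoC 0)) (- INR n) (INR n))%C).
  { intros y n Hy N0 N1. rewrite <- CInt_minus by (apply I; assumption).
    apply CInt_ext. intros t _. apply mellin_integrand_eq.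
    - rewrite Re_vline. lra.
    - apply vline_neq_0. assumption.
    - intros Q. apply (f_equal Re) in Q. rewrite Re_vline in Q. simpl in Q. contradiction. }
  assert (E := Ccv_minus _ _ _ _ R1 R0). assert (F := Ccv_minus _ _ _ _ H3 H4).
  rewrite (Ccv_unique _ _ (RtoC (2 * PI) * N (RtoC 1) - RtoC (2 * PI) * N (RtoC 0))%C F); [ring|].
  refine (Ccv_ext _ _ _ _ E). intros n. cbv beta. rewrite !D by lra. ring.
Qed.

(* Termwise integration of the double series on the line [Re s = 3/2], by the
   Cahen-Mellin formula with [L + ln (l m)] in place of [L]. *)
Lemma mellin_line_value x h k L v3 : Cmod x < 1 -> (0 < k)%nat -> Rabs (Im L) < PI / 2 ->
  0 < Re (Cexp L) ->
  pvint (fun t => mellin_integrand x h k L (vline (3 / 2) t)) v3 ->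
  Ccv (Csum (fun m' => RtoC (2 * PI) * - Clog (1 - x * (e2pi (hk h k) * Cexp (- Cexp L)) ^ S m'))%C) v3.
Proof.
  intros Hx Hk HL HRe H3.
  set (G := fun s => (CGamma s * Cexp (- (s * L)))%C).
  destruct (CGamma_Cexp_decay (3 / 2) (3 / 2) (3 / 2) L 0) as [K [HK B]]; [lra|assumption|].
  assert (BG : forall t, Cmod (G (vline (3 / 2) t)) <= K * / (1 + t ^ 2)).
  { intros t. specialize (B (3 / 2) (3 / 2) t ltac:(lra) ltac:(rewrite Rabs_pos_eq; lra)).
    simpl pow in B at 1. rewrite Rmult_1_l in B. unfold G. rewrite Cmod_mult. exact B. }
  assert (HG : forall t, holo_at G (vline (3 / 2) t)).
  { intros t. apply holo_Gamma_exp. rewrite Re_vline. lra. }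
  set (u := (e2pi (hk h k) * Cexp (- Cexp L))%C).
  assert (Hu : Cmod u < 1).
  { unfold u. rewrite Cmod_mult, Cmod_Cexp, re_opp. unfold hk. rewrite Cmod_e2pi_R, Rmult_1_l, <- exp_0.
    apply exp_increasing. lra. }
  assert (Hxu : forall m, Cmod (x * u ^ S m) < 1).
  { intros m. rewrite Cmod_mult. assert (A := Cpow_Cmod_lt_1 u (S m) Hu ltac:(lia)).
    assert (P := Cmod_ge_0 x). assert (P2 := Cmod_ge_0 (u ^ S m)). nra. }
  destruct (mterm_bound x h k (3 / 2) Hx ltac:(lra)) as [K1 [HK1 B1]].
  assert (Hmt : forall m' s, holo_at (mterm x h k m') s).
  { intros m' s. unfold mterm. apply holo_mult; [apply holo_rpow, holo_opp, holo_id|apply holo_lseries; assumption]. }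
  assert (HP : forall t, 0 < / (1 + t ^ 2)).
  { intros t. apply Rinv_0_lt_compat. generalize (pow2_ge_0 t). lra. }
  (* Interchange of the integral with the outer sum: on this line the term for [m] is of order
     [m^(-3/2)]. *)
  apply (pvint_series (fun m' t => mterm x h k m' (vline (3 / 2) t) * G (vline (3 / 2) t))%C
    (fun t => mellin_integrand x h k L (vline (3 / 2) t))
    (fun m' => K1 * exp (- (3 / 2) * ln (INR m' + 1))) K).
  - intros m' t. apply (rcont_holo_vline (fun s => mterm x h k m' s * G s)%C).
    apply holo_mult; [apply Hmt|apply HG].
  - intros t. destruct (mellin_integrand_dominated x h k L (3 / 2) Hx Hk HL ltac:(lra) ltac:(lra) ltac:(lra)) as [? [A _]].
    apply A.
  - intros m' t. rewrite Cmod_mult. apply Rmult_le_compat; try apply Cmod_ge_0; [|apply BG].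
    apply B1. rewrite Re_vline. lra.
  - intros m'. apply Rmult_le_pos; [assumption|left; apply exp_pos].
  - apply hurwitz_bound_series; lra.
  - assumption.
  - intros t. unfold mellin_integrand. fold (G (vline (3 / 2) t)).
    apply (Ccv_ext (fun n => Csum (fun m' => mterm x h k m' (vline (3 / 2) t)) n * G (vline (3 / 2) t))%C).
    { intros n. rewrite Cmult_comm, <- Csum_scal. apply Csum_ext. intros; ring. }
    apply Ccv_mult; [|apply Ccv_const]. apply Qcont_series; [assumption..|rewrite Re_vline; lra].
  - intros m'.
    set (Fm := fun t => (mterm x h k m' (vline (3 / 2) t) * G (vline (3 / 2) t))%C).
    assert (Pm := INR_S_ge_1 m'). assert (Lm : 0 <= ln (INR (S m'))) by (rewrite <- ln_1; apply ln_le_compat; lra).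
    assert (DF : dominated Fm (K1 * K)).
    { split.
      - intros t. unfold Fm. apply (rcont_holo_vline (fun s => mterm x h k m' s * G s)%C). apply holo_mult; [apply Hmt|apply HG].
      - intros t. unfold Fm. rewrite Cmod_mult, Rmult_assoc. apply Rmult_le_compat; try apply Cmod_ge_0; [|apply BG].
        eapply Rle_trans; [apply B1; rewrite Re_vline; lra|]. rewrite <- (Rmult_1_r K1) at 2.
        apply Rmult_le_compat_l; [assumption|].
        apply Rle_trans with (exp 0); [|rewrite exp_0; lra]. apply exp_le_compat.
        rewrite S_INR in Lm. lra. }
    destruct (dominated_pvint _ _ DF) as [V HV].
    (* Interchange with the inner sum over [l], which is dominated geometrically by [|x|^l]. *)
    assert (Ser : Ccv (Csum (fun l' => RtoC (2 * PI) * ((x * u ^ S m') ^ S l' / RtoC (INR (S l'))))%C) V).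
    { apply (pvint_series (fun l' t => rpow (INR (S m')) (- vline (3 / 2) t) * lterm x h k (S m') l' (vline (3 / 2) t)
          * G (vline (3 / 2) t))%C Fm (fun l' => Cmod x ^ S l' * INR (S l') ^ 0) K).
      - intros l' t.
        apply (rcont_holo_vline (fun s => rpow (INR (S m')) (- s) * lterm x h k (S m') l' s * G s)%C).
        apply holo_mult; [|apply HG]. apply holo_mult; [apply holo_rpow, holo_opp, holo_id|apply holo_lterm].
      - apply DF.
      - intros l' t. rewrite !Cmod_mult. apply Rmult_le_compat; [|apply Cmod_ge_0| |apply BG].
        + apply Rmult_le_pos; apply Cmod_ge_0.
        + rewrite <- (Rmult_1_l (Cmod x ^ S l' * _)). apply Rmult_le_compat; try apply Cmod_ge_0.
          * rewrite Cmod_rpow, <- exp_0. apply exp_le_compat. rewrite re_opp, Re_vline. nra.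
          * apply Cmod_lterm_le. rewrite Re_vline. simpl. lra.
      - intros l'. apply Rmult_le_pos; apply pow_le; [apply Cmod_ge_0|apply pos_INR].
      - apply ex_series_geom_poly. split; [apply Cmod_ge_0|assumption].
      - assumption.
      - intros t. unfold Fm, mterm.
        apply (Ccv_ext (fun n => rpow (INR (S m')) (- vline (3 / 2) t) * Csum (fun l' => lterm x h k (S m') l' (vline (3 / 2) t)) n
           * G (vline (3 / 2) t))%C).
        { intros n. rewrite <- Csum_scal, Cmult_comm, <- Csum_scal. apply Csum_ext. intros; ring. }
        apply Ccv_mult; [|apply Ccv_const]. apply Ccv_scal, lseries_cv. assumption.
      - intros l'. assert (Pl := INR_S_ge_1 l').
        (* A logarithm of [l m y]: the added logarithms are real, so the condition on the imaginary
           part carries over from [L]. *)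
        set (L' := (L + RtoC (ln (INR (S m'))) + RtoC (ln (INR (S l'))))%C).
        assert (HL' : Rabs (Im L') < PI / 2).
        { unfold L'. rewrite !im_plus, !im_RtoC, !Rplus_0_r. assumption. }
        assert (CM := cahen_mellin L' HL').
        set (c := (x ^ S l' * root h k (S l') ^ S m' / RtoC (INR (S l')))%C).
        replace (RtoC (2 * PI) * ((x * u ^ S m') ^ S l' / RtoC (INR (S l'))))%C with
          (c * (RtoC (2 * PI) * Cexp (- Cexp L')))%C.
        + apply (pvint_ext (fun t => c * (CGamma (vline (3 / 2) t) * Cexp (- (vline (3 / 2) t * L'))))%C).
          * intros t. unfold lterm, G. fold c.
            assert (E : Cexp (- (vline (3 / 2) t * L')) = (rpow (INR (S m')) (- vline (3 / 2) t)
              * rpow (INR (S l')) (- vline (3 / 2) t) * Cexp (- (vline (3 / 2) t * L)))%C).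
            { unfold rpow, L'. rewrite <- !Cexp_plus. f_equal. ring. }
            rewrite E. ring.
          * apply pvint_scal; [|exact CM]. intros t. apply (rcont_holo_vline (fun s => CGamma s * Cexp (- (s * L')))%C).
            apply holo_Gamma_exp. rewrite Re_vline. lra.
        + unfold c. rewrite root_pow. unfold L'.
          rewrite !Cexp_plus, !Cexp_R, !exp_ln by lra.
          assert (Eu : ((x * u ^ S m') ^ S l')%C =
            (x ^ S l' * (e2pi (RtoC (INR (S l') * INR (S m')) * hk h k) * Cexp (- (Cexp L * INR (S m') * INR (S l')))))%C).
          { rewrite Cpow_mult_l. f_equal. unfold u. rewrite Cpow_mult_l, Cpow_mult_l.
            rewrite <- !Cpow_mult_r, <- e2pi_nat_mult, <- Cexp_nat. rewrite mult_INR, !RtoC_mult. f_equal; f_equal; ring. }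
          rewrite Eu. unfold Cdiv. ring.
      - exact HV. }
    assert (E : V = (RtoC (2 * PI) * - Clog (1 - x * u ^ S m'))%C).
    { apply (Ccv_unique _ _ _ Ser).
      apply (Ccv_ext (fun n => RtoC (2 * PI) * Csum (fun l' => (x * u ^ S m') ^ S l' / RtoC (INR (S l'))) n)%C).
      - intros n. symmetry. apply Csum_scal.
      - apply Ccv_scal, Clog_series, Hxu. }
    rewrite <- E. exact HV.
  - exact H3.
Qed.

Theorem theorem7 :
  forall (x : C) (h k : nat),
    Cmod x < 1 -> (h < k)%nat -> Nat.gcd h k = 1%nat ->
    exists Q : C -> C,
      is_continuation x h k Q /\
      exists V : C -> Prop,
        locally (T := C_UniformSpace) (e2pi (hk h k)) V /\
        forall z : C,
          0 < Re z ->
          V (e2pi (hk h k + Ci * z)%C) ->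
          j_converges Q z /\
          P x (e2pi (hk h k + Ci * z)%C)
          = (Cexp (w x h k) * Cexp (Psi x k z) * Cexp (j Q z))%C.
Proof.
  intros x h k Hx Hhk Hg. assert (Hk : (0 < k)%nat) by lia.
  exists (Qcont x h k). split; [apply Qcont_is_continuation; assumption|].
  exists (fun _ => True). split; [apply filter_true|].
  intros z Hz _.
  assert (PP := PI_RGT_0). assert (Pk : 0 < INR k) by (apply lt_0_INR; assumption).
  assert (Nz : z <> RtoC 0) by (intros Q; rewrite Q in Hz; simpl in Hz; lra).
  assert (N2 : RtoC (2 * PI) <> RtoC 0) by (intros Q; apply RtoC_inj in Q; lra).
  assert (Nk : RtoC (INR k) <> RtoC 0) by (intros Q; apply RtoC_inj in Q; lra).
  set (y := (RtoC (2 * PI) * z)%C).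
  assert (Hy : 0 < Re y) by (unfold y; rewrite re_scal_l; nra).
  set (L := Clog y).
  assert (HL : Rabs (Im L) < PI / 2) by (apply Clog_right_half_im; assumption).
  assert (EL : Cexp L = y) by (apply Cexp_Clog_right_half; assumption).
  destruct (mellin_integrand_dominated x h k L (3 / 2) Hx Hk HL ltac:(lra) ltac:(lra) ltac:(lra)) as [K3 D3].
  destruct (mellin_integrand_dominated x h k L (- (3 / 4)) Hx Hk HL ltac:(lra) ltac:(lra) ltac:(lra)) as [K4 D4].
  destruct (dominated_pvint _ _ D3) as [v3 H3]. destruct (dominated_pvint _ _ D4) as [v4 H4].
  assert (Sh := mellin_shift x h k L v3 v4 Hx Hk HL H3 H4).
  assert (N1 : mellin_numerator x h k L 1 = Psi x k z).
  { unfold mellin_numerator. rewrite Qnumerator_1 by assumption.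
    (* The numerator contains [Gamma(s + 1)], so the residue at [1] involves [Gamma(2)]. *)
    assert (G2 : CGamma (1 + 1) = RtoC 1).
    { assert (E := CGamma_shift 1 ltac:(simpl; lra) C1_nz). rewrite CGamma_1 in E.
      transitivity (CGamma (1 + 1) / 1)%C; [field; apply C1_nz|symmetry; exact E]. }
    rewrite G2, !Cmult_1_l, Cexp_opp, EL. unfold Psi, y.
    rewrite (RtoC_mult (2 * PI)), RtoC_pow. field. repeat split; assumption. }
  assert (N0 : mellin_numerator x h k L 0 = (- w x h k)%C).
  { unfold mellin_numerator. rewrite Qnumerator_0, Cplus_0_l, CGamma_1, Cmult_0_l by assumption.
    replace (- RtoC 0)%C with (RtoC 0) by ring. rewrite Cexp_0. ring. }
  rewrite N1, N0 in Sh.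
  (* The factor [Ci] of [ds = i dt] later cancels the one in [1 / (2 PI i)], so that [j] is
     [v4 / (2 PI)]. *)
  assert (Ej : forall t, j_integrand (Qcont x h k) z t = (Ci * mellin_integrand x h k L (vline (- (3 / 4)) t))%C).
  { intros t. unfold j_integrand, mellin_integrand, Cpower. cbv zeta. rewrite <- vline_pair.
    fold y. fold L. set (s := vline (- (3 / 4)) t).
    replace (- s * L)%C with (- (s * L))%C by ring. ring. }
  assert (Dj : dominated (j_integrand (Qcont x h k) z) K4).
  { destruct D4 as [A1 A2]. split.
    - intros t. apply (rcont_ext (fun t => Ci * mellin_integrand x h k L (vline (- (3 / 4)) t))%C).
      { intros u. symmetry. apply Ej. }
      apply (rcont_mult (fun _ => Ci)); [apply rcont_const|apply A1].
    - intros t. rewrite Ej, Cmod_mult, Cmod_Ci, Rmult_1_l. apply A2. }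
  assert (Hj : pvint (j_integrand (Qcont x h k) z) (Ci * v4)).
  { apply (pvint_ext (fun t => Ci * mellin_integrand x h k L (vline (- (3 / 4)) t))%C).
    - intros t. symmetry. apply Ej.
    - apply pvint_scal; [apply D4|exact H4]. }
  assert (Rj := dominated_is_RInt_gen _ _ _ Dj Hj).
  split; [eexists; exact Rj|].
  assert (EJ : j (Qcont x h k) z = (v4 / RtoC (2 * PI))%C).
  { unfold j.
    rewrite (@is_RInt_gen_unique C_R_CompleteNormedModule _ _ _ _ _ _ Rj).
    field. split; [assumption|apply Ci_nz]. }
  rewrite EJ.
  set (u := e2pi (hk h k + Ci * z)).
  assert (Eu : u = (e2pi (hk h k) * Cexp (- Cexp L))%C).
  { unfold u. rewrite e2pi_plus, EL. f_equal. unfold e2pi, y. f_equal.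
    assert (E : (Ci * Ci)%C = (- (1))%C) by (apply Ceq_parts; simpl; ring).
    transitivity (RtoC (2 * PI) * (Ci * Ci) * z)%C; [ring|]. rewrite E. ring. }
  assert (Hu : Cmod u < 1).
  { rewrite Eu, Cmod_mult, Cmod_Cexp, re_opp, EL. unfold hk. rewrite Cmod_e2pi_R, Rmult_1_l, <- exp_0.
    apply exp_increasing. lra. }
  assert (Hxu : forall m, Cmod (x * u ^ S m) < 1).
  { intros m. rewrite Cmod_mult. assert (A := Cpow_Cmod_lt_1 u (S m) Hu ltac:(lia)).
    assert (P1 := Cmod_ge_0 x). assert (P2 := Cmod_ge_0 (u ^ S m)). nra. }
  assert (Lim := mellin_line_value x h k L v3 Hx Hk HL ltac:(rewrite EL; assumption) H3).
  rewrite <- Eu in Lim.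
  assert (LS : Ccv (Csum (fun m' => - Clog (1 - x * u ^ S m'))%C) (v3 / RtoC (2 * PI))).
  { apply (Ccv_ext (fun n => / RtoC (2 * PI) * Csum (fun m' => RtoC (2 * PI) * - Clog (1 - x * u ^ S m')) n)%C).
    - intros n. rewrite Csum_scal. field. assumption.
    - eapply Ccv_eq; [apply Ccv_scal, Lim|]. unfold Cdiv. ring. }
  rewrite <- !Cexp_plus.
  (* [Sh] now reads [v3 - v4 = 2 PI (Psi + w)], the two minus signs attached to the pole [0] having
     cancelled. *)
  replace (w x h k + Psi x k z + v4 / RtoC (2 * PI))%C with (v3 / RtoC (2 * PI))%C.
  2:{ replace v3 with ((v3 - v4) + v4)%C by ring. rewrite Sh. field. assumption. }
  (* The partial products are exponentials of partial sums that converge to [v3 / (2 PI)];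
     continuity of [Cexp] finishes without choosing a logarithm of [P]. *)
  unfold P. apply Ccv_Clim_seq.
  apply (Ccv_ext (fun n => Cexp (Csum (fun m' => - Clog (1 - x * u ^ S m')) n)%C)).
  { intros n. symmetry. apply (Cprod_inv_one_minus (fun j => x * u ^ S j)%C). exact Hxu. }
  intros e He. destruct (Ccont_holo Cexp (v3 / RtoC (2 * PI)) (holo_Cexp _) e He) as [d [Hd Hc]].
  destruct (LS d Hd) as [M HM]. exists M. intros n Hn. apply Hc, HM, Hn.
Qed.
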